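(* There is an algorithm which, given an instance $(F,L,l,k)$ of the parameterized 2-ASLASAT problem, outputs a culprit set of $(F,L,l)$ of size at most $k$ if one exists and outputs 'NO' otherwise, in time $O(5^k\cdot k\cdot(n+k)\cdot(m+|L|))$, where $n=|Var(F)|$ and $m=|Clauses(F)|$.
   Context: A literal is a Boolean variable or its negation; $\neg$ denotes negation ($\neg\neg x=x$), and for a set $L$ of literals $\neg L=\{\neg l': l'\in L\}$. $Var(l)$, $Var(L)$, $Var(F)$ denote the sets of variables of a literal, a set of literals, a formula. A 2-CNF formula $F$ is a conjunction of clauses each consisting of exactly two literals (a one-literal clause $(l)$ is written $(l\vee l)$; $(l_1\vee l_2)$ and $(l_2\vee l_1)$ are the same clause); the clauses of $F$ are assumed pairwise distinct, so $F$ is identified with its set of clauses $Clauses(F)$, and for a set $S$ of clauses $F\setminus S$ is the formula consisting of the clauses of $F$ not in $S$. A set of literals is non-contradictory if it contains no literal together with its negation. A satisfying assignment of $F$ is a non-contradictory set $P$ of literals with $Var(P)=Var(F)$ such that each clause of $F$ contains a literal of $P$. $SWRT(F,L)$ means that $F$ has a satisfying assignment $P$ with $P\cap\neg L=\emptyset$. An instance of the parameterized 2-ASLASAT problem is $(F,L,l,k)$ where $F$ is such a 2-CNF formula, $L$ is a non-contradictory set of literals with $SWRT(F,L)$ true, $l$ is a literal with $Var(l)\notin Var(L)$, and $k\ge 0$ is an integer. A culprit set (CS) of $(F,L,l)$ is a set $S\subseteq Clauses(F)$ such that $SWRT(F\setminus S, L\cup\{l\})$ is true. The input is assumed given in any reasonable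 representation (e.g. by the implication graph of $F$ with the literals of $L$, $\neg L$, $l$, $\neg l$ marked). *)

(* Defs.v *)
From mathcomp Require Import all_boot finmap.

Set Implicit Arguments.
Unset Strict Implicit.
Unset Printing Implicit Defensive.

Local Open Scope fset_scope.

(* (x, true) is the variable x, (x, false) its negation. *)
Definition literal : Type := (nat * bool)%type.

Definition neg (a : literal) : literal := (a.1, ~~ a.2).

Definition negs (L : {fset literal}) : {fset literal} := [fset neg a | a in L].

Definition var (a : literal) : nat := a.1.

Definition vars (L : {fset literal}) : {fset nat} := [fset var a | a in L].

(* The clause (a \/ b) is the unordered pair {a, b}; (a \/ a) is {a}. *)
Definition clause : Type := {fset literal}.

Definition mkclause (p : literal * literal) : clause := [fset p.1; p.2].

Definition formula : Type := {fset clause}.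

Definition is_2cnf (F : formula) : Prop :=
  forall c : clause, c \in F -> exists a b : literal, c = mkclause (a, b).

Definition fvars (F : formula) : {fset nat} :=
  \bigcup_(c <- enum_fset F) vars c.

Definition noncontradictory (P : {fset literal}) : Prop :=
  forall a : literal, a \in P -> neg a \notin P.

Definition satisfying_assignment (F : formula) (P : {fset literal}) : Prop :=
  [/\ noncontradictory P,
      vars P = fvars F
    & forall c : clause, c \in F -> exists2 a : literal, a \in c & a \in P].

Definition SWRT (F : formula) (L : {fset literal}) : Prop :=
  exists2 P : {fset literal},
    satisfying_assignment F P & P `&` negs L = fset0.

Definition aslasat_instance (F : formula) (L : {fset literal}) (l : literal) :
    Prop :=
  [/\ is_2cnf F, noncontradictory L, SWRT F L & var l \notin vars L].

Definition culprit_set (F : formula) (L : {fset literal}) (l : literal)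
    (S : {fset clause}) : Prop :=
  S `<=` F /\ SWRT (F `\` S) (L `|` [fset l]).

(* Uniform-cost random access machine with addition and truncated subtraction
   as its only arithmetic, presented with structured control flow.  A program
   mentions finitely many registers; memory cells are addressed by registers. *)
Inductive cmd : Type :=
| Skip
| Const (x c : nat)
| Move (x y : nat)
| Add (x y z : nat)
| Sub (x y z : nat)
| Read (x y : nat)
| Write (x y : nat)
| Seq (p q : cmd)
| If (x : nat) (p q : cmd)
| While (x : nat) (p : cmd).

Record state : Type := State { reg : nat -> nat; mem : nat -> nat }.

Definition upd (f : nat -> nat) (i v : nat) : nat -> nat :=
  fun j => if j == i then v else f j.

Definition setr (s : state) (x v : nat) : state :=
  State (upd (reg s) x v) (mem s).

(* exec p s s' t: from s, the program p halts in s' after exactly t steps, a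
   step being an elementary instruction or a test of an If or a While. *)
Inductive exec : cmd -> state -> state -> nat -> Prop :=
| exec_Skip s : exec Skip s s 1
| exec_Const s x c : exec (Const x c) s (setr s x c) 1
| exec_Move s x y : exec (Move x y) s (setr s x (reg s y)) 1
| exec_Add s x y z : exec (Add x y z) s (setr s x (reg s y + reg s z)) 1
| exec_Sub s x y z : exec (Sub x y z) s (setr s x (reg s y - reg s z)) 1
| exec_Read s x y : exec (Read x y) s (setr s x (mem s (reg s y))) 1
| exec_Write s x y :
    exec (Write x y) s (State (reg s) (upd (mem s) (reg s x) (reg s y))) 1
| exec_Seq p q s1 s2 s3 t1 t2 :
    exec p s1 s2 t1 -> exec q s2 s3 t2 -> exec (Seq p q) s1 s3 (t1 + t2)
| exec_IfT x p q s s' t :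
    reg s x != 0 -> exec p s s' t -> exec (If x p q) s s' t.+1
| exec_IfF x p q s s' t :
    reg s x = 0 -> exec q s s' t -> exec (If x p q) s s' t.+1
| exec_WhileT x p s1 s2 s3 t1 t2 :
    reg s1 x != 0 -> exec p s1 s2 t1 -> exec (While x p) s2 s3 t2 ->
    exec (While x p) s1 s3 (t1 + t2).+1
| exec_WhileF x p s : reg s x = 0 -> exec (While x p) s s 1.

Lemma exec_det p s s1 s2 t1 t2 :
  exec p s s1 t1 -> exec p s s2 t2 -> s1 = s2 /\ t1 = t2.
Proof.
move=> H; elim: H s2 t2 => {p s s1 t1}; intros;
  match goal with H : exec _ _ _ _ |- _ /\ _ => inversion H; subst => // end;
  repeat match goal with
  | IH : forall s t, exec ?p ?s s t -> _, H : exec ?p ?s _ _ |- _ =>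
      case: (IH _ _ H) => ? ?; subst; clear H
  end => //;
  by match goal with h : is_true (_ != 0), e : _ = 0 |- _ => rewrite e in h end.
Qed.

(* A literal takes two words: its variable and its sign. *)
Definition code_literal (a : literal) : seq nat := [:: a.1; nat_of_bool a.2].

Definition code_literals (s : seq literal) : seq nat :=
  flatten [seq code_literal a | a <- s].

Definition code_clauses (s : seq (literal * literal)) : seq nat :=
  flatten [seq code_literal p.1 ++ code_literal p.2 | p <- s].

(* Each clause of S is listed once, with its literals in either order. *)
Definition lists_clauses (s : seq (literal * literal)) (S : {fset clause}) :
    Prop :=
  uniq [seq mkclause p | p <- s] /\ [seq mkclause p | p <- s] =i S.

Definition lists_literals (s : seq literal) (L : {fset literal}) : Prop :=
  uniq s /\ s =i L.

Definition represents (w : seq nat) (F : formula) (L : {fset literal})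
    (l : literal) (k : nat) : Prop :=
  exists (cs : seq (literal * literal)) (ls : seq literal),
    [/\ lists_clauses cs F, lists_literals ls L
      & w = [:: k; size cs; size ls] ++ code_literal l
            ++ code_clauses cs ++ code_literals ls].

Definition init (w : seq nat) : state :=
  State (fun _ => 0) (fun i => nth 0 w i).

Definition outputs_no (s : state) : Prop := mem s 0 = 0.

Definition outputs_set (s : state) (S : {fset clause}) : Prop :=
  exists cs : seq (literal * literal),
    lists_clauses cs S /\
    forall i : nat, i < size ([:: 1; size cs] ++ code_clauses cs) ->
      mem s i = nth 0 ([:: 1; size cs] ++ code_clauses cs) i.

(* The factors of 5^k * k * (n + k) * (m + |L|), with those that can vanish
   replaced by 1 when they do: no machine halts in 0 steps, and k = 0 still
   requires deciding SWRT(F, L + l). *)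
Definition time_bound (F : formula) (L : {fset literal}) (k : nat) : nat :=
  5 ^ k * maxn 1 k * maxn 1 (#|` fvars F| + k) * maxn 1 (#|` F| + #|` L|).

(* Main.v *)
From Stdlib Require Import FunctionalExtensionality.
From mathcomp Require Import all_boot finmap zify.
Require Import Defs.

(* Relative to a satisfying assignment A of F that respects L, a clause with one
   true literal is an arc between variables and a clause with two true literals
   is an edge.  If A does not already contain l, a culprit set is then the set
   of clauses broken by a set Z of flipped variables with Var(l) in Z and
   Z disjoint from Var(L): the arcs entering Z and the edges inside Z.  Bounding
   the in-degree of Z below by a flow, and uncrossing any Z with the smallest
   minimum cut Q, one may assume that Z is contained in Q; a broken clause of Q
   is either deleted or has an endpoint added to L, which increases the flow.
   The search tree then has O(5^k) nodes, each costing at most k + 1 augmentations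
   found by O(n) scans of the clauses.  The assignment A itself takes O(n) scans:
   the closures of a literal and of its negation are computed in parallel. *)

Set Implicit Arguments.
Unset Strict Implicit.
Unset Printing Implicit Defensive.

(** The time claim concerns an explicit machine, so each loop needs a bound fixed before it starts.
    Hence a language with counted loops only: [run] is total, the cost is read off the syntax, and
    the recursion becomes a stack driven by [20 * 5^k] micro-steps, each costing about one flow
    computation. The base 5 comes from the weight [5^K / 3^f] of a node, where [K] is the remaining
    budget plus one and [f] the minimum cut. At an arc, deletion multiplies the weight by at most
    3/5 (the budget drops by one, the cut by at most one) and the other branch by 1/3; at an edge,
    deletion gives 1/5 (the cut stays) and each endpoint 1/3. The sums 14/15 and 13/15 are below 1.
    With base 4 the arc would force 2 in place of 3, and then the edge fails. Variables are
    arbitrary numbers, so no table indexed by them can be swept within the bound; all clearing and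
    searching goes through the clauses. *)

Inductive exp : Type :=
| Cst (c : nat)
| Reg (x : nat)
| Plus (e1 e2 : exp)
| Minus (e1 e2 : exp)
| Arr (a : nat) (e : exp).

Inductive hl : Type :=
| HSkip
| HSet (x : nat) (e : exp)
| HStore (a : nat) (e1 e2 : exp)
| HSeq (p q : hl)
| HIf (e : exp) (p q : hl)
| HFor (x n : nat) (p : hl).

Record hstate : Type := HState { rg : nat -> nat; ar : nat -> nat -> nat }.

Definition hset (s : hstate) (x v : nat) : hstate := HState (upd (rg s) x v) (ar s).

Definition hstore (s : hstate) (a i v : nat) : hstate :=
  HState (rg s) (fun b => if b == a then upd (ar s b) i v else ar s b).

(** * Semantics and syntactic cost of counted loops *)

Fixpoint ev (e : exp) (s : hstate) : nat :=
  match e with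
  | Cst c => c
  | Reg x => rg s x
  | Plus e1 e2 => ev e1 s + ev e2 s
  | Minus e1 e2 => ev e1 s - ev e2 s
  | Arr a e => ar s a (ev e s)
  end.

(** A [HFor] reads its bound once and sets its index register afresh at every turn, so a body that
    overwrites either cannot change the number of turns. This makes the recursion structural. *)
Fixpoint run (c : hl) (s : hstate) : hstate :=
  match c with
  | HSkip => s
  | HSet x e => hset s x (ev e s)
  | HStore a e1 e2 => hstore s a (ev e1 s) (ev e2 s)
  | HSeq p q => run q (run p s)
  | HIf e p q => if ev e s != 0 then run p s else run q s
  | HFor x n p => foldl (fun s i => run p (hset s x i)) s (iota 0 (rg s n))
  end.

(** These are exact machine counts: the 9 for an array access is five doublings, one constant, two
    additions and the memory instruction. *)
Fixpoint ecost (e : exp) : nat :=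
  match e with
  | Cst _ | Reg _ => 1
  | Plus e1 e2 | Minus e1 e2 => ecost e1 + ecost e2 + 1
  | Arr _ e => ecost e + 9
  end.

(* [v x] bounds the contents of the loop-bound register [x]. *)
Fixpoint scost (c : hl) (v : nat -> nat) : nat :=
  match c with
  | HSkip => 1
  | HSet x e => ecost e + 1
  | HStore a e1 e2 => ecost e1 + ecost e2 + 9
  | HSeq p q => scost p v + scost q v
  | HIf e p q => ecost e + 1 + maxn (scost p v) (scost q v)
  | HFor x n p => 3 + v n * (scost p v + 5)
  end.

Fixpoint wregs (c : hl) : seq nat :=
  match c with
  | HSkip | HStore _ _ _ => [::]
  | HSet x _ => [:: x]
  | HSeq p q | HIf _ p q => wregs p ++ wregs q
  | HFor x _ p => x :: wregs p
  end.

Fixpoint warrs (c : hl) : seq nat :=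
  match c with
  | HSkip | HSet _ _ => [::]
  | HStore a _ _ => [:: a]
  | HSeq p q | HIf _ p q => warrs p ++ warrs q
  | HFor _ _ p => warrs p
  end.

Fixpoint bregs (c : hl) : seq nat :=
  match c with
  | HSkip | HSet _ _ | HStore _ _ _ => [::]
  | HSeq p q | HIf _ p q => bregs p ++ bregs q
  | HFor _ n p => n :: bregs p
  end.

Lemma foldl_inv (T : Type) (f : T -> nat -> T) (P : nat -> T -> Prop) (s : T) (n : nat) :
  P 0 s -> (forall i t, i < n -> P i t -> P i.+1 (f t i)) ->
  P n (foldl f s (iota 0 n)).
Proof.
move=> P0 Pn.
suff H j : j <= n -> P j (foldl f s (iota 0 j)) by exact: H.
elim: j => // j IH jn; rewrite -addn1 iotaD foldl_cat /= add0n addn1.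
by apply: Pn => //; apply: IH; apply: ltnW.
Qed.

Lemma run_reg (c : hl) (s : hstate) (x : nat) : x \notin wregs c -> rg (run c s) x = rg s x.
Proof.
elim: c s => [|y e|a e1 e2|p IHp q IHq|e p IHp q IHq|y n p IHp] s //=.
- by rewrite inE /upd => /negPf ->.
- by rewrite mem_cat negb_or => /andP[hp hq]; rewrite IHq // IHp.
- by rewrite mem_cat negb_or => /andP[hp hq]; case: ifP => _; [apply: IHp | apply: IHq].
- rewrite inE negb_or => /andP[/negPf hy hp].
  apply: (foldl_inv (P := fun _ t => rg t x = rg s x)) => // i t _ <-.
  by rewrite IHp //= /upd hy.
Qed.

Lemma run_arr (c : hl) (s : hstate) (a : nat) : a \notin warrs c -> ar (run c s) a = ar s a.
Proof.
elim: c s => [|y e|b e1 e2|p IHp q IHq|e p IHp q IHq|y n p IHp] s //=.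
- by rewrite inE => /negPf ->.
- by rewrite mem_cat negb_or => /andP[hp hq]; rewrite IHq // IHp.
- by rewrite mem_cat negb_or => /andP[hp hq]; case: ifP => _; [apply: IHp | apply: IHq].
- move=> hp; apply: (foldl_inv (P := fun _ t => ar t a = ar s a)) => // i t _ <-.
  by rewrite IHp.
Qed.

(** The step may also use that whatever the body does not write still has its value from before the
    loop, so the invariants below mention only what changes. *)
Lemma for_inv (P : nat -> hstate -> Prop) (x n : nat) (p : hl) (s : hstate) :
  P 0 s ->
  (forall i t, i < rg s n -> P i t ->
     (forall y, y \notin x :: wregs p -> rg t y = rg s y) ->
     (forall a, a \notin warrs p -> ar t a = ar s a) ->
     P i.+1 (run p (hset t x i))) ->
  P (rg s n) (run (HFor x n p) s).
Proof.
move=> P0 PS /=.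
pose Q i t := [/\ P i t, forall y, y \notin x :: wregs p -> rg t y = rg s y
  & forall a, a \notin warrs p -> ar t a = ar s a].
suff [] : Q (rg s n) (foldl (fun s i => run p (hset s x i)) s (iota 0 (rg s n))) by [].
apply: (foldl_inv (P := Q)); first by split.
move=> i t hi [hP hr ha]; split; first exact: PS.
- move=> y; rewrite inE negb_or => /andP[hy hp].
  by rewrite run_reg //= /upd (negPf hy) hr // inE negb_or hy.
- by move=> a h; rewrite run_arr //= ha.
Qed.

(** * Compilation *)

(* Machine register 0 holds the base address of the arrays, 4j with j > 0 are
   temporaries, 4j+2 serve the loops, and 2x+1 is the register x. *)
Definition tmp (j : nat) : nat := 4 * j.+1.
Definition lcnt (d : nat) : nat := 8 * d + 2.
Definition lidx (d : nat) : nat := 8 * d + 6.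
Definition hreg (x : nat) : nat := (2 * x).+1.

Definition seqs (ps : seq cmd) : cmd := foldr Seq Skip ps.

Fixpoint cexp (j : nat) (e : exp) : cmd :=
  match e with
  | Cst c => Const (tmp j) c
  | Reg x => Move (tmp j) (hreg x)
  | Plus e1 e2 => Seq (cexp j e1) (Seq (cexp j.+1 e2) (Add (tmp j) (tmp j) (tmp j.+1)))
  | Minus e1 e2 => Seq (cexp j e1) (Seq (cexp j.+1 e2) (Sub (tmp j) (tmp j) (tmp j.+1)))
  | Arr a e =>
      let dbl := Add (tmp j) (tmp j) (tmp j) in
      Seq (cexp j e) (Seq dbl (Seq dbl (Seq dbl (Seq dbl (Seq dbl
        (Seq (Const (tmp j.+1) a) (Seq (Add (tmp j) (tmp j) (tmp j.+1))
        (Seq (Add (tmp j) (tmp j) 0) (Read (tmp j) (tmp j))))))))))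
  end.

(** The loop at depth [d] keeps its counter and its index in machine registers that no source
    program can name and no deeper loop uses. The temporaries need no protection, since nothing is
    kept in them across commands. *)
Fixpoint comp (d : nat) (c : hl) : cmd :=
  match c with
  | HSkip => Skip
  | HSet x e => Seq (cexp 0 e) (Move (hreg x) (tmp 0))
  | HStore a e1 e2 =>
      let dbl := Add (tmp 0) (tmp 0) (tmp 0) in
      Seq (cexp 0 e1) (Seq dbl (Seq dbl (Seq dbl (Seq dbl (Seq dbl
        (Seq (Const (tmp 1) a) (Seq (Add (tmp 0) (tmp 0) (tmp 1))
        (Seq (Add (tmp 0) (tmp 0) 0) (Seq (cexp 1 e2) (Write (tmp 0) (tmp 1)))))))))))
  | HSeq p q => Seq (comp d p) (comp d q)
  | HIf e p q => Seq (cexp 0 e) (If (tmp 0) (comp d p) (comp d q))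
  | HFor x n p =>
      Seq (Move (lcnt d) (hreg n)) (Seq (Const (lidx d) 0)
        (While (lcnt d)
          (Seq (Move (hreg x) (lidx d)) (Seq (comp d.+1 p)
            (Seq (Const (tmp 0) 1) (Seq (Add (lidx d) (lidx d) (tmp 0))
              (Sub (lcnt d) (lcnt d) (tmp 0))))))))
  end.

(** The 32 arrays are interleaved above the address [b], so that all of them are unbounded inside
    one memory. The stride is a power of two because the machine has no multiplication and addresses
    are formed by doubling. *)
Definition simulates (b : nat) (s : state) (h : hstate) : Prop :=
  [/\ reg s 0 = b, forall x, reg s (hreg x) = rg h x
    & forall a i, a < 32 -> mem s (b + 32 * i + a) = ar h a i].

Fixpoint ewf (e : exp) : bool :=
  match e with
  | Cst _ | Reg _ => true
  | Plus e1 e2 | Minus e1 e2 => ewf e1 && ewf e2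
  | Arr a e => (a < 32) && ewf e
  end.

Fixpoint hwf (c : hl) : bool :=
  match c with
  | HSkip => true
  | HSet _ e => ewf e
  | HStore a e1 e2 => [&& a < 32, ewf e1 & ewf e2]
  | HSeq p q => hwf p && hwf q
  | HIf e p q => [&& ewf e, hwf p & hwf q]
  | HFor _ _ p => hwf p
  end.

Lemma updE (f : nat -> nat) (i v j : nat) : upd f i v j = if j == i then v else f j.
Proof. by []. Qed.

Lemma upd_same (f : nat -> nat) (i v : nat) : upd f i v i = v.
Proof. by rewrite updE eqxx. Qed.

Lemma upd_other (f : nat -> nat) (i v j : nat) : j <> i -> upd f i v j = f j.
Proof. by rewrite updE => /eqP /negPf ->. Qed.

Lemma simulates_reg (b : nat) (s s' : state) (h : hstate) :
  simulates b s h -> mem s' = mem s ->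
  (forall r, (r = 0 \/ exists x, r = hreg x) -> reg s' r = reg s r) ->
  simulates b s' h.
Proof.
case=> h0 hr hm em er; split; first by rewrite er //; left.
- by move=> x; rewrite er //; right; exists x.
- by move=> a i; rewrite em; apply: hm.
Qed.

Lemma cexp_correct (b : nat) (h : hstate) (e : exp) (j : nat) (s : state) :
  ewf e -> simulates b s h ->
  exists s', [/\ exec (cexp j e) s s' (ecost e), reg s' (tmp j) = ev e h,
    mem s' = mem s & forall r, (forall i, j <= i -> r <> tmp i) -> reg s' r = reg s r].
Proof.
elim: e j s => [c|x|e1 IH1 e2 IH2|e1 IH1 e2 IH2|a e IH] j s /=.
- move=> _ _; exists (setr s (tmp j) c); split; first exact: exec_Const.
  + by rewrite /= upd_same.
  + by [].
  + by move=> r hr /=; rewrite upd_other //; apply: hr.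
- move=> _ [h0 hr hm]; exists (setr s (tmp j) (reg s (hreg x))); split; first exact: exec_Move.
  + by rewrite /= upd_same.
  + by [].
  + by move=> r hr' /=; rewrite upd_other //; apply: hr'.
- case/andP=> w1 w2 hs; have [s1 [X1 v1 m1 r1]] := IH1 j s w1 hs.
  have hs1 : simulates b s1 h.
    by apply: (simulates_reg hs) => // r hr; apply: r1 => i _; rewrite /tmp; case: hr => [->|[x ->]]; rewrite /hreg; lia.
  have [s2 [X2 v2 m2 r2]] := IH2 j.+1 s1 w2 hs1.
  exists (setr s2 (tmp j) (reg s2 (tmp j) + reg s2 (tmp j.+1))); split.
  + by rewrite -addnA; do 2 (apply: exec_Seq; eauto); apply: exec_Add.
  + by rewrite /= upd_same v2 r2 ?v1 // => i ji; rewrite /tmp; lia.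
  + by rewrite /= m2.
  + move=> r hr /=; rewrite upd_other; last exact: hr.
    by rewrite r2 ?r1 // => i ji; apply: hr; lia.
- case/andP=> w1 w2 hs; have [s1 [X1 v1 m1 r1]] := IH1 j s w1 hs.
  have hs1 : simulates b s1 h.
    by apply: (simulates_reg hs) => // r hr; apply: r1 => i _; rewrite /tmp; case: hr => [->|[x ->]]; rewrite /hreg; lia.
  have [s2 [X2 v2 m2 r2]] := IH2 j.+1 s1 w2 hs1.
  exists (setr s2 (tmp j) (reg s2 (tmp j) - reg s2 (tmp j.+1))); split.
  + by rewrite -addnA; do 2 (apply: exec_Seq; eauto); apply: exec_Sub.
  + by rewrite /= upd_same v2 r2 ?v1 // => i ji; rewrite /tmp; lia.
  + by rewrite /= m2.
  + move=> r hr /=; rewrite upd_other; last exact: hr.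
    by rewrite r2 ?r1 // => i ji; apply: hr; lia.
- case/andP=> wa w hs; have [s1 [X1 v1 m1 r1]] := IH j s w hs.
  have hs1 : simulates b s1 h.
    by apply: (simulates_reg hs) => // r hr; apply: r1 => i _; rewrite /tmp; case: hr => [->|[x ->]]; rewrite /hreg; lia.
  have e0 i : (0 == tmp i) = false by rewrite /tmp; lia.
  have e1 : (tmp j == tmp j.+1) = false by rewrite /tmp; lia.
  eexists; split.
  + have -> : ecost e + 9 = ecost e + (1 + (1 + (1 + (1 + (1 + (1 + (1 + (1 + 1)))))))) by [].
    apply: exec_Seq; first exact: X1.
    by do 8 (apply: exec_Seq; first by constructor); constructor.
  + rewrite /= upd_same !updE ?eqxx ?e0 ?e1 ?eqxx v1; case: hs1 => -> _ <- //.
    by congr (mem _ _); lia.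
  + by rewrite /= m1.
  + move=> r hr /=; rewrite !upd_other ?r1 //; try (by apply: hr; lia).
Qed.

(** In a loop, 5 counts the test, the copy of the index and the three instructions that update index
    and counter; 3 counts the two initialisations and the last, failing test. *)
Fixpoint cost (c : hl) (s : hstate) : nat :=
  match c with
  | HSkip => 1
  | HSet x e => ecost e + 1
  | HStore a e1 e2 => ecost e1 + ecost e2 + 9
  | HSeq p q => cost p s + cost q (run p s)
  | HIf e p q => ecost e + 1 + (if ev e s != 0 then cost p s else cost q s)
  | HFor x n p =>
      3 + (foldl (fun st i => (run p (hset st.1 x i), st.2 + (cost p (hset st.1 x i) + 5)))
                 (s, 0) (iota 0 (rg s n))).2
  end.

Lemma comp_correct (b : nat) (c : hl) (d : nat) (s : state) (h : hstate) :
  hwf c -> simulates b s h ->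
  exists s', [/\ exec (comp d c) s s' (cost c h), simulates b s' (run c h),
    (forall i, i < d -> reg s' (lcnt i) = reg s (lcnt i) /\ reg s' (lidx i) = reg s (lidx i))
    & forall i, i < b -> mem s' i = mem s i].
Proof.
elim: c d s h => [|x e|a e1 e2|p IHp q IHq|e p IHp q IHq|x n p IHp] d s h /=.
- by move=> _ hs; exists s; split=> //; constructor.
- move=> w hs; have [s1 [X1 v1 m1 r1]] := cexp_correct 0 w hs.
  exists (setr s1 (hreg x) (reg s1 (tmp 0))); split.
  + by apply: exec_Seq X1 _; constructor.
  + case: hs => h0 hr hm; split=> /=.
    * by rewrite upd_other ?r1 // /hreg /tmp; lia.
    * move=> y; rewrite v1 !updE; have -> : (hreg y == hreg x) = (y == x) by rewrite /hreg; lia.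
      by case: ifP => // _; rewrite r1 ?hr // => i _; rewrite /hreg /tmp; lia.
    * by move=> a i; rewrite m1; apply: hm.
  + by move=> i _; rewrite /= !upd_other ?r1 // /lcnt /lidx /hreg /tmp; lia.
  + by move=> i _ /=; rewrite m1.
- case/and3P=> wa w1 w2 hs; have [s1 [X1 v1 m1 r1]] := cexp_correct 0 w1 hs.
  have e0 i : (0 == tmp i) = false by rewrite /tmp; lia.
  have e1' : (tmp 0 == tmp 1) = false by [].
  pose s2 := let dbl s := setr s (tmp 0) (reg s (tmp 0) + reg s (tmp 0)) in
    let s2 := dbl (dbl (dbl (dbl (dbl s1)))) in
    let s3 := setr s2 (tmp 1) a in
    let s4 := setr s3 (tmp 0) (reg s3 (tmp 0) + reg s3 (tmp 1)) in
    setr s4 (tmp 0) (reg s4 (tmp 0) + reg s4 0).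
  have r2 r : (forall i, r <> tmp i) -> reg s2 r = reg s r.
    by move=> hr; rewrite /s2 /= !upd_other ?r1 // => i _; apply: hr.
  have hs2 : simulates b s2 h.
    apply: (simulates_reg hs) => [|r hr]; first by rewrite -m1.
    by apply: r2 => i; rewrite /tmp; case: hr => [->|[x ->]]; rewrite /hreg; lia.
  have v2 : reg s2 (tmp 0) = b + 32 * ev e1 h + a.
    rewrite /s2 /= !updE ?eqxx ?e0 ?e1' v1 r1; last by move=> i _; rewrite /tmp; lia.
    case: hs => -> _ _; lia.
  have [s3 [X3 v3 m3 r3]] := cexp_correct 1 w2 hs2.
  exists (State (reg s3) (upd (mem s3) (reg s3 (tmp 0)) (reg s3 (tmp 1)))); split.
  + have -> : ecost e1 + ecost e2 + 9 =
      ecost e1 + (1 + (1 + (1 + (1 + (1 + (1 + (1 + (1 + (ecost e2 + 1))))))))) by lia.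
    apply: exec_Seq; first exact: X1.
    do 8 (apply: exec_Seq; first by constructor).
    by apply: exec_Seq; first exact: X3; constructor.
  + have v4 : reg s3 (tmp 0) = b + 32 * ev e1 h + a by rewrite r3 // => i i1; rewrite /tmp; lia.
    case: hs2 => h0 hr hm; split=> /=.
    * by rewrite r3 // => i _; rewrite /tmp; lia.
    * by move=> x; rewrite r3 // => i _; rewrite /tmp /hreg; lia.
    * move=> c i hc; rewrite v3 v4 m3 updE.
      have -> : (b + 32 * i + c == b + 32 * ev e1 h + a) = (c == a) && (i == ev e1 h) by lia.
      case: eqP => /= [ca|_]; last exact: hm.
      by rewrite updE; case: eqP => // _; exact: hm.
  + by move=> i _; rewrite /= !r3 ?r2 //; move=> *; rewrite /lcnt /lidx /tmp; lia.
  + move=> i hi /=; rewrite m3 upd_other; first by rewrite /s2 /= m1.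
    by rewrite r3 ?v2; [lia|move=> *; rewrite /tmp; lia].
- case/andP=> wp wq hs; have [s1 [X1 S1 L1 M1]] := IHp d s h wp hs.
  have [s2 [X2 S2 L2 M2]] := IHq d s1 _ wq S1.
  exists s2; split=> //; first exact: exec_Seq X1 X2.
  + by move=> i hi; have [-> ->] := L2 i hi; apply: L1.
  + by move=> i hi; rewrite M2 // M1.
- case/and3P=> we wp wq hs; have [s1 [X1 v1 m1 r1]] := cexp_correct 0 we hs.
  have hs1 : simulates b s1 h.
    by apply: (simulates_reg hs) => // r hr; apply: r1 => i _; rewrite /tmp; case: hr => [->|[x ->]]; rewrite /hreg; lia.
  have L1 i : reg s1 (lcnt i) = reg s (lcnt i) /\ reg s1 (lidx i) = reg s (lidx i).
    by rewrite !r1 //; move=> *; rewrite /lcnt /lidx /tmp; lia.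
  case: ifPn => he.
  + have [s2 [X2 S2 L2 M2]] := IHp d s1 h wp hs1; exists s2; split=> //.
    * rewrite -addnA add1n; apply: exec_Seq X1 _; apply: exec_IfT => //; by rewrite v1.
    * by move=> i hi; have [<- <-] := L1 i; apply: L2.
    * by move=> i hi; rewrite M2 // m1.
  + have [s2 [X2 S2 L2 M2]] := IHq d s1 h wq hs1; exists s2; split=> //.
    * rewrite -addnA add1n; apply: exec_Seq X1 _; apply: exec_IfF => //; rewrite v1; lia.
    * by move=> i hi; have [<- <-] := L1 i; apply: L2.
    * by move=> i hi; rewrite M2 // m1.
- move=> wp hs.
  (* The number of turns left and the current index are generalised independently: the machine
     counts one register down to 0 and the other up. *)
  have loop N i0 s1 h1 : simulates b s1 h1 -> reg s1 (lcnt d) = N -> reg s1 (lidx d) = i0 ->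
    exists s', [/\ exec (While (lcnt d)
          (Seq (Move (hreg x) (lidx d)) (Seq (comp d.+1 p)
            (Seq (Const (tmp 0) 1) (Seq (Add (lidx d) (lidx d) (tmp 0))
              (Sub (lcnt d) (lcnt d) (tmp 0))))))) s1 s'
         (1 + (foldl (fun st i => (run p (hset st.1 x i), st.2 + (cost p (hset st.1 x i) + 5)))
                 (h1, 0) (iota i0 N)).2),
      simulates b s' (foldl (fun s i => run p (hset s x i)) h1 (iota i0 N)),
      (forall i, i < d -> reg s' (lcnt i) = reg s1 (lcnt i) /\ reg s' (lidx i) = reg s1 (lidx i))
      & forall i, i < b -> mem s' i = mem s1 i].
    elim: N i0 s1 h1 => [|N IHN] i0 s1 h1 hs1 hc hi.
      by exists s1; split=> //=; rewrite addn0; apply: exec_WhileF.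
    have hs2 : simulates b (setr s1 (hreg x) i0) (hset h1 x i0).
      case: hs1 => k0 kr km; split=> //=.
      move=> y; rewrite !updE; have -> : (hreg y == hreg x) = (y == x) by rewrite /hreg; lia.
      by case: ifP.
    have [s3 [X3 S3 L3 M3]] := IHp d.+1 _ _ wp hs2.
    have [lc3 li3] := L3 d (ltnSn d).
    pose s4 := setr s3 (tmp 0) 1.
    pose s5 := setr s4 (lidx d) (reg s4 (lidx d) + reg s4 (tmp 0)).
    pose s6 := setr s5 (lcnt d) (reg s5 (lcnt d) - reg s5 (tmp 0)).
    have r6 r : r <> tmp 0 -> r <> lidx d -> r <> lcnt d -> reg s6 r = reg s3 r.
      by move=> *; rewrite /= !upd_other.
    have S6 : simulates b s6 (run p (hset h1 x i0)).
      apply: (simulates_reg S3) => // r hr.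
      by apply: r6; case: hr => [->|[y ->]]; rewrite /tmp /lidx /lcnt /hreg; lia.
    have c6 : reg s6 (lcnt d) = N.
      rewrite /= upd_same !updE lc3 /= !updE ?eqxx.
      have -> : (lcnt d == lidx d) = false by rewrite /lcnt /lidx; lia.
      have -> : (lcnt d == tmp 0) = false by rewrite /lcnt /tmp; lia.
      have -> : (lcnt d == hreg x) = false by rewrite /lcnt /hreg; lia.
      have -> : (tmp 0 == lidx d) = false by rewrite /lidx /tmp; lia.
      by rewrite hc; lia.
    have i6 : reg s6 (lidx d) = i0.+1.
      rewrite /= !updE ?eqxx li3 /= !updE.
      have -> : (lidx d == lcnt d) = false by rewrite /lcnt /lidx; lia.
      have -> : (lidx d == tmp 0) = false by rewrite /lidx /tmp; lia.
      have -> : (lidx d == hreg x) = false by rewrite /lidx /hreg; lia.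
      by rewrite hi; lia.
    have [s' [X' S' L' M']] := IHN i0.+1 s6 _ S6 c6 i6.
    exists s'; split.
    + pose f (st : hstate * nat) i := (run p (hset st.1 x i), st.2 + (cost p (hset st.1 x i) + 5)).
      have shift h2 c0 js : (foldl f (h2, c0) js).2 = c0 + (foldl f (h2, 0) js).2.
        elim: js h2 c0 => [|i js IH] h2 c0 /=; first by rewrite addn0.
        have fE a c j : f (a, c) j = (run p (hset a x j), c + (cost p (hset a x j) + 5)) by [].
        by rewrite !fE (IH _ (c0 + _)) (IH _ (0 + _)) add0n !addnA.
      rewrite -/f in X' *; rewrite /= shift /= add0n.
      set t1 := cost p _; set t2 := (foldl _ _ _).2 in X' *.
      have -> : 1 + (t1 + 5 + t2) = ((1 + (t1 + (1 + (1 + 1)))) + (1 + t2)).+1 by lia.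
      apply: exec_WhileT; [by rewrite hc| |exact: X'].
      apply: exec_Seq; first by constructor.
      rewrite hi; apply: exec_Seq; first exact: X3.
      apply: exec_Seq; first by constructor.
      by apply: exec_Seq; constructor.
    + exact: S'.
    + move=> i id; have [-> ->] := L' i id; have [a1 a2] := L3 i (ltnW id).
      by rewrite !r6 ?a1 ?a2 /= ?upd_other //; rewrite /lidx /lcnt /tmp /hreg; lia.
    + by move=> i ib; rewrite M' //= M3.
  pose s1 := setr (setr s (lcnt d) (reg s (hreg n))) (lidx d) 0.
  have hs1 : simulates b s1 h.
    apply: (simulates_reg hs) => // r hr /=.
    by rewrite !upd_other //; case: hr => [->|[y ->]]; rewrite /lidx /lcnt /hreg; lia.
  have c1 : reg s1 (lcnt d) = rg h n.
    rewrite /= upd_other; last by rewrite /lcnt /lidx; lia.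
    by rewrite upd_same; case: hs.
  have i1 : reg s1 (lidx d) = 0 by rewrite /= upd_same.
  have [s' [X' S' L' M']] := loop _ _ _ _ hs1 c1 i1.
  exists s'; split=> //.
  + set t2 := (foldl _ _ _).2 in X' *.
    have -> : 3 + t2 = 1 + (1 + (1 + t2)) by [].
    apply: exec_Seq; first by constructor.
    by apply: exec_Seq; first by constructor.
  + move=> i id; have [-> ->] := L' i id.
    by rewrite /= !upd_other //; rewrite /lidx /lcnt; lia.
Qed.

(** * Cost bounds read off the syntax *)

Lemma cost_scost (c : hl) (s : hstate) (v : nat -> nat) :
  (forall x, x \in bregs c -> x \notin wregs c) ->
  (forall x, x \in bregs c -> rg s x <= v x) ->
  cost c s <= scost c v.
Proof.
elim: c s => [|y e|b e1 e2|p IHp q IHq|e p IHp q IHq|y n p IHp] s //= hw hv.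
- have hp x : x \in bregs p -> x \notin wregs p /\ x \notin wregs q.
    by move=> hx; have := hw x; rewrite !mem_cat hx negb_or => /(_ isT)/andP.
  have hq x : x \in bregs q -> x \notin wregs p /\ x \notin wregs q.
    by move=> hx; have := hw x; rewrite !mem_cat hx orbT negb_or => /(_ isT)/andP.
  apply: leq_add.
  + by apply: IHp => x hx; [case: (hp x hx) | apply: hv; rewrite mem_cat hx].
  + apply: IHq => x hx; [by case: (hq x hx)|].
    by rewrite run_reg; [apply: hv; rewrite mem_cat hx orbT | case: (hq x hx)].
- rewrite leq_add2l leq_max; case: ifP => _; apply/orP; [left|right].
  + apply: IHp => x hx; last by apply: hv; rewrite mem_cat hx.
    by have := hw x; rewrite !mem_cat hx negb_or => /(_ isT)/andP[].
  + apply: IHq => x hx; last by apply: hv; rewrite mem_cat hx orbT.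
    by have := hw x; rewrite !mem_cat hx orbT negb_or => /(_ isT)/andP[].
- rewrite leq_add2l; apply: (@leq_trans (rg s n * (scost p v + 5))); last first.
    by rewrite leq_mul2r hv ?orbT // mem_head.
  set f := (fun (st : hstate * nat) _ => _).
  suff [] : (foldl f (s, 0) (iota 0 (rg s n))).2 <= rg s n * (scost p v + 5) /\
     (forall x, x \in bregs p -> rg (foldl f (s, 0) (iota 0 (rg s n))).1 x = rg s x) by [].
  apply: (foldl_inv (P := fun i st => st.2 <= i * (scost p v + 5) /\
     (forall x, x \in bregs p -> rg st.1 x = rg s x))) => // i [t c] _ /= [hc ht].
  have hn x : x \in bregs p -> (x == y) = false /\ x \notin wregs p.
    move=> hx; have := hw x; rewrite !inE hx orbT negb_or => /(_ isT)/andP[]; by move/negPf.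
  split.
  + rewrite mulSn addnC leq_add // leq_add2r; apply: IHp => x hx.
      by case: (hn x hx).
    rewrite /= updE; case: (hn x hx) => -> _; rewrite ht //.
    by apply: hv; rewrite inE hx orbT.
  + by move=> x hx; case: (hn x hx) => hy hp; rewrite run_reg //= updE hy ht.
Qed.

(** The cost is split into a factor that depends on the program text alone and a factor [growth] in
    which only nesting multiplies, consecutive pieces contributing their maximum. The asymptotic
    claim then concerns [growth] only. *)
Fixpoint kcost (c : hl) : nat :=
  match c with
  | HSkip => 1
  | HSet x e => ecost e + 1
  | HStore a e1 e2 => ecost e1 + ecost e2 + 9
  | HSeq p q => kcost p + kcost q
  | HIf e p q => ecost e + 1 + (kcost p + kcost q)
  | HFor x n p => 3 + (kcost p + 5)
  end.

Fixpoint growth (c : hl) (v : nat -> nat) : nat :=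
  match c with
  | HSkip | HSet _ _ | HStore _ _ _ => 1
  | HSeq p q | HIf _ p q => maxn (growth p v) (growth q v)
  | HFor x n p => (v n).+1 * growth p v
  end.

Lemma scost_growth (c : hl) (v : nat -> nat) : scost c v <= kcost c * growth c v.
Proof.
suff [] : 0 < growth c v /\ scost c v <= kcost c * growth c v by [].
elim: c => [|y e|b e1 e2|p [gp IHp] q [gq IHq]|e p [gp IHp] q [gq IHq]|y n p [gp IHp]] /=;
  rewrite ?muln1 //.
- split; first by rewrite leq_max gp.
  rewrite mulnDl leq_add //.
  + by apply: (leq_trans IHp); rewrite leq_mul2l leq_maxl orbT.
  + by apply: (leq_trans IHq); rewrite leq_mul2l leq_maxr orbT.
- split; first by rewrite leq_max gp.
  rewrite mulnDl leq_add //; first by rewrite leq_pmulr // leq_max gp.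
  rewrite geq_max mulnDl; apply/andP; split.
  + by apply: (leq_trans IHp); apply: leq_trans (leq_addr _ _); rewrite leq_mul2l leq_maxl orbT.
  + by apply: (leq_trans IHq); apply: leq_trans (leq_addl _ _); rewrite leq_mul2l leq_maxr orbT.
- split; first by rewrite muln_gt0.
  nia.
Qed.

(** * Cuts and flows *)

Section Graph.

Variables (m : nat) (kd tl hd : nat -> nat) (s : nat).

Definition live (dl : nat -> nat) (i : nat) : bool := (dl i == 0) && (kd i == 0).

Definition enters (Z : nat -> bool) (i : nat) : bool := ~~ Z (tl i) && Z (hd i).

Definition din (dl : nat -> nat) (Z : nat -> bool) : nat :=
  \sum_(i < m) (live dl i && enters Z i).

Definition violated (dl : nat -> nat) (Z : nat -> bool) (i : nat) : bool :=
  (dl i == 0) && (if kd i == 0 then enters Z i else Z (tl i) && Z (hd i)).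

Definition nviol (dl : nat -> nat) (Z : nat -> bool) : nat :=
  \sum_(i < m) violated dl Z i.

Definition admissible (T : nat -> nat) (Z : nat -> bool) : Prop :=
  Z s /\ forall x, T x != 0 -> ~~ Z x.

(** Unit capacities, with sink [s] and every vertex marked in [T] a source. Nothing is asked at
    marked vertices; if [s] itself is marked, every [f] is a flow value, in agreement with the
    absence of admissible sets. *)
Definition flow (dl T phi : nat -> nat) (f : nat) : Prop :=
  (forall i, i < m -> phi i != 0 -> live dl i /\ phi i = 1) /\
  (forall u, T u = 0 ->
    \sum_(i < m) phi i * (hd i == u) =
    \sum_(i < m) phi i * (tl i == u) + f * (u == s)).

(** No residual arc enters [Z]: these are the sets closed under searching backwards from the
    sink. *)
Definition residual_closed (dl phi : nat -> nat) (Z : nat -> bool) : Prop :=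
  forall i, i < m -> live dl i ->
    (phi i = 0 -> Z (hd i) -> Z (tl i)) /\ (phi i != 0 -> Z (tl i) -> Z (hd i)).

Lemma flow_across (dl T phi : nat -> nat) (f : nat) (Z : nat -> bool) :
  flow dl T phi f -> admissible T Z ->
  \sum_(i < m) phi i * Z (hd i) = \sum_(i < m) phi i * Z (tl i) + f.
Proof.
case=> _ cons [Zs ZT].
(* Conservation is to be summed over [Z], which may be infinite; only the vertices of this finite
   list contribute. *)
pose U := undup (s :: [seq tl (val i) | i <- enum 'I_m] ++ [seq hd (val i) | i <- enum 'I_m]).
have Uu : uniq U by exact: undup_uniq.
have sum1 (x : nat) : x \in U -> \sum_(u <- U | Z u) (x == u) = Z x.
  move=> xU; rewrite big_mkcond (bigD1_seq x) //= eqxx big1 ?addn0; first by case: (Z x).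
  by move=> u /negPf ux; rewrite eq_sym ux if_same.
have hU (i : 'I_m) : hd i \in U.
  by rewrite mem_undup inE mem_cat; apply/orP; right; apply/orP; right; apply/mapP; exists i; rewrite ?mem_enum.
have tU (i : 'I_m) : tl i \in U.
  by rewrite mem_undup inE mem_cat; apply/orP; right; apply/orP; left; apply/mapP; exists i; rewrite ?mem_enum.
have sU : s \in U by rewrite mem_undup mem_head.
have -> : \sum_(i < m) phi i * Z (hd i) = \sum_(u <- U | Z u) \sum_(i < m) phi i * (hd i == u).
  by rewrite exchange_big; apply: eq_bigr => i _ /=; rewrite -big_distrr /= sum1.
have -> : \sum_(i < m) phi i * Z (tl i) = \sum_(u <- U | Z u) \sum_(i < m) phi i * (tl i == u).
  by rewrite exchange_big; apply: eq_bigr => i _ /=; rewrite -big_distrr /= sum1.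
have -> : f = \sum_(u <- U | Z u) f * (u == s).
  rewrite -big_distrr /= -[LHS]muln1; congr (_ * _).
  by rewrite -[LHS]/(nat_of_bool true) -Zs -(sum1 s) //; apply: eq_bigr => u _; rewrite eq_sym.
rewrite -big_split /=; apply: eq_bigr => u Zu; apply: cons.
by case: (T u =P 0) => // /eqP /ZT; rewrite Zu.
Qed.

Lemma across_arc (dl T phi : nat -> nat) (f : nat) (Z : nat -> bool) (i : nat) :
  flow dl T phi f -> i < m ->
  phi i * Z (hd i) <= phi i * Z (tl i) + (live dl i && enters Z i).
Proof.
move=> [h _] im; case: (phi i =P 0) => [-> //|/eqP /(h i im) [-> ->]].
by rewrite /enters; case: (Z (hd i)); case: (Z (tl i)).
Qed.

Lemma flow_le_din (dl T phi : nat -> nat) (f : nat) (Z : nat -> bool) :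
  flow dl T phi f -> admissible T Z -> f <= din dl Z.
Proof.
move=> hf hZ; have := flow_across hf hZ.
have : \sum_(i < m) phi i * Z (hd i) <=
   \sum_(i < m) phi i * Z (tl i) + din dl Z.
  by rewrite -big_split; apply: leq_sum => i _; apply: across_arc hf _.
lia.
Qed.

Lemma din_residual_closed (dl T phi : nat -> nat) (f : nat) (Q : nat -> bool) :
  flow dl T phi f -> admissible T Q -> residual_closed dl phi Q -> din dl Q = f.
Proof.
move=> hf hQ hc; have := flow_across hf hQ.
have -> : \sum_(i < m) phi i * Q (hd i) =
   \sum_(i < m) phi i * Q (tl i) + din dl Q.
  rewrite -big_split; apply: eq_bigr => i _ /=.
  case: (boolP (live dl i)) => li /=; last first.
    case: (phi i =P 0) => [-> //|/eqP h].
    by case: hf => h1 _; case: (h1 i (ltn_ord i) h); rewrite (negPf li).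
  case: (hc i (ltn_ord i) li) => h0 h1; rewrite /enters.
  case: (phi i =P 0) => [p0|/eqP p0].
    by rewrite p0 !mul0n; have := h0 p0; case: (Q (hd i)); case: (Q (tl i)) => // /(_ isT).
  case: hf => hh _; case: (hh i (ltn_ord i) p0) => _ ->; rewrite !mul1n.
  by have := h1 p0; case: (Q (hd i)); case: (Q (tl i)) => // /(_ isT).
lia.
Qed.

(** Complementary slackness: the arcwise inequalities of [across_arc] sum to an equality, so each of
    them is one. Thus every minimum cut is residual-closed, which is what places the search tree
    inside all of them. *)
Lemma tight_residual_closed (dl T phi : nat -> nat) (f : nat) (Z : nat -> bool) :
  flow dl T phi f -> admissible T Z -> din dl Z <= f -> residual_closed dl phi Z.
Proof.
move=> hf hZ le_f i im li; have := flow_across hf hZ.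
have tight : phi i * Z (hd i) = phi i * Z (tl i) + (live dl i && enters Z i).
  have := flow_across hf hZ; move: le_f; rewrite /din.
  pose o := Ordinal im.
  have D (g : nat -> nat) : \sum_(j < m) g j = g i + \sum_(j < m | j != o) g j.
    by rewrite (bigD1 o).
  rewrite (D (fun j => phi j * Z (hd j))) (D (fun j => phi j * Z (tl j))).
  rewrite (D (fun j => nat_of_bool (live dl j && enters Z j))).
  have := across_arc Z hf im.
  have : \sum_(j < m | j != o) phi j * Z (hd j) <=
   \sum_(j < m | j != o) phi j * Z (tl j) + \sum_(j < m | j != o) (live dl j && enters Z j).
    by rewrite -big_split; apply: leq_sum => j _; apply: across_arc hf _.
  lia.
move=> _; move: tight; rewrite li /enters /=.
case: (phi i =P 0) => [->|/eqP p0].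
  by rewrite !mul0n add0n => e; split=> // _; move: e; case: (Z (hd i)); case: (Z (tl i)).
case: hf => hh _; case: (hh i im p0) => _ ->; rewrite !mul1n => e; split=> // _.
by move: e; case: (Z (hd i)); case: (Z (tl i)).
Qed.

Lemma din_submodular (dl : nat -> nat) (Z Q : nat -> bool) :
  din dl (fun x => Z x && Q x) + din dl (fun x => Z x || Q x) <= din dl Z + din dl Q.
Proof.
rewrite /din -!big_split; apply: leq_sum => i _ /=; rewrite /enters.
by case: (live dl i); case: (Z (tl i)); case: (Q (tl i)); case: (Z (hd i)); case: (Q (hd i)).
Qed.

Definition edges_in (dl : nat -> nat) (Z : nat -> bool) : nat :=
  \sum_(i < m) [&& dl i == 0, kd i != 0, Z (tl i) & Z (hd i)].

Lemma nviolE (dl : nat -> nat) (Z : nat -> bool) : nviol dl Z = din dl Z + edges_in dl Z.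
Proof.
rewrite /nviol /din /edges_in -big_split; apply: eq_bigr => i _ /=.
by rewrite /violated /live; case: (dl i == 0); case: (kd i == 0); rewrite /= ?addn0.
Qed.

(* Uncrossing with the minimum cut Q. *)
Lemma nviol_uncross (dl T phi : nat -> nat) (f : nat) (Q Z : nat -> bool) :
  flow dl T phi f -> admissible T Q -> residual_closed dl phi Q -> admissible T Z ->
  admissible T (fun x => Z x && Q x) /\ nviol dl (fun x => Z x && Q x) <= nviol dl Z.
Proof.
move=> hf hQ hc hZ; have eQ := din_residual_closed hf hQ hc.
case: (hQ) => Qs QT; case: (hZ) => Zs ZT.
split; first by split; [rewrite Zs Qs | move=> x /ZT /negPf ->].
(* The union is admissible as well, so its in-degree is at least [f], which is the in-degree of [Q].
   Submodularity then leaves at most the in-degree of [Z] for the intersection, and the edges inside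
   can only become fewer. *)
have hU : admissible T (fun x => Z x || Q x).
  by split; [rewrite Zs | move=> x hx; rewrite (negPf (ZT x hx)) (negPf (QT x hx))].
have := flow_le_din hf hU; have := din_submodular dl Z Q.
have : edges_in dl (fun x => Z x && Q x) <= edges_in dl Z.
  apply: leq_sum => i _; case: (dl i == 0) (kd i == 0) => [] [] //=.
  by case: (Z (tl i)); case: (Z (hd i)); case: (Q (tl i)); case: (Q (hd i)).
rewrite !nviolE; lia.
Qed.

Lemma live_upd (dl : nat -> nat) (c i : nat) :
  live (upd dl c 1) i = (i != c) && live dl i.
Proof. by rewrite /live updE; case: (i == c). Qed.

Lemma din_upd (dl : nat -> nat) (c : nat) (Z : nat -> bool) :
  c < m -> din dl Z <= (din (upd dl c 1) Z).+1.
Proof.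
move=> cm; pose o := Ordinal cm.
rewrite /din (bigD1 o) //= [X in _ <= X.+1](bigD1 o) //= live_upd eqxx /=.
rewrite [X in _ <= (_ + X).+1](eq_bigr (fun i : 'I_m => (live dl i && enters Z i : nat))).
  by case: (_ && _).
by move=> i io; rewrite live_upd; have -> : (i : nat) != c by [].
Qed.

Lemma nviol_upd (dl : nat -> nat) (c : nat) (Z : nat -> bool) :
  c < m -> violated dl Z c -> nviol dl Z = (nviol (upd dl c 1) Z).+1.
Proof.
move=> cm vc; pose o := Ordinal cm.
have D (g : nat -> nat) : \sum_(j < m) g j = g c + \sum_(j < m | j != o) g j.
  by rewrite (bigD1 o).
rewrite /nviol (D (fun i => nat_of_bool (violated dl Z i))) vc.
rewrite (D (fun i => nat_of_bool (violated (upd dl c 1) Z i))).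
have -> : violated (upd dl c 1) Z c = false by rewrite /violated updE eqxx.
rewrite add0n add1n; congr _.+1; apply: eq_bigr => i io; rewrite /violated updE.
by have -> : (i : nat) == c = false by exact: negPf.
Qed.

(* Ranges over the nodes of the backward search from [s], latest first. *)
Fixpoint search_tree (dl phi nx : nat -> nat) (q : seq nat) : Prop :=
  match q with
  | [::] => False
  | x :: q' =>
    if q' is [::] then x = s else
    [/\ x \notin q', nx x < m, live dl (nx x),
        (if phi (nx x) == 0 then tl (nx x) = x /\ hd (nx x) \in q'
         else hd (nx x) = x /\ tl (nx x) \in q')
      & search_tree dl phi nx q']
  end.

Lemma search_tree_cons (dl phi nx : nat -> nat) (x : nat) (q : seq nat) :
  q <> [::] ->
  search_tree dl phi nx (x :: q) <->
    [/\ x \notin q, nx x < m, live dl (nx x),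
        (if phi (nx x) == 0 then tl (nx x) = x /\ hd (nx x) \in q
         else hd (nx x) = x /\ tl (nx x) \in q)
      & search_tree dl phi nx q].
Proof. by case: q. Qed.

Lemma search_tree_root (dl phi nx : nat -> nat) (q : seq nat) :
  search_tree dl phi nx q -> s \in q.
Proof.
elim: q => // x [|y q] IH; first by move=> /= ->; rewrite mem_head.
by case=> [_ _ _ _ /IH]; rewrite [in X in _ -> X]inE orbC => ->.
Qed.

Lemma search_tree_uniq (dl phi nx : nat -> nat) (q : seq nat) :
  search_tree dl phi nx q -> uniq q.
Proof.
elim: q => // x [|y q] IH //.
by case=> [h _ _ _ /IH hu]; apply/andP.
Qed.

Lemma search_tree_suffix (dl phi nx : nat -> nat) (q1 : seq nat) (x : nat) (q2 : seq nat) :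
  search_tree dl phi nx (q1 ++ x :: q2) -> search_tree dl phi nx (x :: q2).
Proof.
elim: q1 => // y q1 IH; rewrite cat_cons search_tree_cons; last by case: q1 {IH}.
by case=> _ _ _ _ /IH.
Qed.

Lemma search_tree_nx (dl phi nx nx' : nat -> nat) (q : seq nat) :
  (forall x, x \in q -> nx' x = nx x) ->
  search_tree dl phi nx q -> search_tree dl phi nx' q.
Proof.
elim: q => // x [|y q] IH // h.
case=> [h1 h2 h3 h4 h5].
rewrite search_tree_cons //; rewrite (h x) ?mem_head //; split=> //.
by apply: IH => // z hz; apply: h; rewrite inE hz orbT.
Qed.

Lemma search_tree_arc (dl phi nx : nat -> nat) (q : seq nat) (x : nat) :
  search_tree dl phi nx q -> x \in q -> x <> s ->
  nx x < m /\ x = (if phi (nx x) == 0 then tl (nx x) else hd (nx x)).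
Proof.
elim: q => // y [|z q] IH.
  by move=> /= ->; rewrite inE => /eqP ->.
case=> [h1 h2 h3 h4 h5].
rewrite inE => /orP [/eqP -> _|]; last exact: IH.
by split=> //; move: h4; case: ifP => _ [].
Qed.

(** Each vertex of the list is the tail of a residual arc into an older one, so a closed set that
    contains the root absorbs the list from its oldest end. A completed tree is therefore the
    smallest minimum cut. *)
Lemma search_tree_min (dl phi nx : nat -> nat) (q : seq nat) (Z : nat -> bool) :
  search_tree dl phi nx q -> Z s -> residual_closed dl phi Z ->
  forall x, x \in q -> Z x.
Proof.
move=> + Zs hc; elim: q => // y [|z q] IH.
  by move=> /= -> x; rewrite inE => /eqP ->.
case=> [_ h2 h3 h4 h5] x.
rewrite inE => /orP [/eqP ->|]; last exact: IH.
have [c0 c1] := hc _ h2 h3.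
move: h4; case: ifPn => [/eqP p0|p0] [e /(IH h5) hz].
  by have := c0 p0 hz; rewrite e.
by have := c1 p0 hz; rewrite e.
Qed.

(* Flow value [f] is being increased along a path that has been followed up to [v]. *)
Definition preflow (dl T phi : nat -> nat) (f v : nat) : Prop :=
  (forall i, i < m -> phi i != 0 -> live dl i /\ phi i = 1) /\
  (forall u, T u = 0 ->
    \sum_(i < m) phi i * (hd i == u) =
    \sum_(i < m) phi i * (tl i == u) + f * (u == s) + (u == v)).

Lemma sum_upd (phi : nat -> nat) (c w : nat) (g : nat -> nat) : c < m ->
  \sum_(i < m) upd phi c w i * g i + phi c * g c = \sum_(i < m) phi i * g i + w * g c.
Proof.
move=> cm; pose o := Ordinal cm.
rewrite (bigD1 o) //= [in RHS](bigD1 o) //= updE eqxx.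
rewrite (eq_bigr (fun i : 'I_m => phi i * g i)); first by lia.
by move=> i io; rewrite updE (negPf (_ : (i : nat) != c)).
Qed.

Lemma preflow_push (dl T phi : nat -> nat) (f v c : nat) :
  preflow dl T phi f v -> c < m -> live dl c -> phi c = 0 -> tl c = v ->
  preflow dl T (upd phi c 1) f (hd c).
Proof.
move=> [h1 h2] cm lc p0 tc; split.
  by move=> i im; rewrite updE; case: (i =P c) => [->|_]; [split | exact: h1].
move=> u Tu; have := h2 u Tu.
have := sum_upd phi 1 (fun i => hd i == u) cm.
have := sum_upd phi 1 (fun i => tl i == u) cm.
rewrite p0 tc !(eq_sym v) !(eq_sym (hd c)); lia.
Qed.

Lemma preflow_pull (dl T phi : nat -> nat) (f v c : nat) :
  preflow dl T phi f v -> c < m -> phi c != 0 -> hd c = v ->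
  preflow dl T (upd phi c 0) f (tl c).
Proof.
move=> [h1 h2] cm p0 tc; split.
  by move=> i im; rewrite updE; case: (i =P c) => [->|_]; [by [] | exact: h1].
move=> u Tu; have := h2 u Tu; have [_ p1] := h1 c cm p0.
have := sum_upd phi 0 (fun i => hd i == u) cm.
have := sum_upd phi 0 (fun i => tl i == u) cm.
rewrite p1 tc !(eq_sym v) !(eq_sym (tl c)); lia.
Qed.

Lemma preflow_start (dl T phi : nat -> nat) (f v : nat) :
  flow dl T phi f -> T v != 0 -> preflow dl T phi f v.
Proof.
move=> [h1 h2] Tv; split=> // u Tu; rewrite h2 //.
by case: (u =P v) Tu Tv => [-> ->|_ _ _]; rewrite ?addn0.
Qed.

Lemma preflow_end (dl T phi : nat -> nat) (f : nat) :
  preflow dl T phi f s -> flow dl T phi f.+1.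
Proof. by move=> [h1 h2]; split=> // u Tu; rewrite h2 // mulSn; lia. Qed.

Lemma flow0 (dl T phi : nat -> nat) : (forall i, i < m -> phi i = 0) -> flow dl T phi 0.
Proof.
move=> h; split; first by move=> i im; rewrite h.
by move=> u _; rewrite !big1 // => i _; rewrite h.
Qed.

End Graph.

(** * The flow computation *)

Declare Scope hl_scope.
Delimit Scope hl_scope with hl.
Notation "p ;; q" := (HSeq p q) (at level 61, right associativity) : hl_scope.
Notation "x ::= e" := (HSet x e) (at level 60) : hl_scope.
Local Open Scope hl_scope.

(** Any nonzero number counts as true; truncated subtraction from 1 both negates and normalises. *)
Definition Not (e : exp) : exp := Minus (Cst 1) e.
Definition And (e1 e2 : exp) : exp := Not (Plus (Not e1) (Not e2)).
Definition Same (e1 e2 : exp) : exp := Not (Plus (Minus e1 e2) (Minus e2 e1)).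

Lemma ev_Not (e : exp) (s : hstate) : (ev (Not e) s != 0) = (ev e s == 0).
Proof. by rewrite /=; lia. Qed.

Lemma ev_And (e1 e2 : exp) (s : hstate) :
  (ev (And e1 e2) s != 0) = (ev e1 s != 0) && (ev e2 s != 0).
Proof. by rewrite /=; lia. Qed.

Lemma ev_Same (e1 e2 : exp) (s : hstate) : (ev (Same e1 e2) s != 0) = (ev e1 s == ev e2 s).
Proof. by rewrite /=; lia. Qed.

Lemma run_seq (p q : hl) (s : hstate) : run (p ;; q) s = run q (run p s).
Proof. by []. Qed.

Lemma run_if (e : exp) (p q : hl) (s : hstate) :
  run (HIf e p q) s = if ev e s != 0 then run p s else run q s.
Proof. by []. Qed.

Lemma run_set (x : nat) (e : exp) (s : hstate) : run (x ::= e) s = hset s x (ev e s).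
Proof. by []. Qed.

Lemma run_store (a : nat) (e1 e2 : exp) (s : hstate) :
  run (HStore a e1 e2) s = hstore s a (ev e1 s) (ev e2 s).
Proof. by []. Qed.

Lemma run_skip (s : hstate) : run HSkip s = s.
Proof. by []. Qed.

Definition runE := (run_seq, run_if, run_set, run_store, run_skip, ev_And, ev_Not, ev_Same).

Arguments run : simpl never.

Notation rI := 0 (only parsing).
Notation rJ := 1 (only parsing).
Notation rT := 2 (only parsing).
Notation rG := 3 (only parsing).
Notation rB := 4 (only parsing).
Notation rM := 5 (only parsing).
Notation rNL := 6 (only parsing).
Notation rK := 7 (only parsing).
Notation rS := 8 (only parsing).
Notation rK1 := 9 (only parsing).
Notation rNP := 10 (only parsing).
Notation rN2 := 11 (only parsing).
Notation rBIG := 12 (only parsing).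
Notation rF := 13 (only parsing).
Notation rStop := 14 (only parsing).
Notation rHit := 15 (only parsing).
Notation rV := 16 (only parsing).
Notation rC := 17 (only parsing).
Notation rFound := 18 (only parsing).
Notation rDone := 19 (only parsing).
Notation rMode := 20 (only parsing).
Notation rDep := 21 (only parsing).
Notation rND := 22 (only parsing).
Notation rCX := 23 (only parsing).
Notation rCY := 24 (only parsing).
Notation rBX := 25 (only parsing).
Notation rBY := 26 (only parsing).
Notation rPick := 27 (only parsing).
Notation rN := 28 (only parsing).
Notation rP := 29 (only parsing).
Notation rOut := 30 (only parsing).

Notation aIN := 0 (only parsing).
Notation aOUT := 1 (only parsing).
Notation aLA := 2 (only parsing).
Notation aNA := 3 (only parsing).
Notation aLB := 4 (only parsing).
Notation aNB := 5 (only parsing).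
Notation aKD := 6 (only parsing).
Notation aTL := 7 (only parsing).
Notation aHD := 8 (only parsing).
Notation aDEL := 9 (only parsing).
Notation aPHI := 10 (only parsing).
Notation aA := 11 (only parsing).
Notation aX := 12 (only parsing).
Notation aY := 13 (only parsing).
Notation aT := 14 (only parsing).
Notation aQ := 15 (only parsing).
Notation aNX := 16 (only parsing).
Notation aSEEN := 17 (only parsing).
Notation aSC := 18 (only parsing).
Notation aSA := 19 (only parsing).

Notation At a := (Arr a (Reg rI)) (only parsing).

(** Only endpoints of clauses are reset, which takes one scan of the clauses. This is enough as long
    as [aQ] never holds anything but vertices of the graph, an invariant carried through the whole
    search. The last store restores the root, which may be an endpoint too. *)
Definition clear_Q : hl :=
  HFor rI rM (HStore aQ (At aTL) (Cst 0) ;; HStore aQ (At aHD) (Cst 0)) ;; HStore aQ (Reg rS) (Cst 1).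

Definition scan : hl :=
  HIf (And (Not (At aDEL)) (Not (At aKD)))
    (HIf (At aPHI)
      (HIf (And (Arr aQ (At aTL)) (Not (Arr aQ (At aHD))))
        (HStore aQ (At aHD) (Cst 1) ;; HStore aNX (At aHD) (Reg rI)) HSkip)
      (HIf (And (Arr aQ (At aHD)) (Not (Arr aQ (At aTL))))
        (HStore aQ (At aTL) (Cst 1) ;; HStore aNX (At aTL) (Reg rI)) HSkip))
    HSkip.

(** Repeated scans in the style of Bellman and Ford replace a queue with adjacency lists: a search
    then costs a number of scans linear in the number of variables, which the time bound allows. *)
Definition pass : hl := HFor rI rM scan.

(** The root is tested apart because it need not be an endpoint of any clause. When it is marked,
    every round reports a hit, so the flow value rises past the budget and the node is pruned. *)
Definition find_hit : hl :=
  rHit ::= Cst 0 ;; HIf (Arr aT (Reg rS)) (rHit ::= Cst 1 ;; rV ::= Reg rS) HSkip ;;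
  HFor rI rM
    (HIf (And (Arr aQ (At aTL)) (Arr aT (At aTL))) (rHit ::= Cst 1 ;; rV ::= At aTL) HSkip ;;
     HIf (And (Arr aQ (At aHD)) (Arr aT (At aHD))) (rHit ::= Cst 1 ;; rV ::= At aHD) HSkip).

Definition trace_step : hl :=
  HIf (Same (Reg rV) (Reg rS)) HSkip
    (rC ::= Arr aNX (Reg rV) ;;
     HIf (Arr aPHI (Reg rC))
       (HStore aPHI (Reg rC) (Cst 0) ;; rV ::= Arr aTL (Reg rC))
       (HStore aPHI (Reg rC) (Cst 1) ;; rV ::= Arr aHD (Reg rC))).

Definition trace : hl := HFor rT rNP trace_step.

Definition augment : hl :=
  HIf (Reg rStop) HSkip
    (clear_Q ;; HFor rJ rNP pass ;; find_hit ;;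
     HIf (Reg rHit) (trace ;; rF ::= Plus (Reg rF) (Cst 1)) (rStop ::= Cst 1)).

(** The value is not driven beyond [k + 1], where the node is pruned anyway. If it stays below, some
    round found no augmenting path, and the rounds after it are idle, so the cut of that round is
    still in [aQ]. *)
Definition max_flow : hl :=
  HFor rI rM (HStore aPHI (Reg rI) (Cst 0)) ;; rF ::= Cst 0 ;; rStop ::= Cst 0 ;;
  HFor rG rK1 augment.

Section Flow.

Variables (m : nat) (kd tl hd : nat -> nat) (s : nat).

Definition graph_state (t : hstate) : Prop :=
  [/\ rg t rM = m, rg t rS = s, ar t aKD = kd, ar t aTL = tl & ar t aHD = hd].

Lemma graph_frame (c : hl) (t : hstate) :
  all (fun x => x \notin wregs c) [:: rM; rS] ->
  all (fun a => a \notin warrs c) [:: aKD; aTL; aHD] ->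
  graph_state t -> graph_state (run c t).
Proof.
by case/and3P=> h1 h2 _ /and4P[h3 h4 h5 _] [g1 g2 g3 g4 g5]; split; rewrite ?run_reg ?run_arr.
Qed.

Lemma graph_hset (t : hstate) (x v : nat) :
  x != rM -> x != rS -> graph_state t -> graph_state (hset t x v).
Proof.
by move=> h1 h2 [g1 g2 g3 g4 g5]; split=> //=; rewrite updE eq_sym ?(negPf h1) ?(negPf h2).
Qed.

Definition vert (x : nat) : Prop := x = s \/ exists2 i, i < m & x = tl i \/ x = hd i.

Lemma clear_Q_ok (t : hstate) :
  graph_state t -> (forall x, ar t aQ x != 0 -> vert x) ->
  forall x, (ar (run clear_Q t) aQ x != 0) = (x == s).
Proof.
move=> g hQ x; rewrite /clear_Q run_seq; set t1 := run (HFor _ _ _) t.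
have g1 : graph_state t1 by apply: graph_frame.
have [em _ _ _ _] := g.
pose P i t' := forall y, ar t' aQ y != 0 -> y = s \/
    exists2 j, i <= j < m & y = tl j \/ y = hd j.
have H : P (rg t rM) t1.
  apply: for_inv => [|i t' im IH hr ha].
    by move=> z /hQ [->|[i im h]]; [left | right; exists i].
  have gt : graph_state (hset t' rI i).
    by case: g => *; split; rewrite /= ?updE ?hr ?ha.
  move=> z; rewrite !runE; case: gt => _ _ _ /= -> ->; rewrite !updE eqxx.
  case: (z =P hd i) => // zh; case: (z =P tl i) => // zt /IH [->|[j /andP[ij jm] h]]; [by left|right].
  exists j => //; rewrite jm andbT ltn_neqAle ij andbT; apply/eqP=> e.
  by case: h => h; [apply: zt | apply: zh]; rewrite h e.
have {}H y : ar t1 aQ y != 0 -> y = s.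
  by move=> /H [//|[j]]; rewrite em; lia.
have [_ es _ _ _] := g1; rewrite runE /= es updE.
by case: (x =P s) => [//|xs]; apply/negbTE/negP => /H.
Qed.


Definition tree (t : hstate) (q : seq nat) : Prop :=
  search_tree m kd tl hd s (ar t aDEL) (ar t aPHI) (ar t aNX) q /\
  (forall x, (ar t aQ x != 0) = (x \in q)) /\ (forall x, x \in q -> vert x).

Definition closed_at (t : hstate) (i : nat) : Prop :=
  live kd (ar t aDEL) i ->
    (ar t aPHI i = 0 -> ar t aQ (hd i) != 0 -> ar t aQ (tl i) != 0) /\
    (ar t aPHI i != 0 -> ar t aQ (tl i) != 0 -> ar t aQ (hd i) != 0).

Lemma scan_ok (t : hstate) (q : seq nat) :
  graph_state t -> rg t rI < m -> tree t q ->
  (ar (run scan t) aQ = ar t aQ /\ tree (run scan t) q /\ closed_at t (rg t rI)) \/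
  (exists x, tree (run scan t) (x :: q)).
Proof.
move=> g im [ht [hq hv]]; set i := rg t rI in im *.
have [_ _ ekd etl ehd] := g.
have q0 : q <> [::] by move=> e; rewrite e in ht.
have new x : x \notin q -> vert x -> live kd (ar t aDEL) i ->
    (if ar t aPHI i == 0 then tl i = x /\ hd i \in q else hd i = x /\ tl i \in q) ->
    tree (hstore (hstore t aQ x 1) aNX x i) (x :: q).
  move=> xq vx li hx; split; last split.
  - apply/search_tree_cons => //=; rewrite updE eqxx; split=> //.
    by apply: search_tree_nx ht => y yq; rewrite updE; case: eqP yq xq => // -> ->.
  - move=> y /=; rewrite updE inE; case: (y =P x) => //= _; exact: hq.
  - by move=> y; rewrite inE => /orP[/eqP -> //|]; exact: hv.
rewrite /scan !runE /= -/i ekd.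
case: (boolP (_ && _)) => li; last by left; do 2 split=> //; rewrite /closed_at /live (negPf li).
case: ifPn => [p1|p0].
- rewrite etl ehd; case: ifPn => h.
  + right; exists (hd i); case/andP: h => h1 h2; apply: new => //.
    + by rewrite -hq negbK.
    + by right; exists i => //; right.
    + by rewrite (negPf p1) -hq.
  + left; split=> //; split; first by split.
    move=> _; split=> [e|_]; first by rewrite e in p1.
    by move: h; case: (ar t aQ (tl i) != 0) => //=; move/negPf => ->.
- rewrite etl ehd; case: ifPn => h.
  + right; exists (tl i); case/andP: h => h1 h2; apply: new => //.
    + by rewrite -hq negbK.
    + by right; exists i => //; left.
    + by rewrite (negbNE p0) -hq.
  + left; split=> //; split; first by split.
    move=> _; split=> [_|e]; last by rewrite e in p0.
    by move: h; case: (ar t aQ (hd i) != 0) => //=; move/negPf => ->.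
Qed.

(** A pass that adds no vertex leaves [aQ] constant throughout, so the closure facts collected
    clause by clause all concern the same set. Any other pass is paid for by the growth of the
    tree. *)
Lemma pass_ok (t : hstate) (q : seq nat) :
  graph_state t -> tree t q ->
  exists q', tree (run pass t) q' /\
    (size q < size q' \/ forall i, i < m -> closed_at (run pass t) i).
Proof.
move=> g ht; have [em _ _ _ _] := g.
pose P i t' := exists q', tree t' q' /\ (size q < size q' \/
  [/\ size q' = size q, ar t' aQ = ar t aQ & forall j, j < i -> closed_at t' j]).
have : P (rg t rM) (run pass t).
  apply: for_inv; first by exists q; split=> //; right.
  move=> i t' im [q' [ht' hs]] hr ha.
  have gt : graph_state (hset t' rI i) by case: g => *; split; rewrite /= ?updE ?hr ?ha.
  have et : ar (hset t' rI i) = ar t' by [].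
  have iM : rg (hset t' rI i) rI < m by rewrite -em.
  have hT : tree (hset t' rI i) q' by [].
  case: (scan_ok gt iM hT) => [[eQ [hT' hc]]|[x hx]]; last first.
    exists (x :: q'); split=> //; left; case: hs => [|[<-]] //=; lia.
  exists q'; split=> //; case: hs => [hs|[hs e1 hj]]; [by left|right; split=> //].
    by rewrite eQ.
  move=> j; rewrite /closed_at eQ !run_arr // ltnS leq_eqVlt => /orP[/eqP ->|ji].
    by move: hc; rewrite /= updE.
  exact: hj.
case=> q' [h1 h2]; exists q'; split=> //; rewrite em in h2.
by case: h2 => [|[_ _ h]]; [left|right].
Qed.

Variable np : nat.
Hypothesis np_bound : forall q : seq nat, uniq q -> (forall x, x \in q -> vert x) -> size q < np.

Definition Qset (t : hstate) : nat -> bool := fun x => ar t aQ x != 0.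

Lemma search_ok (t : hstate) :
  graph_state t -> rg t rNP = np -> (forall x, ar t aQ x != 0 -> vert x) ->
  let t' := run (HFor rJ rNP pass) (run clear_Q t) in
  exists q, tree t' q /\
    residual_closed m kd tl hd (ar t' aDEL) (ar t' aPHI) (Qset t').
Proof.
move=> g enp hQ; have cQ := clear_Q_ok g hQ; move: (graph_frame (c := clear_Q) isT isT g).
have : rg (run clear_Q t) rNP = np by rewrite run_reg.
move: (run clear_Q t) cQ => {g enp hQ}t hQ enp g.
pose P j t' := exists q, tree t' q /\ (j < size q \/ forall i, i < m -> closed_at t' i).
have : P (rg t rNP) (run (HFor rJ rNP pass) t).
  apply: for_inv.
    exists [:: s]; split; last by left.
    split=> //; split=> x; first by rewrite inE hQ.
    by rewrite inE => /eqP ->; left.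
  move=> j t' jm [q [ht hs]] hr ha.
  have gt : graph_state (hset t' rJ j) by case: g => *; split; rewrite /= ?updE ?hr ?ha.
  have [q' [ht' hs']] := @pass_ok (hset t' rJ j) q gt ht.
  exists q'; split=> //; case: hs' => [lt|h]; last by right.
  case: hs => [jq|hc]; first by left; lia.
  (* A pass over a closed set cannot enlarge it: the tree after the pass lies in every closed set
     containing the root, in particular in the old one. *)
  have hZ : residual_closed m kd tl hd (ar t' aDEL) (ar t' aPHI) (Qset t') by move=> i im; apply: hc.
  case: ht' => ht' _; rewrite (@run_arr _ _ aDEL) // (@run_arr _ _ aPHI) // in ht'.
  have sub : {subset q' <= q}.
    move=> x xq; case: ht => ht [hq _]; rewrite -hq.
    apply: (search_tree_min (Z := Qset t') ht' _ hZ xq).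
    by rewrite /Qset hq; apply: search_tree_root ht.
  by have := uniq_leq_size (search_tree_uniq ht') sub; rewrite leqNgt lt.
case=> q [ht hs]; exists q; split=> //; case: hs => [|h i im]; last exact: h.
have [h1 [h2 h3]] := ht.
by have := np_bound (search_tree_uniq h1) h3; rewrite enp; lia.
Qed.

Lemma find_hit_ok (t : hstate) :
  graph_state t -> (forall x, ar t aQ x != 0 -> vert x) -> ar t aQ s != 0 ->
  let t' := run find_hit t in
  if rg t' rHit == 0 then forall x, ar t aT x != 0 -> ar t aQ x = 0
  else ar t aT (rg t' rV) != 0 /\ ar t aQ (rg t' rV) != 0.
Proof.
move=> g hQ Qs; have [em es ekd etl ehd] := g.
rewrite /find_hit 2!run_seq; set t1 := run (HIf _ _ _) _.
pose R i t' := if rg t' rHit == 0 then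
   ar t aT s = 0 /\ forall j, j < i -> (ar t aT (tl j) != 0 -> ar t aQ (tl j) = 0) /\ (ar t aT (hd j) != 0 -> ar t aQ (hd j) = 0)
   else ar t aT (rg t' rV) != 0 /\ ar t aQ (rg t' rV) != 0.
have g1 : graph_state t1 by rewrite /t1 -run_seq; apply: graph_frame.
have a1 : ar t1 = ar t by rewrite /t1 !runE /=; case: ifP.
have em1 : rg t1 rM = m by case: g1.
have R0 : R 0 t1.
  rewrite /R /t1 !runE /= ?updE /= es; case: (boolP (ar t aT s != 0)) => h.
    by rewrite /= ?updE.
  by rewrite /= ?updE /=; rewrite negbK in h; rewrite (eqP h).
have : R (rg t1 rM) (run (HFor rI rM
    (HIf (And (Arr aQ (At aTL)) (Arr aT (At aTL))) (rHit ::= Cst 1 ;; rV ::= At aTL) HSkip ;;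
     HIf (And (Arr aQ (At aHD)) (Arr aT (At aHD))) (rHit ::= Cst 1 ;; rV ::= At aHD) HSkip)) t1).
  apply: for_inv => // i t' im Ri hr ha.
  have at' a : ar t' a = ar t a by rewrite ha // a1.
  rewrite !runE /= ?at' ?updE ?etl ?ehd /=.
  case: (boolP ((ar t aQ (tl i) != 0) && (ar t aT (tl i) != 0))) => c1;
    rewrite /= ?at' ?updE /= ?at' ?etl ?ehd;
    case: (boolP ((ar t aQ (hd i) != 0) && (ar t aT (hd i) != 0))) => c2;
    rewrite /R /= ?updE /= ?at' ?etl ?ehd.
  - by case/andP: c2.
  - by case/andP: c1.
  - by case/andP: c2.
  - move: Ri; rewrite /R; case: ifP => // _ [h0 hj]; split=> // j.
    rewrite ltnS leq_eqVlt => /orP[/eqP ->|]; last exact: hj.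
    split=> h; lia.
rewrite em1 /R; case: ifP => // _ [h0 hj] x Tx.
case: (ar t aQ x =P 0) => // /eqP Qx; case: (hQ x Qx) => [xs|[j jm [xj|xj]]].
- by rewrite xs h0 in Tx.
- by rewrite xj in Tx *; apply (hj j jm).
- by rewrite xj in Tx *; apply (hj j jm).
Qed.


Lemma split_mem (x : nat) (q : seq nat) : x \in q -> exists q1 q2, q = q1 ++ x :: q2.
Proof. by case/splitPr=> q1 q2; exists q1, q2. Qed.

Lemma trace_ok (t : hstate) (q : seq nat) (f : nat) :
  graph_state t -> rg t rNP = np -> tree t q -> rg t rV \in q -> ar t aT (rg t rV) != 0 ->
  flow m kd tl hd s (ar t aDEL) (ar t aT) (ar t aPHI) f ->
  flow m kd tl hd s (ar t aDEL) (ar t aT) (ar (run trace t) aPHI) f.+1.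
Proof.
move=> g enp [ht [hq hv]] vq vT hf; have [em es ekd etl ehd] := g.
set dl := ar t aDEL in ht hf *; set phi0 := ar t aPHI in ht hf *; set nx := ar t aNX in ht.
(* The current vertex heads a suffix of the tree that gets shorter at every turn, and the flow is
   still the original one on the arcs by which the rest of the suffix was found. *)
pose P j t' := exists q', [/\ search_tree m kd tl hd s dl phi0 nx (rg t' rV :: q'),
   rg t' rV = s \/ size q' + j < size q,
   (forall x, x \in rg t' rV :: q' -> x <> s -> ar t' aPHI (nx x) = phi0 (nx x))
   & preflow m kd tl hd s dl (ar t aT) (ar t' aPHI) f (rg t' rV)].
have : P (rg t rNP) (run trace t).
  apply: for_inv.
    have [q1 [q2 e]] := split_mem vq; exists q2; split=> //.
    - by move: ht; rewrite e => /search_tree_suffix.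
    - by right; rewrite e size_cat /=; lia.
    -    exact: preflow_start.
  move=> j t' jm [q' [h1 h2 h3 h4]] hr ha.
  rewrite /trace_step !runE /= ?updE /= ![rg t' 8]hr // es.
  have a1 : ar t' aNX = nx by rewrite ha.
  have a2 : ar t' aTL = tl by rewrite ha.
  have a3 : ar t' aHD = hd by rewrite ha.
  case: (rg t' 16 =P s) => [vs|vs].
    by exists q'; split=> //=; left; rewrite updE.
  case: h2 => // h2; rewrite a1 a2 a3.
  set v := rg t' 16 in h1 h2 h3 h4 vs *; set c := nx v.
  have q0 : q' <> [::] by move=> e; rewrite e in h1.
  move/search_tree_cons: (h1) => /(_ q0) [vq' cm lc hc ht'].
  have pc : ar t' aPHI c = phi0 c by apply: h3 => //; rewrite mem_head.
  (* The arc just changed is not the tree arc of an older vertex: the original flow on an arc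
     determines which endpoint it discovered, here [v], and [v] is not in [q']. *)
  have keep y q1 q2 : q' = q1 ++ y :: q2 -> forall x w, x \in y :: q2 -> x <> s ->
      upd (ar t' aPHI) c w (nx x) = phi0 (nx x).
    move=> e x w xq xs; have xq' : x \in q' by rewrite e mem_cat xq orbT.
    rewrite updE; case: eqP => [e2|_]; last by apply: h3 => //; rewrite inE xq' orbT.
    have [_ ex] := search_tree_arc ht' xq' xs.
    case/negP: vq'; suff -> : v = x by [].
    by rewrite ex e2; move: hc; rewrite -/c; case: ifP => _ [].
  rewrite pc; case: ifPn => p1; rewrite /= ?updE /= ?a2 ?a3 ?a1 -/v -/c.
  - rewrite (negPf p1) in hc; case: hc => hv1 /split_mem [q1 [q2 E]].
    exists q2; rewrite /= ?updE /=; split.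
    + by move: ht'; rewrite E => /search_tree_suffix.
    + by right; move: h2; rewrite E size_cat /=; lia.
    + by move=> x xq xs; apply: (keep _ _ _ E).
    + by apply: (preflow_pull h4) => //; rewrite pc.
  - rewrite negbK in p1; rewrite p1 in hc; case: hc => hv1 /split_mem [q1 [q2 E]].
    exists q2; rewrite /= ?updE /=; split.
    + by move: ht'; rewrite E => /search_tree_suffix.
    + by right; move: h2; rewrite E size_cat /=; lia.
    + by move=> x xq xs; apply: (keep _ _ _ E).
    + by apply: (preflow_push h4) => //; rewrite pc; apply/eqP.
case=> q' [h1 h2 h3 h4].
have vs : rg (run trace t) rV = s.
  case: h2 => // h2; have := np_bound (search_tree_uniq ht) hv; rewrite -enp; lia.
by rewrite vs in h4; apply: preflow_end.
Qed.

Definition min_cut (t : hstate) : Prop :=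
  [/\ admissible s (ar t aT) (Qset t),
      residual_closed m kd tl hd (ar t aDEL) (ar t aPHI) (Qset t)
    & exists q, tree t q].

Lemma max_flow_ok (t : hstate) :
  graph_state t -> rg t rNP = np -> (forall x, ar t aQ x != 0 -> vert x) ->
  let t' := run max_flow t in
  [/\ flow m kd tl hd s (ar t' aDEL) (ar t' aT) (ar t' aPHI) (rg t' rF),
      rg t' rF < rg t rK1 -> min_cut t'
    & forall x, ar t' aQ x != 0 -> vert x].
Proof.
move=> g enp hQ; have [em es ekd etl ehd] := g.
rewrite /max_flow run_seq; set t1 := run _ t.
have g1 : graph_state t1 by apply: graph_frame.
have p1 i : i < m -> ar t1 aPHI i = 0.
  have : (fun i t' => forall j, j < i -> ar t' aPHI j = 0) (rg t rM) t1.
    apply: (for_inv (P := fun i t' => forall j, j < i -> ar t' aPHI j = 0)) => // j t' jm IH hr ha k.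
    by rewrite !runE /= ?updE /= ltnS leq_eqVlt; case: eqP => //= _; apply: IH.
  by rewrite em; apply.
rewrite 2!run_seq; set t2 := run _ (run _ t1).
have g2 : graph_state t2 by rewrite /t2 -run_seq; apply: graph_frame.
have e2 : rg t2 rK1 = rg t rK1 by rewrite /t2 -run_seq /t1 !run_reg.
have n2 : rg t2 rNP = np by rewrite /t2 -run_seq /t1 !run_reg.
(* As long as the stop flag is unset, the flow value equals the number of rounds; a final value
   below the number of rounds therefore proves that the flag was set. *)
pose P j t' := [/\ flow m kd tl hd s (ar t' aDEL) (ar t' aT) (ar t' aPHI) (rg t' rF),
  rg t' rStop != 0 -> min_cut t', rg t' rStop = 0 -> rg t' rF = j
  & forall x, ar t' aQ x != 0 -> vert x].
have : P (rg t2 rK1) (run (HFor rG rK1 augment) t2).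
  apply: for_inv.
    split=> //; last by rewrite /t2 -run_seq /t1 !run_arr.
    apply: flow0 => i im; rewrite /t2 -run_seq run_arr //; exact: p1.
  move=> j t3 jm [h1 h2 h3 h4] hr ha; rewrite /augment run_if.
  have -> : ev (Reg rStop) (hset t3 rG j) = rg t3 rStop by [].
  case: ifPn => [st|]; first by split=> //= e; rewrite [rg _ _]e in st.
  rewrite negbK => /eqP st; have ej := h3 st.
  rewrite 3!run_seq run_if; set t4 := hset t3 rG j.
  have g4 : graph_state t4 by case: g2 => *; split; rewrite /= ?updE ?hr ?ha.
  have n4 : rg t4 rNP = np by rewrite /= updE /= hr.
  set t5 := run (HFor _ _ _) (run clear_Q t4).
  have [q [ht hc]] := search_ok g4 n4 h4; rewrite -/t5 in ht hc.
  have g5 : graph_state t5 by rewrite /t5 -run_seq; apply: graph_frame.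
  have h5 x : ar t5 aQ x != 0 -> vert x by case: ht => _ [-> hv]; apply: hv.
  have q5 : ar t5 aQ s != 0 by case: (ht) => hs [-> _]; apply: search_tree_root hs.
  have := find_hit_ok g5 h5 q5; set t6 := run find_hit t5 => /=.
  have a6 a : ar t6 a = ar t5 a by rewrite run_arr.
  have r5 a : a \notin [:: aQ; aNX] -> ar t5 a = ar t3 a.
    by move=> na; rewrite /t5 -run_seq run_arr //=; move: na; rewrite !inE => /norP[/negPf-> /negPf->].
  case: ifPn => [/eqP h0 hT|h0 [hT1 hT2]].
    rewrite /= run_set; split=> /=.
    + have -> : upd (rg t6) rStop 1 rF = rg t3 rF by rewrite updE /= run_reg // /t5 -run_seq run_reg.
      by rewrite !a6 !r5.
    + move=> _; split=> //=; rewrite ?a6 //.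
      * by split; [rewrite /Qset a6 | move=> x Tx; rewrite /Qset a6 hT].
      * by rewrite /Qset a6.
      * by exists q; rewrite /tree /= !a6.
    + by rewrite updE.
    + by rewrite a6.
  rewrite /= run_seq run_set.
  have g6 : graph_state t6 by apply: graph_frame.
  have n6 : rg t6 rNP = np by rewrite /t6 run_reg // /t5 -run_seq run_reg.
  have := @trace_ok t6 q (rg t3 rF) g6 n6.
  rewrite /tree !a6 => /(_ ht) tr.
  have f6 : rg (run trace t6) rF = rg t3 rF.
    by rewrite run_reg // /t6 run_reg // /t5 -run_seq run_reg.
  split=> /=.
  + rewrite !updE /= f6 addn1 (@run_arr _ _ aDEL) // (@run_arr _ _ aT) // !a6; apply: tr => //.
      by case: ht => _ [<- _].
    by rewrite !r5.
  + rewrite updE /= run_reg // /t6 run_reg // /t5 -run_seq run_reg //= updE /=.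
    by rewrite [rg _ _]st.
  + by rewrite updE /= f6 ej addn1.
  + by rewrite run_arr // a6.
case=> h1 h2 h3 h4; split=> // lt; apply: h2; apply/eqP=> e0; move: lt.
by rewrite (h3 e0) e2 ltnn.
Qed.

End Flow.

(** * The branching search *)

(** A broken clause has its head in [Q], and it is an arc exactly when its tail is outside;
    comparing the two negations expresses this for truth values that are arbitrary numbers. *)
Definition select : hl :=
  rFound ::= Cst 0 ;;
  HFor rI rM
    (HIf (And (Not (At aDEL)) (Arr aQ (At aHD)))
      (HIf (Same (Not (At aKD)) (Not (Arr aQ (At aTL))))
        (rFound ::= Cst 1 ;; rC ::= Reg rI) HSkip)
      HSkip).

(** [aSA] records the alternative being explored for the stacked clause: 0 for deletion, 1 for a
    marked head, 2 for a marked tail. *)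
Definition push : hl :=
  HStore aSC (Reg rDep) (Reg rC) ;; HStore aSA (Reg rDep) (Cst 0) ;;
  HStore aDEL (Reg rC) (Cst 1) ;;
  rND ::= Plus (Reg rND) (Cst 1) ;; rDep ::= Plus (Reg rDep) (Cst 1).

Definition decide : hl :=
  max_flow ;;
  HIf (Minus (Plus (Reg rND) (Reg rF)) (Reg rK)) (rMode ::= Cst 1)
    (select ;; HIf (Reg rFound) push (rDone ::= Cst 1)).

Notation Top a := (Arr a (Minus (Reg rDep) (Cst 1))) (only parsing).
Notation TopC a := (Arr a (Reg rC)) (only parsing).

(** No old values are saved: a clause branched on was undeleted and the endpoint to be marked was
    unmarked, so writing 0 undoes a choice. After a pop the mode stays at backtracking; an empty
    stack means that the search is exhausted. An arc skips the third alternative because its tail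
    already lies outside the cut. *)
Definition backtrack : hl :=
  HIf (Reg rDep)
    (rC ::= Top aSC ;; rP ::= Top aSA ;;
     HIf (Reg rP)
       (HIf (And (Same (Reg rP) (Cst 1)) (TopC aKD))
         (HStore aT (TopC aHD) (Cst 0) ;; HStore aT (TopC aTL) (Cst 1) ;;
          HStore aSA (Minus (Reg rDep) (Cst 1)) (Cst 2) ;; rMode ::= Cst 0)
         (HIf (Same (Reg rP) (Cst 1)) (HStore aT (TopC aHD) (Cst 0))
            (HStore aT (TopC aTL) (Cst 0)) ;;
          rDep ::= Minus (Reg rDep) (Cst 1)))
       (HStore aDEL (Reg rC) (Cst 0) ;; rND ::= Minus (Reg rND) (Cst 1) ;;
        HStore aT (TopC aHD) (Cst 1) ;;
        HStore aSA (Minus (Reg rDep) (Cst 1)) (Cst 1) ;; rMode ::= Cst 0))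
    (rDone ::= Cst 2).

Definition step : hl := HIf (Reg rDone) HSkip (HIf (Reg rMode) backtrack decide).

Lemma run_regs (c : hl) (s : hstate) (xs : seq nat) :
  all (fun x => x \notin wregs c) xs -> forall x, x \in xs -> rg (run c s) x = rg s x.
Proof. by move/allP=> h x /h; apply: run_reg. Qed.

Lemma run_arrs (c : hl) (s : hstate) (xs : seq nat) :
  all (fun x => x \notin warrs c) xs -> forall x, x \in xs -> ar (run c s) x = ar s x.
Proof. by move/allP=> h x /h; apply: run_arr. Qed.

Lemma upd_restore (f : nat -> nat) (i v : nat) : upd (upd f i v) i (f i) = f.
Proof.
by apply: functional_extensionality => j; rewrite !updE; case: eqP => // ->.
Qed.

Section Search.

Variables (m : nat) (kd tl hd : nat -> nat) (s : nat).

Local Notation adm := (admissible s).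
Local Notation nv := (nviol m kd tl hd).
Local Notation dn := (din m kd tl hd).

Definition feasible (dl T : nat -> nat) (j : nat) : Prop :=
  exists2 Z, adm T Z & nv dl Z <= j.

Definition cut_bound (dl T : nat -> nat) (f : nat) : Prop :=
  forall Z, adm T Z -> f <= dn dl Z.

(** What the search needs to know of a branching clause, detached from the flow that produced it:
    the lower bounds on the cuts of the children serve the running time, [br_complete] serves
    correctness. *)
Record branching (dl T : nat -> nat) (f c : nat) : Prop := Branching {
  br_lt : c < m;
  br_del : dl c = 0;
  br_hd : T (hd c) = 0;
  br_tl : kd c != 0 -> T (tl c) = 0;
  br_bound : forall g, cut_bound dl T g -> g <= f;
  br_lower_del : cut_bound (upd dl c 1) T (if kd c == 0 then f.-1 else f);
  br_lower_hd : cut_bound dl (upd T (hd c) 1) f.+1;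
  br_lower_tl : kd c != 0 -> cut_bound dl (upd T (tl c) 1) f.+1;
  br_complete : forall j, feasible dl T j ->
    [\/ 0 < j /\ feasible (upd dl c 1) T j.-1, feasible dl (upd T (hd c) 1) j
      | kd c != 0 /\ feasible dl (upd T (tl c) 1) j] }.

Lemma violated_branching (dl T phi nx : nat -> nat) (f c : nat) (q : seq nat) (Q : nat -> bool) :
  flow m kd tl hd s dl T phi f -> adm T Q -> residual_closed m kd tl hd dl phi Q ->
  search_tree m kd tl hd s dl phi nx q -> (forall x, Q x = (x \in q)) ->
  c < m -> violated kd tl hd dl Q c -> branching dl T f c.
Proof.
move=> hf hQ hc ht Qq cm vc.
have dc : dl c = 0 by case/andP: vc => /eqP.
have Qh : Q (hd c) by move: vc; rewrite /violated /enters; case: (kd c == 0) => /andP[_ /andP[]].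
have Qt : kd c != 0 -> Q (tl c) by move: vc; rewrite /violated; case: (kd c == 0) => // /andP[_ /andP[]].
have T0 x : Q x -> T x = 0.
  by case: (T x =P 0) => // /eqP hx Qx; case: hQ => _ /(_ _ hx); rewrite Qx.
have sub T' x : adm (upd T x 1) T' -> adm T T' /\ ~~ T' x.
  case=> h1 h2; split; last by apply: h2; rewrite updE eqxx.
  by split=> // y hy; apply: h2; rewrite updE; case: (y =P x).
(* An admissible set of in-degree at most [f] would be a minimum cut, hence would contain the search
   tree and with it [x]. So marking a vertex of [Q] raises the minimum cut. *)
have low x : Q x -> cut_bound dl (upd T x 1) f.+1.
  move=> Qx Z /sub [hZ Zx]; rewrite ltnNge; apply/negP=> le.
  have hr := tight_residual_closed hf hZ le.
  by case/negP: Zx; apply: (search_tree_min ht) hr _ _; [case: hZ | rewrite -Qq].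
split=> //.
- exact: T0.
- by move/Qt/T0.
- by move=> g /(_ Q hQ); rewrite (din_residual_closed hf hQ hc).
- move=> Z hZ; have lf := flow_le_din hf hZ; case: ifPn => k0.
    by have := din_upd kd tl hd dl Z cm; lia.
  apply: (leq_trans lf); rewrite leq_eqVlt; apply/orP; left; apply/eqP.
  apply: eq_bigr => i _; rewrite live_upd; case: eqP => //= ->.
  by rewrite /live (negPf k0) andbF.
- exact: low.
- by move=> /Qt /low.
(* After uncrossing, the set lies in [Q] and misses the tail of any arc entering [Q]. So either it
   breaks the clause [c], which may then be deleted, or it misses an endpoint that may be marked:
   the head of an arc, one of the two ends of an edge. *)
move=> j [Z hZ le]; have [hZ' le'] := nviol_uncross hf hQ hc hZ.
set Z' := (fun x => _) in hZ' le'.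
have ext x : ~~ Z' x -> feasible dl (upd T x 1) j.
  move=> Zx; exists Z'; last by lia.
  by case: hZ' => h1 h2; split=> // y; rewrite updE; case: (y =P x) => [-> //|_]; apply: h2.
have [vz|nvz] := boolP (violated kd tl hd dl Z' c).
  have := nviol_upd cm vz; constructor 1; split; first by lia.
  by exists Z' => //; lia.
move: nvz vc; rewrite /violated dc /enters eqxx /=.
case: ifPn => [k0|k0] nvz.
  case/andP=> Qt0 _; have Zt : Z' (tl c) = false by rewrite /Z' (negPf Qt0) andbF.
  by rewrite Zt in nvz; constructor 2; apply: ext.
move=> _; have [Zh|] := boolP (Z' (hd c)); last by constructor 2; apply: ext.
by constructor 3; split=> //; apply: ext; rewrite Zh andbT in nvz.
Qed.

Variables (k np : nat).
Hypothesis np_bound : forall q : seq nat,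
  uniq q -> (forall x, x \in q -> vert m tl hd s x) -> size q < np.

Definition count_del (dl : nat -> nat) : nat := \sum_(i < m) (dl i != 0).

Record ready (t : hstate) : Prop := Ready {
  rd_graph : graph_state m kd tl hd s t;
  rd_k : rg t rK = k;
  rd_k1 : rg t rK1 = k.+1;
  rd_np : rg t rNP = np;
  rd_Q : forall x, ar t aQ x != 0 -> vert m tl hd s x;
  rd_nd : count_del (ar t aDEL) = rg t rND;
  rd_done : rg t rDone = 0 }.

Lemma count_del_upd (dl : nat -> nat) (c : nat) :
  c < m -> dl c = 0 -> count_del (upd dl c 1) = (count_del dl).+1.
Proof.
move=> cm d0; pose o := Ordinal cm.
have D (g : nat -> nat) : \sum_(j < m) g j = g c + \sum_(j < m | j != o) g j.
  by rewrite (bigD1 o).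
rewrite /count_del (D (fun i => nat_of_bool (upd dl c 1 i != 0))) (D (fun i => nat_of_bool (dl i != 0))).
rewrite d0 updE eqxx add1n add0n; congr _.+1; apply: eq_bigr => i io.
by rewrite updE; have -> : (i : nat) == c = false by exact: negPf.
Qed.

Lemma select_ok (t : hstate) :
  graph_state m kd tl hd s t ->
  let t' := run select t in
  if rg t' rFound == 0 then nv (ar t aDEL) (Qset t) = 0
  else rg t' rC < m /\ violated kd tl hd (ar t aDEL) (Qset t) (rg t' rC).
Proof.
move=> g; have [em _ ekd etl ehd] := g.
rewrite /select run_seq run_set; set t1 := hset _ _ _.
pose R i t' := if rg t' rFound == 0 then
    forall j, j < i -> violated kd tl hd (ar t aDEL) (Qset t) j = false
  else rg t' rC < m /\ violated kd tl hd (ar t aDEL) (Qset t) (rg t' rC).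
have : R (rg t1 rM) (run (HFor rI rM (HIf (And (Not (At aDEL)) (Arr aQ (At aHD)))
      (HIf (Same (Not (At aKD)) (Not (Arr aQ (At aTL))))
        (rFound ::= Cst 1 ;; rC ::= Reg rI) HSkip)
      HSkip)) t1).
  apply: for_inv => // i t' im IH hr ha.
  have at' a : ar t' a = ar t a by rewrite ha.
  rewrite !runE /= ?at' ?updE /= ekd etl ehd.
  have E : violated kd tl hd (ar t aDEL) (Qset t) i =
      [&& (ar t aDEL i == 0), (ar t aQ (hd i) != 0) & 1 - kd i == 1 - ar t aQ (tl i)].
    rewrite /violated /enters /Qset; case: (kd i =P 0) => k0;
    case: (ar t 15 (tl i) =P 0) => q0; case: (ar t 9 i == 0); case: (ar t 15 (hd i) != 0) => //=; lia.
  have [v|v] := boolP (violated kd tl hd (ar t aDEL) (Qset t) i).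
    move: (v); rewrite E => /and3P[-> -> ->] /=; rewrite /R /= ?updE /=; split=> //.
    by rewrite -em.
  have -> : (if (ar t 9 i == 0) && (ar t 15 (hd i) != 0)
     then if 1 - kd i == 1 - ar t 15 (tl i) then hset (hset (hset t' 0 i) 18 1) 17 i else hset t' 0 i
     else hset t' 0 i) = hset t' 0 i.
    by move: v; rewrite E; case: (ar t 9 i == 0); case: (ar t 15 (hd i) != 0); case: (1 - _ == _).
  move: IH; rewrite /R /= ?updE /=; case: ifP => // _ h j; rewrite ltnS leq_eqVlt => /orP[/eqP ->|/h //].
  exact: negPf.
rewrite /R [rg t1 rM]em /=; case: ifP => // _ h.
by rewrite /nviol big1 // => i _; rewrite h.
Qed.

Definition decided (t t' : hstate) : Prop :=
  [\/ [/\ ready t', rg t' rMode = 1,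
         [/\ ar t' aDEL = ar t aDEL, ar t' aT = ar t aT, ar t' aSC = ar t aSC & ar t' aSA = ar t aSA],
         rg t' rND = rg t rND /\ rg t' rDep = rg t rDep
       & forall j, feasible (ar t aDEL) (ar t aT) j -> k < rg t rND + j],
     [/\ rg t' rDone = 1, count_del (ar t' aDEL) <= k
       & exists2 Z, adm (ar t aT) Z & nv (ar t' aDEL) Z = 0]
   | exists f c, branching (ar t aDEL) (ar t aT) f c /\
      [/\ ready t' /\ rg t' rMode = 0, f + rg t rND <= k,
       [/\ ar t' aDEL = upd (ar t aDEL) c 1, ar t' aT = ar t aT,
           ar t' aSC = upd (ar t aSC) (rg t rDep) c & ar t' aSA = upd (ar t aSA) (rg t rDep) 0]
     & rg t' rND = (rg t rND).+1 /\ rg t' rDep = (rg t rDep).+1]].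

Lemma decide_ok (t : hstate) : ready t -> rg t rMode = 0 -> decided t (run decide t).
Proof.
move=> [g ek ek1 enp hQ end_ edone] emode; rewrite /decided /decide run_seq; set t1 := run max_flow t.
have [hf hcut hQ1] := max_flow_ok np_bound g enp hQ; rewrite -/t1 in hf hcut hQ1.
have g1 : graph_state m kd tl hd s t1 by apply: graph_frame.
have r1 x : x \in [:: rK; rK1; rNP; rND; rDone; rMode; rDep] -> rg t1 x = rg t x.
  by apply: run_regs.
have a1 a : a \in [:: aDEL; aT; aSC; aSA] -> ar t1 a = ar t a.
  by apply: run_arrs.
rewrite run_if.
have -> : ev (Minus (Plus (Reg rND) (Reg rF)) (Reg rK)) t1 = rg t rND + rg t1 rF - k.
  by rewrite /= (r1 rND) // (r1 rK) // ek.
case: ifPn => hk.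
  constructor 1; rewrite run_set; split=> //=.
  - by split=> //=; rewrite ?updE /= ?r1 ?a1.
  - by rewrite !a1.
  - by rewrite !updE /= !r1.
  (* Pruning is sound since the in-degree alone makes every admissible set break at least as many
     clauses as the flow value. *)
  move=> j [Z hZ le]; have := flow_le_din hf; rewrite !a1 // => /(_ _ hZ).
  by move: le; rewrite nviolE; lia.
have {}hk : rg t rND + rg t1 rF <= k by lia.
rewrite run_seq run_if; set t2 := run select t1.
have := select_ok g1; rewrite -/t2 /= => hsel.
have {}hcut : min_cut m kd tl hd s t1 by apply: hcut; rewrite ek1; lia.
have a2 a : ar t2 a = ar t1 a by rewrite run_arr.
have r2 x : x \in [:: rK; rK1; rNP; rND; rDone; rMode; rDep] -> rg t2 x = rg t x.
  by move=> hx; rewrite -r1 //; apply: run_regs hx.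
have [cQ1 cQ2 [q [hq1 [hq2 hq3]]]] := hcut.
case: ifPn hsel => h0 hsel.
  constructor 2; rewrite run_set; split=> //=; rewrite ?a2 ?a1 //.
    by rewrite end_; lia.
  exists (Qset t1); first by rewrite -(a1 aT).
  by move: hsel; rewrite (a1 aDEL).
constructor 3; exists (rg t1 rF), (rg t2 rC).
case: hsel => cm vc.
have br : branching (ar t1 aDEL) (ar t1 aT) (rg t1 rF) (rg t2 rC).
  by apply: (violated_branching hf cQ1 cQ2 hq1).
rewrite !a1 // in br; split=> //.
have g2 : graph_state m kd tl hd s t2 by apply: graph_frame.
rewrite /push !runE /=; split.
- split; last by rewrite !updE /= r2.
  split=> /=; rewrite ?updE /= ?(r2 rK) ?(r2 rK1) ?(r2 rNP) ?(r2 rND) ?(r2 rDone) //.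
  + by rewrite a2.
  + by rewrite a2 a1 // count_del_upd ?end_ ?addn1 //; apply: br_del br.
- by rewrite addnC.
- by rewrite !a2 !a1 //= (r2 rDep).
- by rewrite !updE /= !r2 // !addn1.
Qed.


Definition steps (i0 n : nat) (t : hstate) : hstate :=
  foldl (fun t i => run step (hset t rB i)) t (iota i0 n).

Lemma stepsD (i0 a b : nat) (t : hstate) :
  steps i0 (a + b) t = steps (i0 + a) b (steps i0 a t).
Proof. by rewrite /steps iotaD foldl_cat. Qed.

Lemma steps1 (i0 : nat) (t : hstate) : steps i0 1 t = run step (hset t rB i0).
Proof. by []. Qed.

Lemma ready_hset (t : hstate) (x v : nat) :
  x \notin [:: rM; rS; rK; rK1; rNP; rND; rDone] -> ready t -> ready (hset t x v).
Proof.
rewrite !inE !negb_or => /and3P[x1 x2 /and5P[x3 x4 x5 x6 x7]] [g ? ? ? ? ? ?].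
by split=> //=; rewrite ?updE 1?eq_sym ?(negPf x3) ?(negPf x4) ?(negPf x5) ?(negPf x6) ?(negPf x7) //;
  apply: graph_hset.
Qed.

Definition stack_kept (t t' : hstate) (d : nat) : Prop :=
  forall j, j < d -> ar t' aSC j = ar t aSC j /\ ar t' aSA j = ar t aSA j.

Lemma step_back (t : hstate) (i : nat) :
  rg t rDone = 0 -> rg t rMode = 1 -> run step (hset t rB i) = run backtrack (hset t rB i).
Proof.
move=> e1 e2; rewrite /step run_if (_ : ev (Reg rDone) _ = 0) //.
by rewrite run_if (_ : ev (Reg rMode) _ = 1).
Qed.

Lemma step_decide (t : hstate) (i : nat) :
  rg t rDone = 0 -> rg t rMode = 0 -> run step (hset t rB i) = run decide (hset t rB i).
Proof.
move=> e1 e2; rewrite /step run_if (_ : ev (Reg rDone) _ = 0) //.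
by rewrite run_if (_ : ev (Reg rMode) _ = 0).
Qed.

Lemma decide_step (t : hstate) (i0 : nat) :
  ready t -> rg t rMode = 0 -> decided t (steps i0 1 t).
Proof.
move=> hr hm; rewrite steps1 (step_decide _ (rd_done hr) hm).
by apply: (@decide_ok (hset t rB i0)) => //; apply: ready_hset.
Qed.

Lemma back_del (t : hstate) (i d c : nat) (dl : nat -> nat) :
  ready t -> rg t rMode = 1 -> rg t rDep = d.+1 -> ar t aSC d = c -> ar t aSA d = 0 ->
  c < m -> dl c = 0 -> ar t aDEL = upd dl c 1 ->
  let t' := run step (hset t rB i) in
  [/\ ready t' /\ rg t' rMode = 0, ar t' aDEL = dl, ar t' aT = upd (ar t aT) (hd c) 1,
      [/\ rg t' rND = (rg t rND).-1, rg t' rDep = d.+1, ar t' aSC d = c & ar t' aSA d = 1]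
    & stack_kept t t' d].
Proof.
move=> [g ek ek1 enp hQ end_ edone] emode edep ec ea cm d0 edel.
have [_ _ ekd etl ehd] := g.
rewrite (step_back _ edone emode) /backtrack !runE /= ?updE /= edep /= subn1 /= ec ea /=.
have E : upd (ar t 9) c 0 = dl by rewrite edel -d0 upd_restore.
rewrite ehd; split=> //.
- by split=> //=; split=> //=; rewrite E !updE /= -end_ edel count_del_upd // subn1.
- by split=> //=; rewrite !updE /= ?eqxx ?subn1.
- by move=> j jd; rewrite /= updE; case: (j =P d) jd => // ->; rewrite ltnn.
Qed.

Lemma back_edge (t : hstate) (i d c : nat) (T : nat -> nat) :
  ready t -> rg t rMode = 1 -> rg t rDep = d.+1 -> ar t aSC d = c -> ar t aSA d = 1 ->
  kd c != 0 -> T (hd c) = 0 -> ar t aT = upd T (hd c) 1 ->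
  let t' := run step (hset t rB i) in
  [/\ ready t' /\ rg t' rMode = 0, ar t' aDEL = ar t aDEL, ar t' aT = upd T (tl c) 1,
      [/\ rg t' rND = rg t rND, rg t' rDep = d.+1, ar t' aSC d = c & ar t' aSA d = 2]
    & stack_kept t t' d].
Proof.
move=> [g ek ek1 enp hQ end_ edone] emode edep ec ea k0 d0 edel.
have [_ _ ekd etl ehd] := g.
rewrite (step_back _ edone emode) /backtrack !runE /= ?updE /= edep /= subn1 /= ec ea /= ekd k0 /= ehd etl.
have E : upd (ar t 14) (hd c) 0 = T by rewrite edel -d0 upd_restore.
split=> //=; rewrite ?E //.
- by split=> //=; rewrite !updE /= ?eqxx.
- by move=> j jd; rewrite /= updE; case: (j =P d) jd => // ->; rewrite ltnn.
Qed.

Lemma back_pop (t : hstate) (i d c : nat) (T : nat -> nat) :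
  ready t -> rg t rMode = 1 -> rg t rDep = d.+1 -> ar t aSC d = c ->
  (if kd c == 0 then ar t aSA d = 1 else ar t aSA d = 2) ->
  let x := if kd c == 0 then hd c else tl c in
  T x = 0 -> ar t aT = upd T x 1 ->
  let t' := run step (hset t rB i) in
  [/\ ready t' /\ rg t' rMode = 1, ar t' aDEL = ar t aDEL, ar t' aT = T,
      rg t' rND = rg t rND /\ rg t' rDep = d
    & stack_kept t t' d].
Proof.
move=> [g ek ek1 enp hQ end_ edone] emode edep ec ea x d0 edel.
have [_ _ ekd etl ehd] := g.
rewrite (step_back _ edone emode) /backtrack !runE /= ?updE /= edep /= subn1 /= ec ekd.
have -> : (ar t 19 d != 0) by case: (kd c == 0) ea => ->.
have -> : (ar t 19 d == 1) && (kd c != 0) = false by case: (kd c == 0) ea => ->.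
have e : upd (ar t 14) x 0 = T by rewrite edel -d0 upd_restore.
have -> : (ar t 19 d == 1) = (kd c == 0) by case: (kd c == 0) ea => ->.
rewrite /= ehd etl; rewrite /x in e; case: (kd c == 0) e => e; split=> //=;
  by rewrite ?updE /= ?edep ?subn1.
Qed.

(** A failed subtree returns the deletions, the marks and the stack below its own depth as it found
    them, so the parent can resume from the resulting state. *)
Definition failed (t t' : hstate) : Prop :=
  [/\ ready t' /\ rg t' rMode = 1, ar t' aDEL = ar t aDEL /\ ar t' aT = ar t aT,
      rg t' rND = rg t rND /\ rg t' rDep = rg t rDep, stack_kept t t' (rg t rDep)
    & forall j, feasible (ar t aDEL) (ar t aT) j -> k < rg t rND + j].

Definition succeeded (T : nat -> nat) (t' : hstate) : Prop :=
  [/\ rg t' rDone = 1, count_del (ar t' aDEL) <= k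
    & exists2 Z, adm T Z & nv (ar t' aDEL) Z = 0].

Lemma succeeded_weaken (T : nat -> nat) (x : nat) (t : hstate) :
  succeeded (upd T x 1) t -> succeeded T t.
Proof.
case=> h1 h2 [Z [Zs ZT] nZ]; split=> //; exists Z => //; split=> // y hy.
by apply: ZT; rewrite updE; case: (y =P x).
Qed.

Lemma leq_exp35 (f K : nat) : f <= K -> 3 ^ f <= 5 ^ K.
Proof.
elim: K f => [|K IH] [|f] // h; first by rewrite expn_gt0.
by rewrite !expnS leq_mul // IH.
Qed.

(* Each node is charged 4 * 5^K / 3^f micro-steps, where K - 1 is the remaining
   budget and f a lower bound on the minimum cut. *)
Lemma dfs (N K f0 : nat) (t : hstate) (i0 : nat) :
  2 * K - f0 <= N -> ready t -> rg t rMode = 0 -> rg t rND + K = k.+1 -> f0 <= K ->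
  cut_bound (ar t aDEL) (ar t aT) f0 ->
  exists n, (n + 3) * 3 ^ f0 <= 4 * 5 ^ K /\
    (failed t (steps i0 n t) \/ succeeded (ar t aT) (steps i0 n t)).
Proof.
elim: N K f0 t i0 => [|N IH] K f0 t i0 hN hr hm hK hf hlow.
(* A leaf uses one micro-step. With the slack 3 that internal nodes require, the case [f0 = K = 0]
   shows where the factor 4 comes from. *)
all: have leaf : (1 + 3) * 3 ^ f0 <= 4 * 5 ^ K
  by rewrite leq_mul2l leq_exp35.
all: have [[h1 h2 [h3 h4 h5 h6] [h7 h8] h9]|[h1 h2 h3]|[f [c [br [[h1 h1'] h2 [h3 h4 h5 h6] [h7 h8]]]]]]
  := decide_step i0 hr hm.
- exists 1; split=> //; left; split=> //.
  by move=> j _; rewrite h5 h6.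
- by exists 1; split=> //; right; split.
(* A branching node has [f0 <= f < K], so the measure [2 * K - f0] is positive. It decreases in
   every child: deletion takes 2 from the first term and at most 1 from the second. *)
- by exfalso; have := br_bound br hlow; lia.
- exists 1; split=> //; left; split=> //.
  by move=> j _; rewrite h5 h6.
- by exists 1; split=> //; right; split.
set t1 := steps i0 1 t in h1 h1' h3 h4 h5 h6 h7 h8.
set dl := ar t aDEL in hlow br h3 *; set T := ar t aT in hlow br h4 *.
set d := rg t rDep in h5 h6 h8 *; set nd := rg t rND in hK h2 h7 *.
have ff := br_bound br hlow.
have cm := br_lt br; have dc := br_del br.
have fK : f < K by lia.
pose g0 := if kd c == 0 then f.-1 else f.
have A1 : 2 * K.-1 - g0 <= N by rewrite /g0; case: ifP; lia.
have A2 : rg t1 rND + K.-1 = k.+1 by lia.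
have A3 : g0 <= K.-1 by rewrite /g0; case: ifP; lia.
have A4 : cut_bound (ar t1 aDEL) (ar t1 aT) g0 by rewrite h3 h4; apply: br_lower_del br.
have [n0 [b0 r0]] := IH K.-1 g0 t1 (i0 + 1) A1 h1 h1' A2 A3 A4.
set t2 := steps (i0 + 1) n0 t1 in r0.
have s2 : steps i0 (1 + n0) t = t2 by rewrite stepsD.
have p5 : 5 ^ K = 5 * 5 ^ K.-1 by rewrite -expnS prednK //; lia.
have p3 : 3 ^ f0 <= 3 ^ f by rewrite leq_pexp2l.
have up n : (n + 3) * 3 ^ f <= 4 * 5 ^ K -> (n + 3) * 3 ^ f0 <= 4 * 5 ^ K.
  by apply: leq_trans; rewrite leq_mul2l p3 orbT.
(* The bound for the deletion child is rescaled to the factor [3 ^ f]; an arc pays 3 times more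
   because its cut may have dropped by one. *)
have b0' : (n0 + 3) * 3 ^ f <= (if kd c == 0 then 12 else 4) * 5 ^ K.-1.
  move: b0; rewrite /g0; case: ifP => // _; case: (f) => [|f'] //=; first by lia.
  by rewrite expnS; lia.
case: r0 => [[[q1 q1'] [q2 q3] [q4 q5] q6 q7]|su]; last first.
  exists (1 + n0); rewrite s2; split; last by right; rewrite h4 in su.
  by apply: up; move: b0'; rewrite p5; case: ifP => _; lia.
have q6d := q6 d; rewrite h8 in q5 q6 q6d; have [//|c1 c2] := q6d.
rewrite h5 updE eqxx in c1; rewrite h6 updE eqxx in c2.
rewrite h3 in q2; rewrite h4 in q3; rewrite h7 in q4.
have [[u1 u1'] u2 u3 [u4 u5 u6 u7] u8] := back_del (i0 + 1 + n0) q1 q1' q5 c1 c2 cm dc q2.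
set t3 := run step _ in u1 u1' u2 u3 u4 u5 u6 u7 u8.
have s3 : steps i0 (1 + n0 + 1) t = t3 by rewrite stepsD s2 steps1 addnA.
have B1 : 2 * K - f.+1 <= N by lia.
have B2 : rg t3 rND + K = k.+1 by rewrite u4 q4.
have B4 : cut_bound (ar t3 aDEL) (ar t3 aT) f.+1 by rewrite u2 u3 q3; apply: br_lower_hd br.
have [n1 [b1 r1]] := IH K f.+1 t3 (i0 + (1 + n0 + 1)) B1 u1 u1' B2 fK B4.
set t4 := steps _ n1 t3 in r1.
have s4 : steps i0 (1 + n0 + 1 + n1) t = t4 by rewrite stepsD s3.
have b1' : 3 * ((n1 + 3) * 3 ^ f) <= 4 * 5 ^ K by move: b1; rewrite expnS; lia.
case: r1 => [[[v1 v1'] [v2 v3] [v4 v5] v6 v7]|su]; last first.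
  exists (1 + n0 + 1 + n1); rewrite s4; split.
    by apply: up; move: b0' b1'; rewrite p5; case: ifP => _; lia.
  by right; rewrite u3 q3 in su; apply: succeeded_weaken su.
have v6d := v6 d; rewrite u5 in v5 v6 v6d; have [//|w1 w2] := v6d.
rewrite u6 in w1; rewrite u7 in w2; rewrite u2 in v2; rewrite u3 q3 in v3; rewrite u4 q4 /= in v4.
have feas0 j : 0 < j /\ feasible (upd dl c 1) T j.-1 -> k < nd + j.
  by case=> j0 /[dup] h; move: (q7 j.-1); rewrite h3 h4 h7 => /(_ h); lia.
have feas1 j : feasible dl (upd T (hd c) 1) j -> k < nd + j.
  by move=> h; move: (v7 j); rewrite u2 u3 q3 u4 q4 /= => /(_ h).
case: (boolP (kd c == 0)) => k0.
  have [] := @back_pop t4 (i0 + (1 + n0 + 1 + n1)) d c T v1 v1' v5 w1.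
  - by rewrite k0.
  - by rewrite k0; apply: br_hd br.
  - by rewrite k0.
  set t5 := run step _ => -[x1 x1'] x2 x3 [x4 x5] x6.
  have s5 : steps i0 (1 + n0 + 1 + n1 + 1) t = t5 by rewrite stepsD s4 steps1.
  (* An arc uses three micro-steps of its own: the decision, the switch to the second branch and the
     pop. Hence [n + 3] is exactly [(n0 + 3) + (n1 + 3)], which is why the slack is 3. *)
  exists (1 + n0 + 1 + n1 + 1); rewrite s5; split.
    by apply: up; move: b0' b1'; rewrite k0 p5; lia.
  left; split=> //.
  + by rewrite x2 v2 x3.
  + by rewrite x4 v4 x5.
  + move=> j jd; have [-> ->] := x6 j jd; have [-> ->] := v6 j (ltnW jd).
    have [-> ->] := u8 j jd; have [-> ->] := q6 j (ltnW jd).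
    by rewrite h5 h6 !updE; case: (j =P d) jd => // ->; rewrite ltnn.
  + by move=> j /(br_complete br) [/feas0|/feas1|[]] //; rewrite k0.
have [] := @back_edge t4 (i0 + (1 + n0 + 1 + n1)) d c T v1 v1' v5 w1 w2 k0 (br_hd br) v3.
set t5 := run step _ => -[x1 x1'] x2 x3 [x4 x5 x6 x7] x8.
have s5 : steps i0 (1 + n0 + 1 + n1 + 1) t = t5 by rewrite stepsD s4 steps1.
have C2 : rg t5 rND + K = k.+1 by rewrite x4 v4.
have C4 : cut_bound (ar t5 aDEL) (ar t5 aT) f.+1 by rewrite x2 v2 x3; apply: br_lower_tl br k0.
have [n2 [b2 r2]] := IH K f.+1 t5 (i0 + (1 + n0 + 1 + n1 + 1)) B1 x1 x1' C2 fK C4.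
set t6 := steps _ n2 t5 in r2.
have s6 : steps i0 (1 + n0 + 1 + n1 + 1 + n2) t = t6 by rewrite stepsD s5.
have b2' : 3 * ((n2 + 3) * 3 ^ f) <= 4 * 5 ^ K by move: b2; rewrite expnS; lia.
rewrite (negPf k0) in b0'.
case: r2 => [[[y1 y1'] [y2 y3] [y4 y5] y6 y7]|su]; last first.
  exists (1 + n0 + 1 + n1 + 1 + n2); rewrite s6; split; first by apply: up; move: b1' b2'; rewrite p5; lia.
  by right; rewrite x3 in su; apply: succeeded_weaken su.
have y6d := y6 d; rewrite x5 in y5 y6 y6d; have [//|z1 z2] := y6d.
rewrite x6 in z1; rewrite x7 in z2; rewrite x2 v2 in y2; rewrite x3 in y3; rewrite x4 v4 in y4.
have feas2 j : feasible dl (upd T (tl c) 1) j -> k < nd + j.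
  by move=> h; move: (y7 j); rewrite x2 v2 x3 x4 v4 => /(_ h).
have [] := @back_pop t6 (i0 + (1 + n0 + 1 + n1 + 1 + n2)) d c T y1 y1' y5 z1.
- by rewrite (negPf k0).
- by rewrite (negPf k0); apply: br_tl br k0.
- by rewrite (negPf k0).
set t7 := run step _ => -[o1 o1'] o2 o3 [o4 o5] o6.
have s7 : steps i0 (1 + n0 + 1 + n1 + 1 + n2 + 1) t = t7 by rewrite stepsD s6 steps1.
(* An edge uses four micro-steps of its own, and the slacks of its three children add up to 9, more
   than the 4 + 3 to be covered. *)
exists (1 + n0 + 1 + n1 + 1 + n2 + 1); rewrite s7; split; first by apply: up; move: b1' b2'; rewrite p5; lia.
left; split=> //.
+ by rewrite o2 y2 o3.
+ by rewrite o4 y4 o5.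
+ move=> j jd; have [-> ->] := o6 j jd; have [-> ->] := y6 j (ltnW jd).
  have [-> ->] := x8 j jd; have [-> ->] := v6 j (ltnW jd).
  have [-> ->] := u8 j jd; have [-> ->] := q6 j (ltnW jd).
  by rewrite h5 h6 !updE; case: (j =P d) jd => // ->; rewrite ltnn.
+ by move=> j /(br_complete br) [/feas0|/feas1|[_ /feas2]].
Qed.

End Search.

(** * A satisfying assignment *)

Notation rR := 31 (only parsing).

(* The two runs live in one array: run r of the literal c is the cell 2c + r. *)
Definition Xix (e : exp) : exp := Plus (Plus e e) (Reg rR).
Definition X (e : exp) : exp := Arr aX (Xix e).

(** A literal already in the committed assignment is not taken into the run, so the run stays on
    uncommitted variables and can be merged later without conflict. *)
Definition propagate1 (a b : nat) : hl :=
  HIf (And (X (At a)) (Not (Plus (X (At b)) (Arr aA (At b)))))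
    (HStore aX (Xix (At b)) (Cst 1) ;; rCX ::= Cst 1) HSkip.

Definition propagate : hl := propagate1 aNA aLB ;; propagate1 aNB aLA.

Definition check_consistent : hl :=
  HIf (Plus (And (X (At aLA)) (X (At aNA))) (And (X (At aLB)) (X (At aNB))))
    (rBX ::= Cst 1) HSkip.

Definition advance : hl :=
  rCX ::= Cst 0 ;; rBX ::= Cst 0 ;; HFor rI rM propagate ;; HFor rI rM check_consistent.

Definition commit1 (a : nat) : hl := HIf (X (At a)) (HStore aA (At a) (Cst 1)) HSkip.

Definition commit : hl :=
  HFor rI rM (commit1 aLA ;; commit1 aNA ;; commit1 aLB ;; commit1 aNB).

Definition clear1 (a : nat) : hl :=
  HStore aX (Plus (At a) (At a)) (Cst 0) ;;
  HStore aX (Plus (Plus (At a) (At a)) (Cst 1)) (Cst 0).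

Definition clear_runs : hl :=
  HFor rI rM (clear1 aLA ;; clear1 aNA ;; clear1 aLB ;; clear1 aNB).

Definition free1 (a b : nat) : hl :=
  HIf (Plus (Arr aA (At a)) (Arr aA (At b))) HSkip
    (rPick ::= Cst 1 ;; rP ::= At a ;; rOut ::= At b).

Definition find_free : hl :=
  rPick ::= Cst 0 ;; HFor rI rM (free1 aLA aNA ;; free1 aLB aNB).

Definition pick : hl :=
  clear_runs ;; find_free ;;
  HIf (Reg rPick)
    (HStore aX (Plus (Reg rP) (Reg rP)) (Cst 1) ;;
     HStore aX (Plus (Plus (Reg rOut) (Reg rOut)) (Cst 1)) (Cst 1))
    HSkip.

(** A run is committed once a pass adds nothing to it and it is consistent. An inconsistent run is
    never committed; it only keeps turning until the other one is finished. *)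
Definition sat_step : hl :=
  rR ::= Cst 0 ;; advance ;;
  HIf (Plus (Reg rCX) (Reg rBX))
    (rR ::= Cst 1 ;; advance ;;
     HIf (Plus (Reg rCX) (Reg rBX)) HSkip (commit ;; pick))
    (commit ;; pick).

(** Negation on the codes [2 * x + b] of the literals [(x, b)]. *)
Definition nc (c : nat) : nat := if odd c then c.-1 else c.+1.

Lemma ncK (c : nat) : nc (nc c) = c.
Proof. by rewrite /nc; case: (boolP (odd c)) => h; rewrite /= ?h //=; case: c h => //= c /negPf ->. Qed.

Lemma half_nc (c : nat) : (nc c)./2 = c./2.
Proof. by rewrite /nc; case: ifP; lia. Qed.

Lemma half_eq (c d : nat) : c./2 = d./2 -> c = d \/ c = nc d.
Proof. by rewrite /nc; case: ifP; lia. Qed.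

Lemma count_le (T : eqType) (p q : pred T) (v : seq T) :
  (forall y, y \in v -> p y -> q y) -> count p v <= count q v.
Proof.
elim: v => // y v IH sub /=; apply: leq_add; last first.
  by apply: IH => z zv; apply: sub; rewrite inE zv orbT.
by have := sub y (mem_head _ _); case: (p y) => // ->.
Qed.

Lemma count_lt (T : eqType) (p q : pred T) (v : seq T) (x : T) :
  (forall y, y \in v -> p y -> q y) -> x \in v -> q x -> ~~ p x -> count p v < count q v.
Proof.
elim: v => // y v IH sub; rewrite inE => /orP[/eqP <-|xv] qx npx /=.
  rewrite qx (negPf npx) add0n add1n ltnS; apply: count_le => z zv; apply: sub.
  by rewrite inE zv orbT.
have := IH (fun z zv => sub z (mem_behead (s := y :: v) zv)) xv qx npx.
by case: (boolP (p y)) => [/(sub y (mem_head _ _)) ->|_]; case: (q y); lia.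
Qed.

Lemma count_disjoint (T : eqType) (p q r : pred T) (v : seq T) :
  (forall y, y \in v -> p y -> q y -> False) ->
  (forall y, y \in v -> p y || q y -> r y) -> count p v + count q v <= count r v.
Proof.
elim: v => // y v IH h1 h2 /=.
have [H1 H2] := (h1 y (mem_head _ _), h2 y (mem_head _ _)).
have := IH (fun z zv => h1 z (mem_behead (s := y :: v) zv)) (fun z zv => h2 z (mem_behead (s := y :: v) zv)).
move: H1 H2; case: (p y); case: (q y) => /= H1 H2.
- by case: (H1 isT isT).
- by rewrite (H2 isT); lia.
- by rewrite (H2 isT); lia.
- by lia.
Qed.

(** * Correctness and amortised length of the two parallel closures *)

Section Sat.

Variables (m : nat) (la na lb nb : nat -> nat) (V : seq nat) (P Lc : nat -> bool).
Hypothesis na_la : forall i, i < m -> na i = nc (la i).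
Hypothesis nb_lb : forall i, i < m -> nb i = nc (lb i).
Hypothesis la_V : forall i, i < m -> (la i)./2 \in V.
Hypothesis lb_V : forall i, i < m -> (lb i)./2 \in V.

Definition flit_of (i c : nat) : bool := c \in [:: la i; na i; lb i; nb i].
Definition flit (c : nat) : Prop := exists2 i, i < m & flit_of i c.

Hypothesis P_sat : forall i, i < m -> P (la i) || P (lb i).
Hypothesis P_cons : forall c, flit c -> P c -> ~~ P (nc c).
Hypothesis P_tot : forall c, flit c -> P c || P (nc c).
Hypothesis V_flit : forall v, v \in V -> flit v.*2.
Hypothesis P_L : forall c, Lc c -> flit c -> P c.

Lemma flit_nc (c : nat) : flit c -> flit (nc c).
Proof.
case=> i im h; exists i => //; move: h; rewrite /flit_of !inE na_la // nb_lb //.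
by case/or4P=> /eqP ->; rewrite ?ncK eqxx ?orbT.
Qed.

Lemma flit_V (c : nat) : flit c -> c./2 \in V.
Proof.
case=> i im; rewrite /flit_of !inE na_la // nb_lb //.
by case/or4P=> /eqP ->; rewrite ?half_nc ?la_V ?lb_V.
Qed.

Lemma flit_la i : i < m -> flit (la i). Proof. by exists i => //; rewrite /flit_of !inE eqxx. Qed.
Lemma flit_na i : i < m -> flit (na i). Proof. by exists i => //; rewrite /flit_of !inE eqxx !orbT. Qed.
Lemma flit_lb i : i < m -> flit (lb i). Proof. by exists i => //; rewrite /flit_of !inE eqxx !orbT. Qed.
Lemma flit_nb i : i < m -> flit (nb i). Proof. by exists i => //; rewrite /flit_of !inE eqxx !orbT. Qed.

Lemma P_arc (i : nat) : i < m -> (P (na i) -> P (lb i)) /\ (P (nb i) -> P (la i)).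
Proof.
move=> im; rewrite na_la // nb_lb //; split=> h.
  have := P_sat im; have := P_cons (flit_nc (flit_la im)) h; rewrite ncK => /negPf ->.
  by [].
have := P_sat im; have := P_cons (flit_nc (flit_lb im)) h; rewrite ncK => /negPf ->.
by rewrite orbF.
Qed.

Definition codes (t : hstate) : Prop :=
  [/\ rg t rM = m, ar t aLA = la, ar t aNA = na, ar t aLB = lb & ar t aNB = nb].

Lemma codes_frame (c : hl) (t : hstate) :
  rM \notin wregs c -> all (fun a => a \notin warrs c) [:: aLA; aNA; aLB; aNB] ->
  codes t -> codes (run c t).
Proof.
by move=> h0 /and5P[h1 h2 h3 h4 _] [g1 g2 g3 g4 g5]; split; rewrite ?run_reg ?run_arr.
Qed.

Definition Xs (t : hstate) (r c : nat) : bool := ar t aX (c + c + r) != 0.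
Definition As (t : hstate) (c : nat) : bool := ar t aA c != 0.

Definition closedA (t : hstate) : Prop :=
  forall i, i < m -> (As t (na i) -> As t (lb i)) /\ (As t (nb i) -> As t (la i)).
Definition consistent (S : nat -> bool) : Prop := forall c, flit c -> S c -> ~~ S (nc c).
Definition fresh (t : hstate) (r : nat) : Prop :=
  forall c, flit c -> Xs t r c -> ~~ As t c /\ ~~ As t (nc c).
(** [P] is a fixed satisfying assignment that respects [L]; it need not agree with the assignment
    being built. It only certifies consistency: a run whose literals are all true under [P] keeps
    this property under propagation. *)
Definition good (t : hstate) (r : nat) : Prop := forall c, flit c -> Xs t r c -> P c.
Definition nvars (S : nat -> bool) : nat := count (fun v => S v.*2 || S v.*2.+1) V.

Lemma advance_ok (t : hstate) :
  codes t -> rg t rR < 2 -> closedA t -> fresh t (rg t rR) ->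
  let r := rg t rR in let t' := run advance t in
  [/\ [/\ codes t', (forall c, As t' c = As t c), rg t' rR = r & fresh t' r],
      (forall c, Xs t r c -> Xs t' r c),
      (forall r' c, r' < 2 -> r' != r -> Xs t' r' c = Xs t r' c),
      good t r -> good t' r
    & (if rg t' rCX == 0
       then forall i, i < m -> (Xs t' r (na i) -> Xs t' r (lb i) || As t' (lb i)) /\
                               (Xs t' r (nb i) -> Xs t' r (la i) || As t' (la i))
       else exists2 c, flit c & Xs t' r c && ~~ Xs t r c) /\
      (rg t' rBX == 0 <-> consistent (Xs t' r))].
Proof.
move=> g r2 hA hF r; rewrite /advance 3!run_seq 2!run_set.
set t1 := hset _ _ _.
have g1 : codes t1 by case: g.
have [em ela ena elb enb] := g1.
have r1 : rg t1 rR = r by [].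
set t2 := run (HFor rI rM propagate) t1.
have g2 : codes t2 by apply: codes_frame.
pose I i t' := [/\ fresh t' r, (forall c, Xs t r c -> Xs t' r c),
    (forall r' c, r' < 2 -> r' != r -> Xs t' r' c = Xs t r' c),
    good t r -> good t' r
  & if rg t' rCX == 0 then ar t' aX = ar t aX /\
      (forall j, j < i -> (Xs t r (na j) -> Xs t r (lb j) || As t (lb j)) /\
                               (Xs t r (nb j) -> Xs t r (la j) || As t (la j)))
    else exists2 c, flit c & Xs t' r c && ~~ Xs t r c].
have A0 t' : ar t' aA = ar t aA -> forall c, As t' c = As t c by rewrite /As => ->.
(* Adding the head q of an arc p -> q of the clause (~p \/ q). *)
have add (t' : hstate) (p q : nat) : ar t' aA = ar t aA -> flit p -> flit q ->
    (As t (nc q) -> As t (nc p)) -> (P p -> P q) ->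
    I 0 t' -> Xs t' r p -> Xs t' r q = false -> As t' q = false ->
    I 0 (hset (hstore t' aX (q + q + r) 1) rCX 1).
  move=> eA fp fq ctr Ppq [h1 h2 h3 h4 h5] Xp Xq Aq.
  have Xq' c : Xs (hset (hstore t' aX (q + q + r) 1) rCX 1) r c = (c == q) || Xs t' r c.
    rewrite /Xs /= updE; have -> : (c + c + r == q + q + r) = (c == q) by lia.
    by case: (c == q).
  split.
  - move=> c fc; rewrite Xq' => /orP[/eqP ->|]; last exact: h1.
    split; first by rewrite /As /= -/(As t' q) Aq.
    (* If the negation of [q] were committed, the closure of the committed set would also contain
       the negation of [p], against the freshness of [p]. *)
    have [_] := h1 p fp Xp; rewrite /As /= -!/(As t' _) !A0 //.
    by apply: contra => /ctr.
  - by move=> c /h2 hc; rewrite Xq' hc orbT.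
  - move=> r' c r'2 nr; rewrite -h3 // /Xs /= updE.
    by have -> : (c + c + r' == q + q + r) = false by move: r2 nr; rewrite -/r; lia.
  - move=> gd c fc; rewrite Xq' => /orP[/eqP ->|]; last exact: h4.
    by apply: Ppq; apply: h4.
  - rewrite /= ?updE /=; exists q => //; rewrite Xq' eqxx /=; apply/negP=> /h2; by rewrite Xq.
have I2 : I (rg t1 rM) t2.
  apply: for_inv; first by split=> //=; rewrite ?updE.
  move=> i t' im hI hr ha; rewrite em in im.
  have eA : ar t' aA = ar t aA by rewrite ha.
  have e31 : rg t' rR = r by rewrite hr.
  have c1 : ar t' aLA = la by rewrite ha.
  have c2 : ar t' aNA = na by rewrite ha.
  have c3 : ar t' aLB = lb by rewrite ha.
  have c4 : ar t' aNB = nb by rewrite ha.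
  have [ac1 ac2] := hA i im; have [pc1 pc2] := P_arc im.
  pose t3 := if Xs t' r (na i) && ~~ (Xs t' r (lb i) || As t' (lb i))
    then hset (hstore (hset t' rI i) aX (lb i + lb i + r) 1) rCX 1 else hset t' rI i.
  pose t4 := if Xs t3 r (nb i) && ~~ (Xs t3 r (la i) || As t3 (la i))
    then hset (hstore t3 aX (la i + la i + r) 1) rCX 1 else t3.
  have -> : run propagate (hset t' rI i) = t4.
    rewrite /propagate run_seq; have -> : run (propagate1 aNA aLB) (hset t' rI i) = t3.
      rewrite /propagate1 !runE /= ?updE /= c2 c3 e31 /t3 /Xs /As /=.
      by rewrite addn_eq0 negb_or !negbK.
    have a3 a : a != aX -> ar t3 a = ar t' a by rewrite /t3; case: ifP => //= _ /negPf ->.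
    have i3 : rg t3 rI = i by rewrite /t3; case: ifP => _ /=; rewrite ?updE.
    have r3 : rg t3 rR = r by rewrite /t3; case: ifP => _ /=; rewrite ?updE.
    rewrite /propagate1 !runE /= ?i3 ?r3 (a3 aLA) // (a3 aNB) // c1 c4 /t4 /Xs /As /=.
    by rewrite addn_eq0 negb_or !negbK.
  (* The index matters only while nothing has been added. Working with index 0 lets [add] apply at
     any turn; the unchanged case is recovered at the end from the flag. *)
  have w j u : I j u -> I 0 u.
    by case=> ? ? ? ? h; split=> //; move: h; case: ifP => // _ [].
  have hI0 : I 0 (hset t' rI i) by apply: (w i).
  have I3 : I 0 t3.
    rewrite /t3; case: ifPn => // /andP[x1]; rewrite negb_or => /andP[/negPf x2 /negPf x3].
    apply: (add _ (na i)) => //; [exact: flit_na | exact: flit_lb | by rewrite -nb_lb // na_la // ncK].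
  have A3 : ar t3 aA = ar t aA by rewrite /t3; case: ifP.
  have I4 : I 0 t4.
    rewrite /t4; case: ifPn => // /andP[x1]; rewrite negb_or => /andP[/negPf x2 /negPf x3].
    apply: (add _ (nb i)) => //; [exact: flit_nb | exact: flit_la | by rewrite -na_la // nb_lb // ncK].
  case: I4 => k1 k2 k3 k4 k5; split=> //; move: k5.
  case: ifP => // k0 _; rewrite /t4 in k0 *; move: k0; case: ifPn => // n4 k0.
  rewrite /t3 in k0 n4 *; move: k0 n4; case: ifPn => // n3 k0 n4.
  case: hI => _ _ _ _; rewrite [rg t' _ == 0]k0 => -[eX hj]; split=> // j.
  rewrite ltnS leq_eqVlt => /orP[/eqP ->|]; last exact: hj.
  have EX c : Xs (hset t' 0 i) r c = Xs t r c by rewrite /Xs /= eX.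
  have EX' c : Xs t' r c = Xs t r c by rewrite /Xs eX.
  have EA c : As (hset t' 0 i) c = As t c by rewrite /As /= eA.
  have EA' c : As t' c = As t c by rewrite /As eA.
  move: n3 n4; rewrite !EX !EX' !EA !EA'.
  by move=> n3 n4; split=> h; [move: n3|move: n4]; rewrite h /= negbK.
rewrite em in I2; case: I2 => h1 h2 h3 h4 h5.
set t3 := run (HFor rI rM check_consistent) t2.
have a3 a : ar t3 a = ar t2 a by rewrite run_arr.
have X3 r' c : Xs t3 r' c = Xs t2 r' c by rewrite /Xs a3.
have A2 : ar t2 aA = ar t aA by rewrite run_arr.
have A3 c : As t3 c = As t c by rewrite /As a3 A2.
split.
- split=> //; first by apply: codes_frame.
    by rewrite run_reg // run_reg.
  by move=> c fc; rewrite X3 !A3 => /(h1 c fc); rewrite /As A2.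
- by move=> c /h2; rewrite X3.
- by move=> r' c *; rewrite X3; apply: h3.
- by move=> /h4 gd c fc; rewrite X3; apply: gd.
split.
  have -> : rg t3 rCX = rg t2 rCX by rewrite run_reg.
  move: h5; case: ifP => _.
    case=> eX h i im; have EX c : Xs t3 r c = Xs t r c by rewrite X3 /Xs eX.
    by rewrite !EX !A3; apply: h.
  by case=> c fc; rewrite -X3 => h; exists c.
have em2 : rg t2 rM = m by case: g2.
pose J i t' := if rg t' rBX == 0 then forall j c, j < i -> flit_of j c -> Xs t2 r c -> ~~ Xs t2 r (nc c)
  else ~ consistent (Xs t2 r).
have : J (rg t2 rM) t3.
  apply: for_inv; first by rewrite /J run_reg.
  move=> i t' im IH hr ha; rewrite em2 in im.
  have at' a : ar t' a = ar t2 a by rewrite ha.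
  have e31 : rg t' rR = r by rewrite hr // run_reg.
  have [_ c1 c2 c3 c4] := g2.
  rewrite /check_consistent run_if.
  have -> : (ev (Plus (And (X (At aLA)) (X (At aNA))) (And (X (At aLB)) (X (At aNB)))) (hset t' rI i) != 0)
     = (Xs t2 r (la i) && Xs t2 r (na i)) || (Xs t2 r (lb i) && Xs t2 r (nb i)).
    have evP e1 e2 u : (ev (Plus e1 e2) u != 0) = (ev e1 u != 0) || (ev e2 u != 0).
      by rewrite /= addn_eq0 negb_and.
    by rewrite evP !ev_And /= ?updE /= !at' e31 c1 c2 c3 c4.
  case: ifPn => h.
    rewrite run_set /J /= ?updE /= => cs; case/orP: h => /andP[x1 x2].
      by have := cs _ (flit_la im) x1; rewrite -na_la // x2.
    by have := cs _ (flit_lb im) x1; rewrite -nb_lb // x2.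
  rewrite run_skip; move: IH; rewrite /J /= ?updE /=; case: ifP => // _ IH j c.
  rewrite ltnS leq_eqVlt => /orP[/eqP ->|]; last exact: IH.
  move: h; rewrite negb_or !negb_and /flit_of !inE !na_la // !nb_lb // => /andP[d1 d2].
  case/or4P=> /eqP -> x; rewrite ?ncK; move: d1 d2; rewrite x //= ?orbF //.
rewrite em2 /J; case: ifP => [e h|e h]; split=> //.
- move=> _ c fc; rewrite !X3; case: fc => i im ic; exact: h im ic.
- by move=> cs; case: h => c fc; rewrite -!X3; apply: cs.
Qed.


Lemma commit1_ok (a : nat) (u : hstate) :
  let u' := run (commit1 a) u in
  [/\ forall c, As u' c = As u c || (c == ar u a (rg u rI)) && Xs u (rg u rR) c,
      rg u' = rg u & forall b, b != aA -> ar u' b = ar u b].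
Proof.
rewrite /commit1 run_if.
have -> : (ev (X (At a)) u != 0) = Xs u (rg u rR) (ar u a (rg u rI)) by [].
case: ifPn => h; rewrite ?run_store ?run_skip; split=> //=.
- move=> c; rewrite /As /= updE; case: (c =P _) => [->|_]; first by rewrite h orbT.
  by rewrite orbF.
- by move=> b /negPf ->.
- by move=> c; case: eqP => [->|_]; rewrite ?(negPf h) orbF.
Qed.

Lemma commit_ok (t : hstate) :
  codes t ->
  let t' := run commit t in
  [/\ codes t', ar t' aX = ar t aX
    & forall c, As t' c <-> As t c \/ flit c /\ Xs t (rg t rR) c].
Proof.
move=> g; split; [exact: codes_frame | by rewrite run_arr | ].
have [em c1 c2 c3 c4] := g.
pose I i t' := forall c, As t' c <-> As t c \/ (exists2 j, j < i & flit_of j c) /\ Xs t (rg t rR) c.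
have : I (rg t rM) (run commit t).
  apply: for_inv; first by move=> c; split; [left | case=> // -[[]]].
  move=> i t' im IH hr ha c.
  rewrite 3!run_seq; set u0 := hset t' rI i.
  have [u1 v1 w1] := commit1_ok aLA u0; move: u1 v1 w1; set t1 := run _ u0 => u1 v1 w1.
  have [u2 v2 w2] := commit1_ok aNA t1; move: u2 v2 w2; set t2 := run _ t1 => u2 v2 w2.
  have [u3 v3 w3] := commit1_ok aLB t2; move: u3 v3 w3; set t3 := run _ t2 => u3 v3 w3.
  have [u4 v4 w4] := commit1_ok aNB t3; move: u4 v4 w4; set t4 := run _ t3 => u4 v4 w4.
  have xs u d : rg u = rg u0 -> ar u aX = ar u0 aX -> Xs u (rg u rR) d = Xs t (rg t rR) d.
    by move=> e1 e2; rewrite /Xs e1 e2 /= ha // updE /= hr.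
  have x1 : ar t1 aX = ar u0 aX by rewrite w1.
  have x2 : ar t2 aX = ar u0 aX by rewrite w2.
  have x3 : ar t3 aX = ar u0 aX by rewrite w3.
  rewrite v1 in v2; rewrite v2 in v3.
  have e0 : rg u0 rI = i by [].
  rewrite u4 u3 u2 u1 !xs // v3 v2 v1 e0.
  have a0 a : a \notin [:: aA] -> ar u0 a = ar t a.
    by move=> h; rewrite /= ha //; move: h; rewrite /= !inE => /negPf ->.
  rewrite !(w3, w2, w1) // !a0 // c1 c2 c3 c4 -!orbA -!andb_orl.
  have -> : As u0 c = As t' c by [].
  have -> : [|| c == la i, c == na i, c == lb i | c == nb i] = flit_of i c by rewrite /flit_of !inE.
  split.
  - case/orP=> [/IH [|[[j ji jc] x]]|/andP[ic x]]; first by left.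
      by right; split=> //; exists j => //; apply: ltnW.
    by right; split=> //; exists i.
  - case=> [h|[[j]]]; first by apply/orP; left; apply/IH; left.
    rewrite ltnS leq_eqVlt => /orP[/eqP ->|ji] jc x; first by rewrite jc x orbT.
    by apply/orP; left; apply/IH; right; split=> //; exists j.
by rewrite em.
Qed.

Lemma clear1_ok (a : nat) (u : hstate) :
  a != aX ->
  let u' := run (clear1 a) u in
  [/\ forall r c, r < 2 -> Xs u' r c = (c != (ar u a (rg u rI))) && Xs u r c,
      rg u' = rg u & forall b, b != aX -> ar u' b = ar u b].
Proof.
move=> ax; rewrite /clear1 !runE; split=> //=; last by move=> b /negPf ->.
move=> r c r2; rewrite /Xs /= (negPf ax) !updE; set y := ar u a _.
case: (c =P y) => [->|cy] /=.
  have : (y + y + r == y + y + 1) || (y + y + r == y + y) by lia.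
  by case: (_ == y + y + 1) => //=; case: (_ == y + y).
have -> : (c + c + r == y + y + 1) = false by lia.
by have -> : (c + c + r == y + y) = false by lia.
Qed.

Lemma clear_runs_ok (t : hstate) :
  codes t -> forall r c, r < 2 -> flit c -> Xs (run clear_runs t) r c = false.
Proof.
move=> g r c r2; have [em c1 c2 c3 c4] := g.
pose I i t' := forall j, j < i -> flit_of j c -> Xs t' r c = false.
have : I (rg t rM) (run clear_runs t).
  apply: for_inv => // i t' im IH hr ha j ji jc.
  rewrite 3!run_seq; set u0 := hset t' rI i.
  have [u1 v1 w1] := clear1_ok u0 (isT : aLA != aX); move: u1 v1 w1; set t1 := run _ u0 => u1 v1 w1.
  have [u2 v2 w2] := clear1_ok t1 (isT : aNA != aX); move: u2 v2 w2; set t2 := run _ t1 => u2 v2 w2.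
  have [u3 v3 w3] := clear1_ok t2 (isT : aLB != aX); move: u3 v3 w3; set t3 := run _ t2 => u3 v3 w3.
  have [u4 v4 w4] := clear1_ok t3 (isT : aNB != aX); move: u4 v4 w4; set t4 := run _ t3 => u4 v4 w4.
  rewrite v1 in v2; rewrite v2 in v3.
  have e0 : rg u0 rI = i by [].
  have a0 a : a \notin [:: aX] -> ar u0 a = ar t a.
    by move=> h; rewrite /= ha //; move: h; rewrite /= !inE => /negPf ->.
  rewrite u4 // u3 // u2 // u1 // v3 v2 v1 e0 !(w3, w2, w1) // !a0 // c1 c2 c3 c4.
  move: ji; rewrite ltnS leq_eqVlt => /orP[/eqP e|ji].
    move: jc; rewrite e /flit_of !inE.
    by case: (c == la i); case: (c == na i); case: (c == lb i); case: (c == nb i); rewrite ?andbF.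
  by have -> : Xs u0 r c = false; [exact: IH ji jc | rewrite !andbF].
by rewrite em => h [i im ic]; apply: h im ic.
Qed.

Lemma free1_run (a b : nat) (u : hstate) :
  run (free1 a b) u =
  if As u (ar u a (rg u rI)) || As u (ar u b (rg u rI)) then u
  else hset (hset (hset u rPick 1) rP (ar u a (rg u rI))) rOut (ar u b (rg u rI)).
Proof.
by rewrite /free1 !runE /= addn_eq0 negb_and.
Qed.

Definition free (t : hstate) (q : nat) : Prop := [/\ flit q, ~~ As t q & ~~ As t (nc q)].

Lemma find_free_ok (t : hstate) :
  codes t ->
  let t' := run find_free t in
  if rg t' rPick == 0 then forall c, flit c -> As t c || As t (nc c)
  else free t (rg t' rP) /\ rg t' rOut = nc (rg t' rP).
Proof.
move=> g; rewrite /find_free run_seq run_set; set t0 := hset _ _ _.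
have g0 : codes t0 by case: g.
have [em c1 c2 c3 c4] := g0.
pose I i t' := if rg t' rPick == 0 then forall j, j < i -> (As t (la j) || As t (na j)) && (As t (lb j) || As t (nb j))
  else free t (rg t' rP) /\ rg t' rOut = nc (rg t' rP).
have : I (rg t0 rM) (run (HFor rI rM (free1 aLA aNA ;; free1 aLB aNB)) t0).
  apply: for_inv => // i t' im IH hr ha; rewrite em in im.
  have at' a : ar t' a = ar t a by rewrite ha.
  have At' c : As t' c = As t c by rewrite /As at'.
  pose u := if As t (la i) || As t (na i) then hset t' rI i
    else hset (hset (hset (hset t' rI i) rPick 1) rP (la i)) rOut (na i).
  rewrite run_seq; have -> : run (free1 aLA aNA) (hset t' rI i) = u.
    by rewrite free1_run /As /= ?updE /= !at' [ar t 2]c1 [ar t 3]c2.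
  have eu : ar u = ar t' by rewrite /u; case: ifP.
  have iu : rg u rI = i by rewrite /u; case: ifP => _ /=; rewrite ?updE.
  have Au c : As u c = As t c by rewrite /As eu at'.
  rewrite free1_run iu eu !Au !at' [ar t 4]c3 [ar t 5]c4.
  case: ifPn => hb; last first.
    rewrite /I /= ?updE /=; split; last by rewrite nb_lb.
    by move: hb; rewrite negb_or nb_lb // => /andP[b1 b2]; split=> //; apply: flit_lb.
  rewrite /u; case: ifPn => ha'; last first.
    rewrite /I /= ?updE /=; split; last by rewrite na_la.
    by move: ha'; rewrite negb_or na_la // => /andP[b1 b2]; split=> //; apply: flit_la.
  move: IH; rewrite /I /= ?updE /=; case: ifP => // _ IH j.
  by rewrite ltnS leq_eqVlt => /orP[/eqP ->|/IH //]; rewrite ha' hb.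
rewrite em /I; case: ifP => // _ h c [i im]; have /andP[h1 h2] := h i im.
move: h1 h2; rewrite /flit_of !inE na_la // nb_lb // => h1 h2.
by case/or4P=> /eqP ->; rewrite ?ncK // orbC.
Qed.

Lemma pick_ok (t : hstate) :
  codes t ->
  let t' := run pick t in
  [/\ codes t', ar t' aA = ar t aA
    & if rg t' rPick == 0
      then (forall c, flit c -> As t c || As t (nc c)) /\
           (forall r c, r < 2 -> flit c -> Xs t' r c = false)
      else exists2 q, free t q &
           forall c, flit c -> Xs t' 0 c = (c == q) /\ Xs t' 1 c = (c == nc q)].
Proof.
move=> g; split; [exact: codes_frame | by rewrite run_arr | ].
rewrite /pick 2!run_seq; set t1 := run clear_runs t.
have g1 : codes t1 by apply: codes_frame.
have hc := clear_runs_ok g; rewrite -/t1 in hc.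
have A1 c : As t1 c = As t c by rewrite /As run_arr.
have := find_free_ok g1; set t2 := run find_free t1 => /=.
have X2 r c : Xs t2 r c = Xs t1 r c by rewrite /Xs run_arr.
rewrite run_if; have -> : ev (Reg rPick) t2 = rg t2 rPick by [].
case: (boolP (rg t2 rPick == 0)) => p0 /=.
  rewrite run_skip p0 => h; split=> [c fc|r c r2 fc]; first by rewrite -!A1; apply: h.
  by rewrite X2; apply: hc.
case=> -[fq a1 a2] eo; rewrite !runE /=.
rewrite (negPf p0); exists (rg t2 rP); first by split; rewrite -?A1.
move=> c fc; rewrite /Xs /= eo !updE; set q := rg t2 rP.
have := X2 0 c; have := X2 1 c; rewrite !hc // /Xs => /negbT x1 /negbT x0.
rewrite negbK in x1; rewrite negbK in x0; rewrite (eqP x1) (eqP x0).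
have -> : (c + c + 0 == nc q + nc q + 1) = false by lia.
have -> : (c + c + 1 == nc q + nc q + 1) = (c == nc q) by lia.
have -> : (c + c + 1 == q + q) = false by lia.
have -> : (c + c + 0 == q + q) = (c == q) by lia.
by split; [case: (c == q) | case: (c == nc q)].
Qed.

Definition assigned (t : hstate) : Prop := forall c, flit c -> As t c || As t (nc c).

(** In [si_time], [tau] counts rounds and [p] bounds from below the size of every consistent run; it
    grows in each round without a commit, and a commit pays for these rounds with the variables it
    assigns. Equal speed makes this work: the committed run is at least as large as the number of
    rounds spent on the abandoned one. In [si_L], both runs start from [L], so the first commit
    contains it. *)
Record sat_inv (tau : nat) (t : hstate) : Prop := SatInv {
  si_codes : codes t;
  si_closed : closedA t;
  si_cons : consistent (As t);
  si_fresh : forall r, r < 2 -> fresh t r;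
  si_good : good t 0 \/ good t 1;
  si_L : (forall c, Lc c -> flit c -> As t c) \/
         (forall r c, r < 2 -> Lc c -> flit c -> Xs t r c);
  si_time : assigned t \/ exists2 p, tau <= 2 * nvars (As t) + p &
     forall r, r < 2 -> consistent (Xs t r) -> p <= nvars (Xs t r) }.

Lemma flit_cases (S : nat -> bool) (v : nat) :
  S v.*2 || S v.*2.+1 -> exists2 c, S c & c./2 = v.
Proof. by case/orP=> h; [exists v.*2|exists v.*2.+1] => //; lia. Qed.

Lemma half_in (S : nat -> bool) (c : nat) : S c -> S (c./2).*2 || S (c./2).*2.+1.
Proof.
rewrite -{1}(odd_double_half c) => h; case: (odd c) h => h; last by rewrite h.
by rewrite -add1n h orbT.
Qed.


Lemma nc_double (v : nat) : nc v.*2 = v.*2.+1.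
Proof. by rewrite /nc odd_double. Qed.

Lemma V_flits (c : nat) : c./2 \in V -> flit c.
Proof.
move=> /V_flit h; have /half_eq [->//|->] : c./2 = (c./2).*2./2 by rewrite doubleK.
exact: flit_nc.
Qed.

Lemma disjoint_vars (t : hstate) (r v : nat) :
  fresh t r -> v \in V -> As t v.*2 || As t v.*2.+1 -> Xs t r v.*2 || Xs t r v.*2.+1 -> False.
Proof.
move=> hF vV /flit_cases [c Ac cv] /(flit_cases (S := Xs t r)) [d Xd dv].
have fd : flit d by apply: V_flits; rewrite dv.
have [n1 n2] := hF d fd Xd.
have /half_eq [e|e] : c./2 = d./2 by rewrite cv dv.
  by rewrite e (negPf n1) in Ac.
by rewrite e (negPf n2) in Ac.
Qed.

Lemma finish_ok (tau : nat) (t : hstate) :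
  codes t -> closedA t -> consistent (As t) -> fresh t (rg t rR) ->
  (forall i, i < m -> (Xs t (rg t rR) (na i) -> Xs t (rg t rR) (lb i) || As t (lb i)) /\
                      (Xs t (rg t rR) (nb i) -> Xs t (rg t rR) (la i) || As t (la i))) ->
  consistent (Xs t (rg t rR)) ->
  ((forall c, Lc c -> flit c -> As t c) \/
   (forall c, Lc c -> flit c -> Xs t (rg t rR) c)) ->
  (assigned t \/ exists2 p, tau <= 2 * nvars (As t) + p & p <= nvars (Xs t (rg t rR))) ->
  sat_inv tau.+1 (run (commit ;; pick) t).
Proof.
set r := rg t rR => g cA kA hF cX kX hL hT.
have [g1 _ A1] := commit_ok g; rewrite run_seq; set t1 := run commit t in g1 A1 *.
have [g2 A2 hp] := pick_ok g1; set t2 := run pick t1 in g2 A2 hp *.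
have E c : As t2 c = As t1 c by rewrite /As A2.
have mono c : As t c -> As t1 c by move=> h; apply/A1; left.
split=> //.
- move=> i im; rewrite !E; have [a1 a2] := cA i im; have [x1 x2] := cX i im.
  split=> /A1 [h|[_ h]]; apply/A1.
  + by left; apply: a1.
  + by case/orP: (x1 h); [right; split=> //; apply: flit_lb | left].
  + by left; apply: a2.
  + by case/orP: (x2 h); [right; split=> //; apply: flit_la | left].
- move=> c fc; rewrite !E => /A1 h; apply/negP=> /A1; case: h => [h|[_ h]] [h'|[f' h']].
  + by have := kA c fc h; rewrite h'.
  + by have [_] := hF _ f' h'; rewrite ncK h.
  + by have [_] := hF _ fc h; rewrite h'.
  + by have := kX c fc h; rewrite h'.
- move=> r' r2 c fc; move: hp; case: ifP => _.
    by case=> _ h; rewrite h.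
  case=> q [fq n1 n2] h; have [h0 h1] := h c fc; rewrite !E.
  by case: r' r2 => [|[|//]] _; rewrite ?h0 ?h1 => /eqP ->; rewrite ?ncK.
- move: hp; case: ifP => _; first by case=> _ h; left=> c fc; rewrite h.
  case=> q [fq _ _] h; case/orP: (P_tot fq) => Pq; [left|right] => c fc.
    by have [-> _] := h c fc; move/eqP ->.
  by have [_ ->] := h c fc; move/eqP ->.
- left=> c lc fc; rewrite E; apply/A1.
  by case: hL => h; [left; apply: h | right; split=> //; apply: h].
- move: hp; case: ifP => _.
    by case=> h _; left=> c fc; rewrite !E; apply: h.
  case=> q [fq n1 n2] h; case: hT => [h'|[p p1 p2]].
    by case/orP: (h' q fq) => /mono; rewrite ?(negPf n1) ?(negPf n2).
  (* Each of the two new runs already contains the picked variable, which pays for the round just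
     spent. *)
  right; exists 1; last first.
    move=> r' r2 _; rewrite -has_count; apply/hasP; exists q./2; first exact: flit_V.
    case: r' r2 => [|[|//]] _; first by apply: (half_in (S := Xs t2 0)); have [-> _] := h q fq.
    by rewrite -half_nc; apply: (half_in (S := Xs t2 1)); have [_ ->] := h (nc q) (flit_nc fq).
  have : nvars (As t) + nvars (Xs t r) <= nvars (As t2).
    apply: count_disjoint => v vV; first exact: disjoint_vars.
    have f0 := V_flit vV; have f1 := flit_nc f0; rewrite nc_double in f1.
    rewrite !E => /orP[/orP[h0|h0]|/orP[h0|h0]].
    + by rewrite mono.
    + by rewrite (mono _ h0) orbT.
    + by apply/orP; left; apply/A1; right.
    + by apply/orP; right; apply/A1; right.
  by lia.
Qed.

Lemma nvars_grow (S S' : nat -> bool) :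
  (forall c, S c -> S' c) -> nvars S <= nvars S'.
Proof. by move=> h; apply: count_le => v _ /orP[/h ->|/h ->]; rewrite ?orbT. Qed.

(** Consistency of the larger set keeps the negation of the new literal out of the smaller one, so a
    new literal is also a new variable. *)
Lemma nvars_new (S S' : nat -> bool) (c : nat) :
  (forall c, S c -> S' c) -> consistent S' -> flit c -> S' c -> ~~ S c -> nvars S < nvars S'.
Proof.
move=> h kS fc Sc nS; apply: (count_lt (x := c./2)).
- by move=> v _ /orP[/h ->|/h ->]; rewrite ?orbT.
- exact: flit_V.
- exact: half_in.
- apply/negP=> /flit_cases [d Sd /half_eq [e|e]]; first by rewrite -e Sd in nS.
  by have := kS c fc Sc; rewrite -e h.
Qed.

Lemma sat_step_ok (tau : nat) (t : hstate) : sat_inv tau t -> sat_inv tau.+1 (run sat_step t).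
Proof.
case=> g cA kA hF hG hL hT; rewrite /sat_step 2!run_seq run_set.
set t0 := hset t rR _.
have g0 : codes t0 by case: g.
have [[g1 A1 r1 f1] x1 y1 z1 [w1 b1]] := advance_ok g0 (isT : rg t0 rR < 2) cA (hF 0 isT).
rewrite [rg t0 rR]/= in r1 f1 x1 y1 z1 w1 b1.
set t1 := run advance t0 in g1 A1 r1 f1 x1 y1 z1 w1 b1 *.
have {}x1 c : Xs t 0 c -> Xs t1 0 c := x1 c.
have sub (S S' : nat -> bool) : (forall c, S c -> S' c) -> consistent S' -> consistent S.
  by move=> h k c fc Sc; apply/negP=> /h Sn; have := k c fc (h c Sc); rewrite Sn.
have A1' c : As t1 c = As t c by exact: A1.
have nA1 : nvars (As t1) = nvars (As t) by apply: eq_count => v; rewrite !A1'.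
have as1 : assigned t -> assigned t1 by move=> h c fc; rewrite !A1'; apply: h.
have cA1 : closedA t1 by move=> i im; rewrite !A1'; apply: cA.
have kA1 : consistent (As t1) by move=> c fc; rewrite !A1'; apply: kA.
rewrite run_if; have -> : ev (Plus (Reg rCX) (Reg rBX)) t1 = rg t1 rCX + rg t1 rBX by [].
case: ifPn => fl1; last first.
  rewrite negbK addn_eq0 in fl1; case/andP: fl1 => fl1 fl1'.
  rewrite fl1 in w1; have k1 : consistent (Xs t1 0) by apply/b1.
  apply: finish_ok; rewrite ?r1 //.
    case: hL => h; [left|right] => c lc fc; first by rewrite A1'; apply: h.
    by apply: x1; apply: h.
  case: hT => [h|[p p1 p2]]; [left; exact: as1 | right; exists p; rewrite ?nA1 //].
  by apply: leq_trans (p2 0 isT (sub _ _ x1 k1)) _; apply: nvars_grow.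
rewrite 2!run_seq run_set; set t2 := hset t1 rR _.
have g2 : codes t2 by case: g1.
have X1 c : Xs t1 1 c = Xs t 1 c by exact: y1.
have F1 : fresh t1 1 by move=> c fc; rewrite X1 !A1'; apply: hF.
have [[g3 A3 r3 f3] x3 y3 z3 [w3 b3]] := advance_ok g2 (isT : rg t2 rR < 2) cA1 F1.
rewrite [rg t2 rR]/= in r3 f3 x3 y3 z3 w3 b3.
set t3 := run advance t2 in g3 A3 r3 f3 x3 y3 z3 w3 b3 *.
have {}x3 c : Xs t 1 c -> Xs t3 1 c by rewrite -X1; exact: x3.
have A3' c : As t3 c = As t c by rewrite -A1'; exact: A3.
have nA3 : nvars (As t3) = nvars (As t) by apply: eq_count => v; rewrite !A3'.
have as3 : assigned t -> assigned t3 by move=> h c fc; rewrite !A3'; apply: h.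
have cA3 : closedA t3 by move=> i im; rewrite !A3'; apply: cA.
have kA3 : consistent (As t3) by move=> c fc; rewrite !A3'; apply: kA.
rewrite run_if; have -> : ev (Plus (Reg rCX) (Reg rBX)) t3 = rg t3 rCX + rg t3 rBX by [].
case: ifPn => fl3; last first.
  rewrite negbK addn_eq0 in fl3; case/andP: fl3 => fl3 fl3'.
  rewrite fl3 in w3; have k3 : consistent (Xs t3 1) by apply/b3.
  apply: finish_ok; rewrite ?r3 //.
    case: hL => h; [left|right] => c lc fc; first by rewrite A3'; apply: h.
    by apply: x3; apply: h.
  case: hT => [h|[p p1 p2]]; [left; exact: as3 | right; exists p; rewrite ?nA3 //].
  by apply: leq_trans (p2 1 isT (sub _ _ x3 k3)) _; apply: nvars_grow.
have X0 c : Xs t3 0 c = Xs t1 0 c by exact: y3.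
rewrite run_skip; split=> //.
- case=> [|[|//]] _ //; move=> c fc; rewrite X0 !A3' -!A1'; exact: f1.
- case: hG => h; [left|right].
    by move=> c fc; rewrite X0; apply: z1.
  by apply: z3 => c fc; rewrite [Xs t2 1 c]X1; apply: h.
- case: hL => h; [left|right].
    by move=> c lc fc; rewrite A3'; apply: h.
  by case=> [|[|//]] c _ lc fc; [rewrite X0; apply: x1 | apply: x3]; apply: h.
(* Neither run was committed, so one that is consistent must have changed in its pass and has gained
   a variable. *)
- case: hT => [h|[p p1 p2]]; [left; exact: as3 | right; exists p.+1; rewrite ?nA3; first by lia].
  case=> [|[|//]] _ kk.
    have k1 : consistent (Xs t1 0) by move=> c fc; rewrite -!X0; apply: kk.
    have c1 : rg t1 rBX == 0 by apply/b1.
    move: w1 fl1; rewrite (eqP c1) addn0 => w1 /negPf fl1; rewrite fl1 in w1.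
    case: w1 => c fc /andP[c2 c3].
    have := p2 0 isT (sub _ _ x1 k1); have := nvars_new x1 k1 fc c2 c3.
    have -> : nvars (Xs t3 0) = nvars (Xs t1 0) by apply: eq_count => v; rewrite !X0.
    by lia.
  have c1 : rg t3 rBX == 0 by apply/b3.
  move: w3 fl3; rewrite (eqP c1) addn0 => w3 /negPf fl3; rewrite fl3 in w3.
  case: w3 => c fc /andP[c2 c3]; rewrite [Xs t2 1 c]X1 in c3.
  have := p2 1 isT (sub _ _ x3 kk); have := nvars_new x3 kk fc c2 c3; lia.
Qed.

(** The run that is true under [P] is consistent, hence has at least [p] variables, and these are
    disjoint from the assigned ones. Together they fit into [V], which bounds the number of
    rounds. *)
Lemma sat_inv_assigned (tau : nat) (t : hstate) :
  sat_inv tau t -> 2 * size V < tau -> assigned t.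
Proof.
case=> g cA kA hF hG hL [//|[p p1 p2]] lt.
have [r r2 gr] : exists2 r, r < 2 & good t r by case: hG; [exists 0|exists 1].
have kX : consistent (Xs t r).
  by move=> c fc Xc; apply/negP=> /(gr _ (flit_nc fc)); rewrite (negPf (P_cons fc (gr _ fc Xc))).
have : nvars (As t) + nvars (Xs t r) <= count predT V.
  by apply: count_disjoint => // v vV; apply: disjoint_vars => //; apply: hF.
by rewrite count_predT; have := p2 r r2 kX; lia.
Qed.

Definition solve_sat : hl := HFor rJ rN2 sat_step.

Lemma solve_sat_ok (t : hstate) :
  sat_inv 0 t -> 2 * size V < rg t rN2 ->
  let t' := run solve_sat t in
  [/\ forall c, flit c -> As t' (nc c) = ~~ As t' c,
      forall i, i < m -> As t' (la i) || As t' (lb i)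
    & forall c, Lc c -> flit c -> As t' c].
Proof.
move=> hs lt; have : sat_inv (rg t rN2) (run solve_sat t).
  apply: for_inv => // i u _ [g h2 h3 h4 h5 h6 h7] _ _; apply: sat_step_ok.
  by split=> //; case: g.
move=> si; have as' := sat_inv_assigned si lt; case: si => g cA kA hF hG hL _.
move: (run solve_sat t) as' g cA kA hF hL {hG} => u as' g cA kA hF hL.
have tot c : flit c -> As u (nc c) = ~~ As u c.
  move=> fc; case: (boolP (As u c)) => h /=; first exact: negPf (kA c fc h).
  by have := as' c fc; rewrite (negPf h).
split=> //.
- move=> i im; case: (boolP (As u (la i))) => //= h.
  have [h1 _] := cA i im; apply: h1; rewrite na_la // tot //; exact: flit_la.
- move=> c lc fc; case: hL => h; first exact: h.
  have [n1 n2] := hF 0 isT c fc (h 0 c isT lc fc).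
  by have := as' c fc; rewrite (negPf n1) (negPf n2).
Qed.

End Sat.

Local Close Scope hl_scope.
Local Open Scope fset_scope.

(** * Culprit sets as cuts *)

Definition code (a : literal) : nat := a.1 + a.1 + a.2.
Definition lit (c : nat) : literal := (c./2, odd c).

Lemma codeK (a : literal) : lit (code a) = a.
Proof. by case: a => x b; rewrite /lit /code /=; congr (_, _); case: b; lia. Qed.

Lemma litK (c : nat) : code (lit c) = c.
Proof. by rewrite /code /lit /= addnn addnC odd_double_half. Qed.

Lemma code_neg (a : literal) : code (neg a) = nc (code a).
Proof. by case: a => x [] /=; rewrite /code /nc /neg /=; case: ifP; lia. Qed.

Lemma lit_nc (c : nat) : lit (nc c) = neg (lit c).
Proof. by rewrite -{1}(litK c) -code_neg codeK. Qed.

Lemma half_code (a : literal) : (code a)./2 = var a.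
Proof. by rewrite -[in RHS](codeK a). Qed.

Lemma negK (a : literal) : neg (neg a) = a.
Proof. by case: a => x b; rewrite /neg /= negbK. Qed.

Lemma var_eq (a b : literal) : var a = var b -> a = b \/ a = neg b.
Proof.
case: a b => x b [y c]; rewrite /var /neg /= => ->.
by case: b; case: c; [left|right|right|left].
Qed.

Lemma mem_mkclause (a : literal) (p : literal * literal) :
  (a \in mkclause p) = (a == p.1) || (a == p.2).
Proof. by rewrite /mkclause !inE. Qed.

Lemma fvarsP (G : formula) (x : nat) :
  reflect (exists c a, [/\ c \in G, a \in c & x = var a]) (x \in fvars G).
Proof.
apply: (iffP idP) => [/bigfcupP [c]|[c [a [cG ac ->]]]].
  rewrite andbT => cG /imfsetP [a ac ->]; by exists c, a.
by apply/bigfcupP; exists c; [rewrite andbT | apply/imfsetP; exists a].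
Qed.

Lemma sum_size_filter (n : nat) (p : pred nat) :
  \sum_(i < n) p i = size [seq i <- iota 0 n | p i].
Proof.
rewrite -(big_mkord xpredT (fun i => nat_of_bool (p i))) /index_iota subn0.
by rewrite size_filter -sum1_count [RHS]big_mkcond; apply: eq_bigr => i _; case: (p i).
Qed.

Section Semantics.

Variables (cs : seq (literal * literal)) (F : formula) (L : {fset literal}) (l : literal).
Hypothesis csF : lists_clauses cs F.
Hypothesis lL : var l \notin vars L.

Definition cl (i : nat) : literal * literal := nth ((0, false), (0, false)) cs i.

Lemma memF (c : clause) : reflect (exists2 i, i < size cs & c = mkclause (cl i)) (c \in F).
Proof.
case: csF => _ <-; apply: (iffP mapP) => [[p ps ->]|[i im ->]].
  by exists (index p cs); rewrite ?index_mem // /cl nth_index.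
by exists (cl i) => //; apply: mem_nth.
Qed.

Lemma cl_inj (i j : nat) : i < size cs -> j < size cs -> mkclause (cl i) = mkclause (cl j) -> i = j.
Proof.
move=> im jm e; case: csF => u _; apply/eqP.
rewrite -(nth_uniq fset0 _ _ u) ?size_map //.
by rewrite !(nth_map ((0, false), (0, false))) //; apply/eqP.
Qed.

Lemma fvarsF (x : nat) :
  reflect (exists2 i, i < size cs & x = var (cl i).1 \/ x = var (cl i).2) (x \in fvars F).
Proof.
apply: (iffP (fvarsP _ _)) => [[c [a [/memF [i im ->]]]]|[i im h]].
  by rewrite mem_mkclause => /orP[] /eqP -> ->; exists i => //; [left|right].
case: h => ->; [exists (mkclause (cl i)), (cl i).1 | exists (mkclause (cl i)), (cl i).2];
  by split; rewrite ?mem_mkclause ?eqxx ?orbT //; apply/memF; exists i.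
Qed.

Variables (A : nat -> bool) (kd tl hd : nat -> nat).
Hypothesis A_neg : forall a, var a \in fvars F -> A (code (neg a)) = ~~ A (code a).
Hypothesis A_sat : forall i, i < size cs -> A (code (cl i).1) || A (code (cl i).2).
Hypothesis A_L : forall a, a \in L -> var a \in fvars F -> A (code a).
Hypothesis kind : forall i, i < size cs ->
  if A (code (cl i).1) && A (code (cl i).2)
  then [/\ kd i = 1, tl i = var (cl i).1 & hd i = var (cl i).2]
  else if A (code (cl i).1) then [/\ kd i = 0, tl i = var (cl i).2 & hd i = var (cl i).1]
  else [/\ kd i = 0, tl i = var (cl i).1 & hd i = var (cl i).2].

Lemma violatedE (dl : nat -> nat) (Z : nat -> bool) (i : nat) : i < size cs -> dl i = 0 ->
  violated kd tl hd dl Z i =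
  ~~ ((A (code (cl i).1) (+) Z (var (cl i).1)) || (A (code (cl i).2) (+) Z (var (cl i).2))).
Proof.
move=> im d0; have := A_sat im; have := kind im; rewrite /violated /enters d0 eqxx /=.
case: (A _); case: (A _) => //= -[-> -> ->] /=; case: (Z _); case: (Z _) => //.
Qed.

(* Z is the set of variables whose value differs from A. *)
Lemma culprit_of_cut (dl : nat -> nat) (Z : nat -> bool) (S : {fset clause}) :
  (var l \in fvars F -> A (code l) (+) Z (var l)) ->
  (forall x, x \in vars L -> ~~ Z x) ->
  (forall i, i < size cs -> dl i = 0 -> violated kd tl hd dl Z i = false) ->
  (forall c, c \in S <-> exists i, [/\ i < size cs, dl i != 0 & c = mkclause (cl i)]) ->
  culprit_set F L l S.
Proof.
move=> hl hL hv hS; split.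
  by apply/fsubsetP=> c /hS [i [im _ ->]]; apply/memF; exists i.
pose v x := A (code (x, true)) (+) Z x.
have vE a : var a \in fvars F -> (v (var a) == a.2) = A (code a) (+) Z (var a).
  case: a => x [] /=; rewrite /v /var /= => xF; first by rewrite eqb_id.
  by have := A_neg (a := (x, true)) xF; rewrite /neg /= => ->; case: (A _); case: (Z x).
(* Deleting clauses may remove variables, and a satisfying assignment must have exactly the
   variables of the formula that remains. *)
exists [fset (x, v x) | x in fvars (F `\` S)].
  split.
  - move=> a /imfsetP [x xF ->]; apply/negP=> /imfsetP [y yF]; rewrite /neg /= => -[-> e].
    by move: e; case: (v y).
  - apply/fsetP=> x; apply/imfsetP/idP => [[a /imfsetP [y yF -> ->]] //|xF].
    by exists (x, v x) => //; apply/imfsetP; exists x.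
  - move=> c; rewrite inE => /andP[cS cF]; case/memF: (cF) => i im ec.
    have d0 : dl i = 0.
      by case: (dl i =P 0) => // /eqP di; case/negP: cS; apply/hS; exists i.
    have memc a : a \in c -> var a \in fvars (F `\` S).
      by move=> ac; apply/fvarsP; exists c, a; split=> //; rewrite inE cS.
    have memF' a : a \in c -> var a \in fvars F.
      by move=> ac; apply/fvarsP; exists c, a.
    have in1 : (cl i).1 \in c by rewrite ec mem_mkclause eqxx.
    have in2 : (cl i).2 \in c by rewrite ec mem_mkclause eqxx orbT.
    have pick a : a \in c -> A (code a) (+) Z (var a) ->
        exists2 a : literal, a \in c & a \in [fset (x, v x) | x in fvars (F `\` S)].
      move=> ac; rewrite -vE ?memF' // => /eqP va; exists a => //.
      by apply/imfsetP; exists (var a); [exact: memc | rewrite va; case: a {ac va}].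
    have := hv i im d0; rewrite violatedE // => /negbFE /orP[h|h].
      exact: pick h.
    exact: pick h.
apply/fsetP=> a; rewrite !inE; apply/negP=> /andP[/imfsetP [x xF ea] /imfsetP [b]].
have xF' : x \in fvars F.
  case/fvarsP: xF => c [d [cF dc ->]]; apply/fvarsP; exists c, d; split=> //.
  by move: cF; rewrite inE => /andP[].
have vb : x = var b -> v x = ~~ b.2 -> A (code b) (+) Z (var b) = false.
  by move=> xb e; rewrite -vE -?xb // e; case: (b.2).
rewrite /= => bL; rewrite ea /neg => -[xb eb]; have nb := vb xb eb.
move: bL; rewrite !inE => /orP[bL|/eqP bl].
  have Ab : A (code b) by apply: A_L; rewrite // -[var b]xb.
  have Zb : ~~ Z (var b) by apply: hL; apply/imfsetP; exists b.
  by move: nb; rewrite Ab (negPf Zb).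
by move: nb; rewrite bl hl // -bl -[var b]xb.
Qed.

(** The cut consists of the variables on which the new assignment contradicts [A], together with
    [var l], which must belong to it even when it no longer occurs. Variables of [L] stay out since
    both assignments respect [L], and a clause broken by the cut is false under the new assignment,
    hence lies in [S]. *)
Lemma cut_of_culprit (S : {fset clause}) (T dl : nat -> nat) :
  A (code l) = false -> (forall i, dl i = 0) -> (forall x, T x != 0 -> x \in vars L) ->
  culprit_set F L l S -> feasible (size cs) kd tl hd (var l) dl T #|` S|.
Proof.
move=> Al d0 hT [SF [P' [ncP vP sP] dP]].
pose Z x := (x == var l) || ((x, true) \in P') && ~~ A (code (x, true)) ||
   ((x, false) \in P') && ~~ A (code (x, false)).
have subF x : x \in fvars (F `\` S) -> x \in fvars F.
  case/fvarsP=> c [d [cF dc ->]]; apply/fvarsP; exists c, d; split=> //.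
  by move: cF; rewrite inE => /andP[].
have nL a : a \in L -> neg a \notin P'.
  move=> aL; apply/negP=> h; have : neg a \in P' `&` negs (L `|` [fset l]).
    by rewrite in_fsetI h; apply/imfsetP; exists a => //; rewrite !inE aL.
  by rewrite dP inE.
have nl : neg l \notin P'.
  apply/negP=> h; have : neg l \in P' `&` negs (L `|` [fset l]).
    by rewrite in_fsetI h; apply/imfsetP; exists l => //; rewrite !inE eqxx orbT.
  by rewrite dP inE.
have inP a : a \in P' -> var a \in fvars F.
  by move=> aP; apply: subF; rewrite -vP; apply/imfsetP; exists a.
exists Z.
  split; first by rewrite /Z eqxx.
  move=> x /hT xL; have /negPf xl : x != var l by apply: contra lL => /eqP <-.
  case/imfsetP: xL => a /= aL xa.
  have key b : b \in P' -> var b = x -> A (code b).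
    move=> bP bx; have /var_eq [e|e] : var b = var a by rewrite bx xa.
      by rewrite e; apply: A_L => //; rewrite -e; apply: inP.
    by have := nL a aL; rewrite -e bP.
  rewrite /Z xl /= negb_or !negb_and !negbK.
  by apply/andP; split; [case: (boolP ((x, true) \in P')) | case: (boolP ((x, false) \in P'))] => //= h;
    apply: key h _.
have inPE a : var a \in fvars (F `\` S) -> (a \in P') = A (code a) (+) Z (var a).
  move=> aF; have aF' := subF _ aF.
  have tot b : var b = var a -> (neg b \in P') = (b \notin P').
    move=> ba; have := aF; rewrite -vP => /imfsetP [d /= dP' e].
    case: (boolP (b \in P')) => hb; first by apply/negbTE/ncP.
    have /var_eq [e'|e'] : var d = var b by rewrite -e ba.
      by rewrite -e' dP' in hb.
    by rewrite -e' dP'.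
  have t1 : ((var a, false) \in P') = ((var a, true) \notin P') := tot (var a, true) erefl.
  have t2 : A (code (var a, false)) = ~~ A (code (var a, true)).
    by have := A_neg (a := (var a, true)) aF'.
  have Za : Z (var a) = ((var a, true) \in P') (+) A (code (var a, true)).
    (* At [var l] the forced membership agrees with the formula: the new assignment omits [neg l],
       so it contains [l], which is false under [A]. *)
    rewrite /Z t1 t2; case: eqP => [e|_]; last by case: (_ \in P'); case: (A _).
    move: nl Al t1 t2; case: (l) e => y b /= e; rewrite /neg /= -[y]e.
    by case: b => /=; case: (_ \in P') => //; case: (A (code (var a, true))) => //=;
      case: (_ \in P') => //; case: (A _).
  rewrite Za; have -> : a = (var a, a.2) by case: (a).
  by case: (a.2); rewrite ?t1 ?t2 /var /=; case: (_ \in P'); case: (A _).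
rewrite /nviol.
have vS i : i < size cs -> violated kd tl hd dl Z i -> mkclause (cl i) \in S.
  move=> im; rewrite violatedE //; apply: contraR => cS.
  have cF : mkclause (cl i) \in F `\` S by rewrite inE cS; apply/memF; exists i.
  have memc a : a \in mkclause (cl i) -> var a \in fvars (F `\` S).
    by move=> ac; apply/fvarsP; exists (mkclause (cl i)), a.
  have [a ac aP] := sP _ cF; move: (aP); rewrite inPE ?memc //; move: ac.
  by rewrite mem_mkclause => /orP[] /eqP -> ->; rewrite ?orbT.
pose I := [seq i <- iota 0 (size cs) | violated kd tl hd dl Z i].
rewrite sum_size_filter -/I -(size_map (fun i => mkclause (cl i))); apply: uniq_leq_size.
  rewrite map_inj_in_uniq ?filter_uniq ?iota_uniq // => i j.
  rewrite !mem_filter !mem_iota => /andP[_ /andP[_ im]] /andP[_ /andP[_ jm]]; exact: cl_inj.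
by move=> c /mapP [i]; rewrite mem_filter mem_iota => /andP[vi /andP[_ im]] ->; apply: vS.
Qed.

End Semantics.

Local Close Scope fset_scope.
Local Open Scope hl_scope.

(** * The program *)

Notation four e := (Plus (Plus e e) (Plus e e)) (only parsing).
Notation In j := (Arr aIN (Plus (Reg rP) (Cst j))) (only parsing).

Definition read_codes : hl :=
  rP ::= Plus (Cst 5) (four (Reg rI)) ;;
  HStore aLA (Reg rI) (Plus (Plus (In 0) (In 0)) (In 1)) ;;
  HStore aNA (Reg rI) (Plus (Plus (In 0) (In 0)) (Not (In 1))) ;;
  HStore aLB (Reg rI) (Plus (Plus (In 2) (In 2)) (In 3)) ;;
  HStore aNB (Reg rI) (Plus (Plus (In 2) (In 2)) (Not (In 3))).

Definition see1 (j : nat) : hl :=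
  HIf (Arr aSEEN (In j)) HSkip
    (HStore aSEEN (In j) (Cst 1) ;; rN ::= Plus (Reg rN) (Cst 1)).

Definition count_vars : hl := rP ::= Plus (Cst 5) (four (Reg rI)) ;; see1 0 ;; see1 2.

(** Each literal of [L] is put into both runs: with no opposite seeds to compare in the opening
    phase, either run may be the one that commits the closure of [L]. *)
Definition mark_literals : hl :=
  rP ::= Plus (Plus (Cst 5) (four (Reg rM))) (Plus (Reg rI) (Reg rI)) ;;
  HStore aT (In 0) (Cst 1) ;;
  rC ::= Plus (Plus (In 0) (In 0)) (In 1) ;;
  HStore aX (Plus (Reg rC) (Reg rC)) (Cst 1) ;;
  HStore aX (Plus (Plus (Reg rC) (Reg rC)) (Cst 1)) (Cst 1).

(** An arc leads from the variable of the false literal to that of the true one, since the clause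
    breaks when only the latter is flipped. A clause with two equal literals becomes an edge whose
    ends coincide, broken as soon as its variable is flipped; a tautology becomes an arc with equal
    ends, which enters no set. *)
Definition classify : hl :=
  rP ::= Plus (Cst 5) (four (Reg rI)) ;;
  HIf (And (Arr aA (At aLA)) (Arr aA (At aLB)))
    (HStore aKD (Reg rI) (Cst 1) ;; HStore aTL (Reg rI) (In 0) ;; HStore aHD (Reg rI) (In 2))
    (HStore aKD (Reg rI) (Cst 0) ;;
     HIf (Arr aA (At aLA))
       (HStore aTL (Reg rI) (In 2) ;; HStore aHD (Reg rI) (In 0))
       (HStore aTL (Reg rI) (In 0) ;; HStore aHD (Reg rI) (In 2))).

Definition emit : hl :=
  HIf (At aDEL)
    (rP ::= Plus (Cst 5) (four (Reg rI)) ;; rC ::= Plus (Cst 2) (four (Reg rN)) ;;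
     HStore aOUT (Reg rC) (In 0) ;; HStore aOUT (Plus (Reg rC) (Cst 1)) (In 1) ;;
     HStore aOUT (Plus (Reg rC) (Cst 2)) (In 2) ;; HStore aOUT (Plus (Reg rC) (Cst 3)) (In 3) ;;
     rN ::= Plus (Reg rN) (Cst 1))
    HSkip.

Definition output : hl :=
  HIf (Same (Reg rDone) (Cst 1))
    (rN ::= Cst 0 ;; HFor rI rM emit ;;
     HStore aOUT (Cst 0) (Cst 1) ;; HStore aOUT (Cst 1) (Reg rN) ;;
     rOut ::= Plus (Cst 2) (four (Reg rN)))
    (HStore aOUT (Cst 0) (Cst 0) ;; rOut ::= Cst 1).

(** The constant 20 is 4 * 5: the root of the search has weight [4 * 5^(k + 1)], and the factor
    [5^k] is multiplied in afterwards. *)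
Definition setup : hl :=
  rK ::= Arr aIN (Cst 0) ;; rM ::= Arr aIN (Cst 1) ;; rNL ::= Arr aIN (Cst 2) ;;
  rS ::= Arr aIN (Cst 3) ;; rK1 ::= Plus (Reg rK) (Cst 1) ;; rN ::= Cst 0 ;; rBIG ::= Cst 20.

Definition stage1 : hl :=
  HFor rI rM read_codes ;; HFor rI rM count_vars ;; HFor rI rNL mark_literals ;;
  HFor rI rK (rBIG ::= Plus (Reg rBIG) (four (Reg rBIG))).

(** There are at most [n + 1] vertices, as [var l] need not occur in the formula; one more makes the
    inequality of [np_bound] strict. The rounds of [solve_sat] must exceed [2 * n]. *)
Definition bounds : hl :=
  rNP ::= Plus (Reg rN) (Cst 2) ;; rN2 ::= Plus (Plus (Reg rN) (Reg rN)) (Cst 1).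

(** If the assignment already contains [l], the flag is set before the search, all micro-steps are
    idle and the empty set is output. *)
Definition stage2 : hl :=
  solve_sat ;; HFor rI rM classify ;;
  HIf (Arr aA (Plus (Plus (Arr aIN (Cst 3)) (Arr aIN (Cst 3))) (Arr aIN (Cst 4))))
    (rDone ::= Cst 1) HSkip ;;
  HFor rB rBIG step ;; output.

Lemma size_code_clauses (cs : seq (literal * literal)) : size (code_clauses cs) = 4 * size cs.
Proof. by elim: cs => // p cs IH; rewrite /code_clauses /= -/(code_clauses cs) IH; lia. Qed.

Lemma size_code_literals (ls : seq literal) : size (code_literals ls) = 2 * size ls.
Proof. by elim: ls => // p cs IH; rewrite /code_literals /= -/(code_literals cs) IH; lia. Qed.

Definition block (p : literal * literal) : seq nat := code_literal p.1 ++ code_literal p.2.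

Lemma nth_code_clauses (cs : seq (literal * literal)) (r : seq nat) (i j : nat) :
  i < size cs -> j < 4 -> nth 0 (code_clauses cs ++ r) (4 * i + j) = nth 0 (block (cl cs i)) j.
Proof.
elim: cs i => // p cs IH [|i] im j4; first by case: j j4 {IH} => [|[|[|[|]]]].
have -> : 4 * i.+1 + j = (4 * i + j).+4 by lia.
exact: IH.
Qed.

Lemma nth_code_literals (ls : seq literal) (i j : nat) :
  i < size ls -> j < 2 ->
  nth 0 (code_literals ls) (2 * i + j) = nth 0 (code_literal (nth (0, false) ls i)) j.
Proof.
elim: ls i => // p ls IH [|i] im j2; first by case: j j2 {IH} => [|[|]].
have -> : 2 * i.+1 + j = (2 * i + j).+2 by lia.
exact: IH.
Qed.

(** * The phases of the program on an encoded instance *)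

Section Program.

Variables (cs : seq (literal * literal)) (ls : seq literal) (l : literal) (k : nat).

Definition input : seq nat :=
  [:: k; size cs; size ls] ++ code_literal l ++ code_clauses cs ++ code_literals ls.

Local Notation m := (size cs).
Local Notation c := (cl cs).

Lemma input_clause (i j : nat) : i < m -> j < 4 ->
  nth 0 input (5 + (i + i + (i + i)) + j) = nth 0 (block (c i)) j.
Proof.
move=> im j4; rewrite -(nth_code_clauses (code_literals ls) im j4) /input /=.
by congr (nth _ _ _); lia.
Qed.

Lemma input_literal (i j : nat) : i < size ls -> j < 2 ->
  nth 0 input (5 + (m + m + (m + m)) + (i + i) + j) = nth 0 (code_literal (nth (0, false) ls i)) j.
Proof.
move=> im j2; rewrite -(nth_code_literals im j2) /input.
have -> : 5 + (m + m + (m + m)) + (i + i) + j = (4 * m + (2 * i + j)).+4.+1 by lia.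
rewrite /= nth_cat size_code_clauses ifF; last by lia.
by congr (nth _ _ _); lia.
Qed.

Lemma read_codes_ok (t : hstate) :
  rg t rM = m -> ar t aIN = nth 0 input ->
  let t' := run (HFor rI rM read_codes) t in
  forall i, i < m -> [/\ ar t' aLA i = code (c i).1, ar t' aNA i = code (neg (c i).1),
     ar t' aLB i = code (c i).2 & ar t' aNB i = code (neg (c i).2)].
Proof.
move=> em ein t'.
pose I n u := forall i, i < n -> [/\ ar u aLA i = code (c i).1, ar u aNA i = code (neg (c i).1),
     ar u aLB i = code (c i).2 & ar u aNB i = code (neg (c i).2)].
suff : I (rg t rM) t' by rewrite em.
apply: for_inv => // i u im IH hr ha j; rewrite em in im.
have eu : ar u aIN = nth 0 input by rewrite ha.
rewrite /read_codes !runE /= ?updE /= !eu !input_clause //= /code /neg /=.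
rewrite ltnS leq_eqVlt; case: (j =P i) => [-> _|_ /= ji]; last exact: IH.
by case: (c i) => -[x []] [y []].
Qed.

Lemma see1_ok (j : nat) (u : hstate) :
  let x := ar u aIN (rg u rP + j) in
  run (see1 j) u = if ar u aSEEN x != 0 then u
    else hset (hstore u aSEEN x 1) rN (rg u rN + 1).
Proof. by rewrite /see1 !runE. Qed.

Lemma count_vars_ok (t : hstate) :
  rg t rM = m -> ar t aIN = nth 0 input -> rg t rN = 0 -> (forall x, ar t aSEEN x = 0) ->
  let t' := run (HFor rI rM count_vars) t in
  exists V, [/\ uniq V, size V = rg t' rN &
    forall x, x \in V <-> exists2 i, i < m & x = var (c i).1 \/ x = var (c i).2].
Proof.
move=> em ein en es t'.
pose see u V := [/\ uniq V, size V = rg u rN & forall x, (ar u aSEEN x != 0) = (x \in V)].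
pose I n u := exists V, see u V /\
    forall x, x \in V <-> exists2 i, i < n & x = var (c i).1 \/ x = var (c i).2.
have add u V j : see u V -> exists V', see (run (see1 j) u) V' /\
    forall x, x \in V' <-> x \in V \/ x = ar u aIN (rg u rP + j).
  move=> [h1 h2 h3]; rewrite see1_ok; set x := ar u aIN _.
  case: ifPn => hx.
    exists V; split=> // y; split; [by left | by case=> // ->; rewrite -h3].
  exists (x :: V); split.
    split=> /=; first by rewrite -h3 hx.
      by rewrite ?updE /= h2 addn1.
    by move=> y; rewrite updE inE; case: (y =P x) => //= _; apply: h3.
  move=> y; rewrite inE; split; first by case/orP=> [/eqP ->|]; [right|left].
  by case=> [->|->]; rewrite ?eqxx ?orbT.
have [V [[h1 h2 h3] h4]] : I (rg t rM) t'.
  apply: for_inv.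
    exists [::]; split; first by split=> // x; rewrite es.
    by move=> x; split=> // -[].
  move=> i u im [V [hV hx]] hr ha; rewrite em in im.
  have eu : ar u aIN = nth 0 input by rewrite ha.
  rewrite /count_vars 2!run_seq run_set; set u0 := hset _ rP _.
  have [V1 [hV1 m1]] := add u0 V 0 hV; set u1 := run (see1 0) u0 in hV1 m1 *.
  have [V2 [hV2 m2]] := add u1 V1 2 hV1.
  have p1 : rg u1 rP = rg u0 rP by rewrite /u1 run_reg.
  have i1 : ar u1 aIN = nth 0 input by rewrite /u1 run_arr.
  have e0 : ar u0 aIN (rg u0 rP + 0) = var (c i).1.
    by rewrite [ar u0 aIN]eu; exact: (input_clause im (isT : 0 < 4)).
  have e2 : ar u1 aIN (rg u1 rP + 2) = var (c i).2.
    by rewrite i1 p1; exact: (input_clause im (isT : 2 < 4)).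
  exists V2; split=> // x; rewrite m2 m1 e0 e2.
  split.
  - case=> [[/hx [j ji h]|->]|->].
    + by exists j => //; apply: ltnW.
    + by exists i => //; left.
    + by exists i => //; right.
  - case=> j; rewrite ltnS leq_eqVlt => /orP[/eqP ->|ji] h.
      by case: h => ->; [left; right | right].
    by left; left; apply/hx; exists j.
by exists V; split=> //; rewrite em in h4.
Qed.

Lemma mark_literals_ok (t : hstate) :
  rg t rM = m -> rg t rNL = size ls -> ar t aIN = nth 0 input ->
  (forall x, ar t aT x = 0) -> (forall x, ar t aX x = 0) ->
  let t' := run (HFor rI rNL mark_literals) t in
  (forall x, ar t' aT x != 0 <-> exists2 a, a \in ls & x = var a) /\
  (forall r d, r < 2 -> Xs t' r d <-> lit d \in ls).
Proof.
move=> em enl ein eT eX t'.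
pose I n u := (forall x, ar u aT x != 0 <-> exists2 i, i < n & x = var (nth (0, false) ls i)) /\
  (forall r d, r < 2 -> Xs u r d <-> exists2 i, i < n & lit d = nth (0, false) ls i).
have [h1 h2] : I (rg t rNL) t'.
  apply: for_inv.
    by split=> [x|r d _]; rewrite /Xs ?eT ?eX; split=> // -[].
  move=> i u im [IH1 IH2] hr ha; rewrite enl in im.
  have eu : ar u aIN = nth 0 input by rewrite ha.
  have mu : rg u rM = m by rewrite hr.
  rewrite /mark_literals !runE /= ?updE /= !eu !mu !input_literal //=.
  set a := nth (0, false) ls i.
  split.
    move=> x /=; rewrite updE; case: (x =P a.1) => [->|xa].
      by split=> // _; exists i.
    rewrite IH1; split=> -[j ji e]; first by exists j => //; apply: ltnW.
    move: ji; rewrite ltnS leq_eqVlt => /orP[/eqP ej|ji]; last by exists j.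
    by case: xa; rewrite e ej.
  move=> r d r2; rewrite /Xs /= !updE -/(code a).
  have E : (d + d + r == code a + code a + 1) || (d + d + r == code a + code a) = (d == code a).
    by case: r r2 => [|[|//]] _; lia.
  have -> : ((if d + d + r == code a + code a + 1 then 1
     else if d + d + r == code a + code a then 1 else ar u 12 (d + d + r)) != 0) =
     (d == code a) || Xs u r d.
    by rewrite -E /Xs; case: (_ == code a + code a + 1); case: (_ == code a + code a).
  split.
    case/orP=> [/eqP ->|/IH2 [//|j ji e]]; first by exists i => //; rewrite codeK.
    by exists j => //; apply: ltnW.
  case=> j; rewrite ltnS leq_eqVlt => /orP[/eqP ->|ji] e.
    by rewrite -(litK d) e eqxx.
  by apply/orP; right; apply/IH2 => //; exists j.
rewrite enl in h1 h2; split=> [x|r d r2].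
  rewrite h1; split=> [[i im ->]|[a /nthP-/(_ (0, false)) [i im <-] ->]]; last by exists i.
  by exists (nth (0, false) ls i) => //; apply: mem_nth.
rewrite h2 //; split=> [[i im ->]|/(nthP (0, false)) [i im <-]]; last by exists i.
exact: mem_nth.
Qed.

Lemma scale_ok (t : hstate) :
  rg (run (HFor rI rK (rBIG ::= Plus (Reg rBIG) (four (Reg rBIG)))) t) rBIG =
  rg t rBIG * 5 ^ rg t rK.
Proof.
apply: (for_inv (P := fun i u => rg u rBIG = rg t rBIG * 5 ^ i)); first by rewrite muln1.
by move=> i u _ IH _ _; rewrite run_set /= ?updE /= IH expnS; lia.
Qed.

Lemma classify_ok (t : hstate) :
  rg t rM = m -> ar t aIN = nth 0 input ->
  (forall i, i < m -> ar t aLA i = code (c i).1 /\ ar t aLB i = code (c i).2) ->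
  let t' := run (HFor rI rM classify) t in
  forall i, i < m ->
  if As t (code (c i).1) && As t (code (c i).2)
  then [/\ ar t' aKD i = 1, ar t' aTL i = var (c i).1 & ar t' aHD i = var (c i).2]
  else if As t (code (c i).1)
  then [/\ ar t' aKD i = 0, ar t' aTL i = var (c i).2 & ar t' aHD i = var (c i).1]
  else [/\ ar t' aKD i = 0, ar t' aTL i = var (c i).1 & ar t' aHD i = var (c i).2].
Proof.
move=> em ein hc t'.
pose I n u := forall i, i < n ->
  if As t (code (c i).1) && As t (code (c i).2)
  then [/\ ar u aKD i = 1, ar u aTL i = var (c i).1 & ar u aHD i = var (c i).2]
  else if As t (code (c i).1)
  then [/\ ar u aKD i = 0, ar u aTL i = var (c i).2 & ar u aHD i = var (c i).1]
  else [/\ ar u aKD i = 0, ar u aTL i = var (c i).1 & ar u aHD i = var (c i).2].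
suff : I (rg t rM) t' by rewrite em.
apply: for_inv => // i u im IH hr ha j; rewrite em in im.
have eu : ar u aIN = nth 0 input by rewrite ha.
have [ea eb] := hc i im.
have c1 : ar u aLA i = code (c i).1 by rewrite ha.
have c2 : ar u aLB i = code (c i).2 by rewrite ha.
have Au d : (ar u aA d != 0) = As t d by rewrite /As ha.
rewrite ltnS leq_eqVlt /classify !runE /= ?updE /= c1 c2 !Au !eu !input_clause //=.
case: (j =P i) => [-> _|ji /= jlt]; last first.
  have {}IH := IH j jlt; have /eqP/negPf ji' := ji.
  by case: (As t (code (c i).1)); case: (As t (code (c i).2)) => /=; rewrite !updE ji'.
by case: (As t (code (c i).1)); case: (As t (code (c i).2)) => /=; rewrite !updE eqxx; split.
Qed.

Definition deleted (t : hstate) (n : nat) : seq (literal * literal) :=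
  [seq c i | i <- iota 0 n & ar t aDEL i != 0].

Lemma output_ok (t : hstate) :
  rg t rM = m -> ar t aIN = nth 0 input ->
  let t' := run output t in
  if rg t rDone == 1 then
    rg t' rOut = 2 + 4 * size (deleted t m) /\
    forall i, i < 2 + 4 * size (deleted t m) ->
      ar t' aOUT i = nth 0 ([:: 1; size (deleted t m)] ++ code_clauses (deleted t m)) i
  else rg t' rOut = 1 /\ ar t' aOUT 0 = 0.
Proof.
move=> em ein; rewrite /output run_if ev_Same /=; case: (rg t rDone == 1); last by split; rewrite !runE.
rewrite 2!run_seq run_set; set t0 := hset t rN _.
pose I n u := rg u rN = size (deleted t n) /\
  forall i, i < 4 * size (deleted t n) -> ar u aOUT (2 + i) = nth 0 (code_clauses (deleted t n)) i.
have : I (rg t0 rM) (run (HFor rI rM emit) t0).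
  apply: for_inv => // i u im [IH1 IH2] hr ha; rewrite [rg t0 rM]em in im.
  have eu : ar u aIN = nth 0 input by rewrite ha.
  have ed : ar u aDEL = ar t aDEL by rewrite ha.
  have eD : deleted t i.+1 = if ar t aDEL i != 0 then rcons (deleted t i) (c i) else deleted t i.
    rewrite /deleted -[i.+1]addn1 iotaD filter_cat map_cat /= add0n; case: ifP => _ /=; last by rewrite cats0.
    by rewrite cats1.
  rewrite /emit run_if /= ?updE /= ed /I eD; case: ifPn => hd; last by rewrite run_skip.
  set D := deleted t i in IH1 IH2 *.
  have -> : code_clauses (rcons D (c i)) = code_clauses D ++ block (c i).
    by rewrite /code_clauses map_rcons -cats1 flatten_cat.
  rewrite !runE /= ?updE /= !eu IH1 !input_clause //= size_rcons; split; first by lia.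
  move=> j j4; rewrite !updE nth_cat size_code_clauses.
  case: (ltnP j (4 * size D)) => jD.
    by do 4 (rewrite ifF; last by lia); apply: IH2.
  have [q [-> q4]] : exists q, j = 4 * size D + q /\ q < 4 by exists (j - 4 * size D); lia.
  rewrite addKn; set n := size D.
  have -> : (2 + (4 * n + q) == 2 + (n + n + (n + n)) + 3) = (q == 3) by lia.
  have -> : (2 + (4 * n + q) == 2 + (n + n + (n + n)) + 2) = (q == 2) by lia.
  have -> : (2 + (4 * n + q) == 2 + (n + n + (n + n)) + 1) = (q == 1) by lia.
  have -> : (2 + (4 * n + q) == 2 + (n + n + (n + n))) = (q == 0) by lia.
  by case: q q4 => [|[|[|[|]]]].
rewrite [rg t0 rM]em; set u := run _ t0 => -[h1 h2].
rewrite !runE /= ?updE /= h1; split; first by lia.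
move=> i hi; rewrite !updE; case: i hi => [|[|i]] hi //=.
exact: h2.
Qed.

End Program.

(** The stages are cut where loop bounds are computed: inside each of them no register that bounds a
    loop is written, as the cost estimate requires. *)
Definition program : hl := setup ;; stage1 ;; bounds ;; stage2.

Definition hinit (w : seq nat) : hstate :=
  HState (fun _ => 0) (fun a i => if a == aIN then nth 0 w i else 0).

Lemma steps_done (i0 n : nat) (t : hstate) : rg t rDone != 0 ->
  let t' := steps i0 n t in ar t' = ar t /\ forall x, x != rB -> rg t' x = rg t x.
Proof.
move=> h; suff H j : ar (steps i0 j t) = ar t /\ forall x, x != rB -> rg (steps i0 j t) x = rg t x by exact: H.
elim: j => // j [IH1 IH2]; rewrite -addn1 stepsD steps1 /step run_if.
have -> : ev (Reg rDone) (hset (steps i0 j t) rB (i0 + j)) = rg t rDone by rewrite /= updE /= IH2.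
rewrite h run_skip; split=> //= x xB.
by rewrite updE (negPf xB) IH2.
Qed.

(** * From the search to the answer *)

Section Correct.

Variables (F : formula) (L : {fset literal}) (l : literal) (k : nat).
Variables (cs : seq (literal * literal)) (ls : seq literal).
Hypothesis inst : aslasat_instance F L l.
Hypothesis csF : lists_clauses cs F.
Hypothesis lsL : lists_literals ls L.

Local Notation m := (size cs).
Local Notation c := (cl cs).
Local Notation inw := (input cs ls l k).

Definition st1 : hstate := run setup (hinit inw).
Definition st2 : hstate := run (HFor rI rM read_codes) st1.
Definition st3 : hstate := run (HFor rI rM count_vars) st2.
Definition st4 : hstate := run (HFor rI rNL mark_literals) st3.
Definition st5 : hstate := run (HFor rI rK (rBIG ::= Plus (Reg rBIG) (Plus (Plus (Reg rBIG) (Reg rBIG)) (Plus (Reg rBIG) (Reg rBIG))))) st4.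
Definition st6 : hstate := run bounds st5.
Definition st7 : hstate := run solve_sat st6.
Definition st8 : hstate := run (HFor rI rM classify) st7.

Lemma st1_arr : ar st1 = ar (hinit inw). Proof. by []. Qed.

Lemma st1_reg : [/\ rg st1 rK = k, rg st1 rM = m, rg st1 rNL = size ls, rg st1 rS = var l
  & [/\ rg st1 rK1 = k.+1, rg st1 rN = 0, rg st1 rBIG = 20, rg st1 rDone = 0
  & [/\ rg st1 rMode = 0, rg st1 rDep = 0 & rg st1 rND = 0]]].
Proof. by split=> //; split=> //; rewrite /st1 /setup !runE /= !updE /= addn1. Qed.

Lemma st6_frame (x : nat) :
  x \in [:: rK; rM; rNL; rS; rK1; rDone; rMode; rDep; rND] -> rg st6 x = rg st1 x.
Proof.
rewrite /st6 /st5 /st4 /st3 /st2 => h; rewrite -4!run_seq.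
by apply: run_regs h.
Qed.

Lemma st6_arr (a : nat) :
  a \in [:: aIN; aOUT; aKD; aTL; aHD; aDEL; aPHI; aA; aQ; aNX; aSC; aSA] -> ar st6 a = ar st1 a.
Proof.
rewrite /st6 /st5 /st4 /st3 /st2 => h; rewrite -4!run_seq.
by apply: run_arrs h.
Qed.

Lemma st6_codes (i : nat) : i < m ->
  [/\ ar st6 aLA i = code (c i).1, ar st6 aNA i = code (neg (c i).1),
      ar st6 aLB i = code (c i).2 & ar st6 aNB i = code (neg (c i).2)].
Proof.
have e a : a \in [:: aLA; aNA; aLB; aNB] -> ar st6 a = ar st2 a.
  rewrite /st6 /st5 /st4 /st3 => h; rewrite -3!run_seq; by apply: run_arrs h.
have [_ em _ _ _] := st1_reg.
by move=> im; have := read_codes_ok (t := st1) em erefl im; rewrite -/st2 !e.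
Qed.

Lemma st6_vars : exists V, [/\ uniq V, size V = rg st6 rN & V =i fvars F].
Proof.
have [_ em _ _ [_ en _ _ _]] := st1_reg.
have em2 : rg st2 rM = m by rewrite /st2 run_reg.
have ei2 : ar st2 aIN = nth 0 inw by rewrite /st2 run_arr.
have en2 : rg st2 rN = 0 by rewrite /st2 run_reg.
have es2 x : ar st2 aSEEN x = 0 by rewrite /st2 run_arr.
have [V [h1 h2 h3]] := count_vars_ok em2 ei2 en2 es2; exists V; split=> //.
  by rewrite h2 -/st3 /st6 /st5 /st4 -2!run_seq run_reg.
by move=> x; apply/idP/(fvarsF csF) => /h3.
Qed.

Lemma st6_marks :
  (forall x, ar st6 aT x != 0 <-> x \in vars L) /\
  (forall r d, r < 2 -> Xs st6 r d <-> lit d \in L).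
Proof.
have [_ em enl _ _] := st1_reg.
have em3 : rg st3 rM = m by rewrite /st3 /st2 -run_seq run_reg.
have enl3 : rg st3 rNL = size ls by rewrite /st3 /st2 -run_seq run_reg.
have ei3 : ar st3 aIN = nth 0 inw by rewrite /st3 /st2 -run_seq run_arr.
have eT x : ar st3 aT x = 0 by rewrite /st3 /st2 -run_seq run_arr.
have eX x : ar st3 aX x = 0 by rewrite /st3 /st2 -run_seq run_arr.
have [h1 h2] := mark_literals_ok em3 enl3 ei3 eT eX; rewrite -/st4 in h1 h2.
have eT6 : ar st6 aT = ar st4 aT by rewrite /st6 /st5 -run_seq run_arr.
have eX6 : ar st6 aX = ar st4 aX by rewrite /st6 /st5 -run_seq run_arr.
case: lsL => _ lsE; split=> [x|r d r2].
  rewrite eT6 h1; split=> [[a al ->]|/imfsetP [a /= aL ->]].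
    by apply/imfsetP; exists a => //; rewrite -lsE.
  by exists a => //; rewrite lsE.
by have := h2 r d r2; rewrite lsE /Xs eX6.
Qed.

Lemma st6_bounds : [/\ rg st6 rNP = rg st6 rN + 2, rg st6 rN2 = 2 * rg st6 rN + 1
  & rg st6 rBIG = 20 * 5 ^ k].
Proof.
rewrite /st6 /bounds !runE /= ?updE /=; split=> //; first by lia.
rewrite /st5 scale_ok.
have -> : rg st4 rBIG = rg st1 rBIG by rewrite /st4 /st3 /st2 -2!run_seq run_reg.
have -> : rg st4 rK = rg st1 rK by rewrite /st4 /st3 /st2 -2!run_seq run_reg.
by have [-> _ _ _ [_ _ -> _ _]] := st1_reg.
Qed.

Lemma st7_assignment :
  [/\ forall a, var a \in fvars F -> As st7 (code (neg a)) = ~~ As st7 (code a),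
      forall i, i < m -> As st7 (code (c i).1) || As st7 (code (c i).2)
    & forall a, a \in L -> var a \in fvars F -> As st7 (code a)].
Proof.
case: inst => _ ncL [P [ncP vP sP] dP] _.
have [V [uV sV VF]] := st6_vars.
pose la := ar st6 aLA; pose na := ar st6 aNA; pose lb := ar st6 aLB; pose nb := ar st6 aNB.
pose PP d := lit d \in P; pose LL d := lit d \in L.
have cd := st6_codes.
have na_la i : i < m -> na i = nc (la i) by move=> /cd [e1 e2 _ _]; rewrite /na /la e1 e2 code_neg.
have nb_lb i : i < m -> nb i = nc (lb i) by move=> /cd [_ _ e1 e2]; rewrite /nb /lb e1 e2 code_neg.
have la_V i : i < m -> (la i)./2 \in V.
  by move=> im; case: (cd i im) => e _ _ _; rewrite /la e half_code VF; apply/(fvarsF csF); exists i => //; left.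
have lb_V i : i < m -> (lb i)./2 \in V.
  by move=> im; case: (cd i im) => _ _ e _; rewrite /lb e half_code VF; apply/(fvarsF csF); exists i => //; right.
have V_flit v : v \in V -> flit m la na lb nb v.*2.
  rewrite VF => /(fvarsF csF) [i im h]; exists i => //; have [e1 e2 e3 e4] := cd i im.
  rewrite /flit_of !inE na_la // nb_lb //.
  case: h => h; [have /half_eq [->|->] : v.*2./2 = (la i)./2 by rewrite doubleK /la e1 half_code
    | have /half_eq [->|->] : v.*2./2 = (lb i)./2 by rewrite doubleK /lb e3 half_code];
    by rewrite eqxx ?orbT.
have flitE d : flit m la na lb nb d -> var (lit d) \in fvars F.
  by move=> fd; rewrite -VF; apply: (flit_V na_la nb_lb la_V lb_V fd).
have flit_code a : var a \in fvars F -> flit m la na lb nb (code a).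
  by move=> aF; apply: (V_flits na_la nb_lb V_flit); rewrite half_code VF.
have P_sat i : i < m -> PP (la i) || PP (lb i).
  move=> im; have [e1 _ e3 _] := cd i im; rewrite /PP /la /lb e1 e3 !codeK.
  have [a] := sP (mkclause (c i)) (introT (memF csF _) (ex_intro2 _ _ i im erefl)).
  by rewrite mem_mkclause => /orP[] /eqP -> ->; rewrite ?orbT.
have P_cons d : flit m la na lb nb d -> PP d -> ~~ PP (nc d).
  by move=> _ h; rewrite /PP lit_nc; apply: ncP.
have P_tot d : flit m la na lb nb d -> PP d || PP (nc d).
  move=> /flitE; rewrite -vP => /imfsetP [a /= aP e]; rewrite /PP lit_nc.
  by have /var_eq [<-|<-] : var a = var (lit d) by []; rewrite aP ?orbT.
have P_L d : LL d -> flit m la na lb nb d -> PP d.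
  move=> ld fd; case/orP: (P_tot d fd) => //; rewrite /PP lit_nc => h.
  have : neg (lit d) \in (P `&` negs L)%fset by rewrite in_fsetI h; apply/imfsetP; exists (lit d).
  by rewrite dP inE.
have [_ mX] := st6_marks.
have A0 d : As st6 d = false by rewrite /As st6_arr.
have em : rg st6 rM = m by rewrite st6_frame //; have [_ ->] := st1_reg.
(* At the start nothing is assigned and both runs consist of [L], so both are true under the given
   satisfying assignment. *)
have si : sat_inv m la na lb nb V PP LL 0 st6.
  split=> //.
  - by move=> i _; rewrite !A0.
  - by move=> d _; rewrite A0.
  - by move=> r r2 d _ _; rewrite !A0.
  - by left=> d fd /(mX 0 d isT) h; apply: P_L.
  - by right=> r d r2 ld _; apply/mX.
  - by right; exists 0.
have lt : 2 * size V < rg st6 rN2 by have [_ -> _] := st6_bounds; rewrite sV; lia.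
have [h1 h2 h3] := solve_sat_ok na_la nb_lb la_V lb_V P_sat P_cons P_tot V_flit si lt.
rewrite -/st7 in h1 h2 h3; split.
- by move=> a aF; rewrite code_neg; apply: h1; apply: flit_code.
- by move=> i im; have := h2 i im; have [e1 _ e3 _] := cd i im; rewrite /la /lb e1 e3.
- by move=> a aL aF; apply: h3; [rewrite /LL codeK | apply: flit_code].
Qed.

Definition st9 : hstate :=
  run (HIf (Arr aA (Plus (Plus (Arr aIN (Cst 3)) (Arr aIN (Cst 3))) (Arr aIN (Cst 4))))
    (rDone ::= Cst 1) HSkip) st8.
Definition st10 : hstate := run (HFor rB rBIG step) st9.

Lemma st9_frame (x : nat) :
  x \in [:: rK; rM; rS; rK1; rMode; rDep; rND; rNP; rBIG] -> rg st9 x = rg st6 x.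
Proof. by rewrite /st9 /st8 /st7 => h; rewrite -2!run_seq; apply: run_regs h. Qed.

Lemma st9_arr (a : nat) :
  a \in [:: aIN; aOUT; aDEL; aT; aPHI; aQ; aNX; aSC; aSA; aLA; aLB] -> ar st9 a = ar st6 a.
Proof. by rewrite /st9 /st8 /st7 => h; rewrite -2!run_seq; apply: run_arrs h. Qed.

Lemma st9_done : rg st9 rDone = As st7 (code l).
Proof.
have i8 : ar st8 aIN = nth 0 inw by rewrite /st8 /st7 -run_seq run_arr // st6_arr.
rewrite /st9 run_if.
have -> : (ev (Arr aA (Plus (Plus (Arr aIN (Cst 3)) (Arr aIN (Cst 3))) (Arr aIN (Cst 4)))) st8 != 0)
  = As st7 (code l).
  have a8 : ar st8 aA = ar st7 aA by rewrite /st8 run_arr.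
  have -> : ev (Arr aA (Plus (Plus (Arr aIN (Cst 3)) (Arr aIN (Cst 3))) (Arr aIN (Cst 4)))) st8 =
    ar st8 aA (ar st8 aIN 3 + ar st8 aIN 3 + ar st8 aIN 4) by [].
  rewrite a8 i8 /As.
  by congr (ar st7 aA _ != 0).
case: (As st7 (code l)); first by rewrite run_set.
by rewrite run_skip /st8 /st7 -run_seq run_reg // st6_frame.
Qed.

Lemma st7_frame : [/\ rg st7 rM = m, ar st7 aIN = nth 0 inw
  & forall i, i < m -> ar st7 aLA i = code (c i).1 /\ ar st7 aLB i = code (c i).2].
Proof.
have [_ em1 _ _ _] := st1_reg.
split; [by rewrite /st7 run_reg // st6_frame | by rewrite /st7 run_arr // st6_arr | ].
have a7 a : a \in [:: aLA; aLB] -> ar st7 a = ar st6 a by apply: run_arrs.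
by move=> i im; rewrite !a7 //; have [-> _ -> _] := st6_codes im.
Qed.

Lemma st9_graph (a : nat) : a \in [:: aKD; aTL; aHD] -> ar st9 a = ar st8 a.
Proof. by apply: run_arrs. Qed.

Lemma st8_kind (i : nat) : i < m ->
  if As st7 (code (c i).1) && As st7 (code (c i).2)
  then [/\ ar st8 aKD i = 1, ar st8 aTL i = var (c i).1 & ar st8 aHD i = var (c i).2]
  else if As st7 (code (c i).1)
  then [/\ ar st8 aKD i = 0, ar st8 aTL i = var (c i).2 & ar st8 aHD i = var (c i).1]
  else [/\ ar st8 aKD i = 0, ar st8 aTL i = var (c i).1 & ar st8 aHD i = var (c i).2].
Proof.
have [em7 i7 c7] := st7_frame.
have h := classify_ok em7 i7 c7; rewrite -/st8 in h => im.
exact (h i im).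
Qed.

Lemma deleted_uniq (t : hstate) : uniq [seq mkclause p | p <- deleted cs t m].
Proof.
rewrite /deleted -map_comp map_inj_in_uniq ?filter_uniq ?iota_uniq // => i j.
by rewrite !mem_filter !mem_iota => /andP[_ /andP[_ im]] /andP[_ /andP[_ jm]]; apply: (cl_inj csF).
Qed.

Lemma st10_steps (n r : nat) : n + r = 20 * 5 ^ k -> st10 = steps n r (steps 0 n st9).
Proof.
have [_ _ eB] := st6_bounds => e.
by rewrite -[X in steps X r _]add0n -stepsD e -eB -(st9_frame (x := rBIG)).
Qed.

Lemma st10_frame : rg st10 rM = m /\ ar st10 aIN = nth 0 inw.
Proof.
split; last by rewrite /st10 run_arr // st9_arr // st6_arr.
rewrite /st10 run_reg // st9_frame // st6_frame //; by have [_ ->] := st1_reg.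
Qed.

Lemma program_st10 : run program (hinit inw) = run output st10.
Proof. by rewrite /program /stage1 /stage2 !run_seq. Qed.

Opaque st1 st6 st7 st8 st9 st10.

Definition solved (t : hstate) : Prop :=
  exists S : {fset clause}, [/\ culprit_set F L l S, (#|` S|%fset <= k)
    & lists_clauses (deleted cs t m) S].

Lemma search_ok' :
  (rg st10 rDone = 1 /\ solved st10) \/
  (rg st10 rDone = 2 /\ ~ exists S : {fset clause}, culprit_set F L l S /\ #|` S|%fset <= k).
Proof.
have [A_neg A_sat A_L] := st7_assignment.
have lL : var l \notin vars L by case: inst.
have kind := st8_kind; have ak := st9_graph.
have [mT _] := st6_marks.
have fin t (Z : nat -> bool) :
    (var l \in fvars F -> As st7 (code l) (+) Z (var l)) ->
    (forall x, x \in vars L -> ~~ Z x) -> count_del m (ar t aDEL) <= k ->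
    nviol m (ar st8 aKD) (ar st8 aTL) (ar st8 aHD) (ar t aDEL) Z = 0 -> solved t.
  move=> h1 h2 h3 h4; pose s := [seq mkclause p | p <- deleted cs t m].
  have us : uniq s := deleted_uniq t.
  pose S := seq_fset tt s; have Ss : S =i s by apply: seq_fsetE.
  exists S; split; last by split=> // x; rewrite Ss.
    apply: (culprit_of_cut csF A_neg A_sat A_L kind (dl := ar t aDEL) (Z := Z)) => //.
      move=> i im d0; apply/negP=> v; move: h4; rewrite /nviol (bigD1 (Ordinal im)) //= v; lia.
    move=> d; rewrite Ss /s /deleted -map_comp; split.
      by case/mapP=> i; rewrite mem_filter mem_iota => /andP[di /andP[_ im]] ->; exists i.
    case=> i [im di ->]; apply/mapP; exists i => //; by rewrite mem_filter di mem_iota.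
  apply: leq_trans h3; rewrite /count_del (sum_size_filter m (fun i => ar t aDEL i != 0)) -(size_map (cl cs)) -/(deleted cs t m).
  rewrite -(size_map mkclause) -/s; apply: uniq_leq_size; first exact: fset_uniq.
  by move=> x; rewrite -Ss.
have frame10 (t : hstate) (v n : nat) : rg t rDone = v.+1 -> n <= 20 * 5 ^ k ->
    steps 0 n st9 = t -> ar st10 = ar t /\ rg st10 rDone = v.+1.
  move=> hd le et; rewrite (st10_steps (subnKC le)) et -hd.
  have hd0 : rg t rDone != 0 by rewrite hd.
  by have [e1 e2] := steps_done n (20 * 5 ^ k - n) hd0; rewrite e1 e2.
have d9 i : ar st9 aDEL i = 0 by rewrite st9_arr // st6_arr.
have cd9 : count_del m (ar st9 aDEL) = 0 by rewrite /count_del big1 // => i _; rewrite d9.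
have [r1 r2 r3 r4 [r5 r6 r7 r8 [r9 r10 r11]]] := st1_reg.
(* When [l] is already true no variable has to be flipped, and the empty set answers with the empty
   cut. *)
case: (boolP (As st7 (code l))) => Al.
  have dn : rg st9 rDone = 1 by rewrite st9_done Al.
  have [e1 e2] := frame10 st9 0 0 dn (leq0n _) erefl.
  left; rewrite e2; split=> //; apply: (fin st10 (fun _ => false)); [by rewrite Al|by []|by rewrite e1 cd9|].
  rewrite /nviol big1 // => i _; rewrite (violatedE A_sat kind) ?e1 //.
  by have := A_sat i (ltn_ord i); rewrite !addbF => ->.
have [V [uV sV VF]] := st6_vars.
have npb (q : seq nat) : uniq q -> (forall x, x \in q -> vert m (ar st8 aTL) (ar st8 aHD) (var l) x) ->
    size q < rg st6 rNP.
  move=> uq vq; have -> : rg st6 rNP = (size (var l :: V)).+1.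
    by have [-> _ _] := st6_bounds; rewrite /= sV; lia.
  rewrite ltnS; apply: uniq_leq_size => // x /vq [->|[i im h]]; first by rewrite mem_head.
  rewrite inE VF; apply/orP; right; apply/(fvarsF csF); exists i => //.
  have := kind i im; case: ifP => _; [|case: ifP => _] => -[_ e1 e2];
    move: h; rewrite e1 e2 => -[->|->]; [by left|by right|by right|by left|by left|by right].
have rdy : ready m (ar st8 aKD) (ar st8 aTL) (ar st8 aHD) (var l) k (rg st6 rNP) st9.
  split.
  - by split; rewrite ?ak // st9_frame // st6_frame.
  - by rewrite st9_frame // st6_frame.
  - by rewrite st9_frame // st6_frame.
  - by rewrite st9_frame.
  - by move=> x; rewrite st9_arr // st6_arr.
  - by rewrite cd9 st9_frame // st6_frame.
  - by rewrite st9_done (negPf Al).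
have md : rg st9 rMode = 0 by rewrite st9_frame // st6_frame.
have nd : rg st9 rND = 0 by rewrite st9_frame // st6_frame.
(* At the root [K = k + 1] and [f0 = 0], so [n + 3] is at most [4 * 5^(k + 1)]. One of the spare
   micro-steps is the final backtrack on an empty stack, which reports failure. *)
have [n [bn out]] := dfs npb 0 (leqnn (2 * k.+1 - 0)) rdy md
  (etrans (congr1 (addn^~ k.+1) nd) (add0n _)) (leq0n _) (fun _ _ => leq0n _).
have {}bn : n + 1 <= 20 * 5 ^ k by move: bn; rewrite expn0 expnS; lia.
case: out => [[[f1 f2] [f3 f4] [f5 f6] f7 f8]|[s1 s2 [Z [Zs ZT] nZ]]]; last first.
  have [e1 e2] := frame10 _ 0 n s1 (leq_trans (leq_addr 1 n) bn) erefl.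
  left; rewrite e2; split=> //; apply: (fin st10 Z); rewrite ?e1 //.
  - by rewrite (negPf Al).
  - by move=> x /mT; rewrite -(st9_arr (a := aT)) // => /ZT.
set t := steps 0 n st9 in f1 f2 f3 f4 f5 f6.
have dep : rg t rDep = 0 by rewrite f6 st9_frame // st6_frame.
have e : rg (steps 0 (n + 1) st9) rDone = 2.
  rewrite stepsD steps1 (step_back _ (rd_done f1) f2) /backtrack run_if.
  by have -> : ev (Reg rDep) (hset t rB (0 + n)) = 0; [rewrite /= updE | rewrite run_set].
have [e1 e2] := frame10 _ 1 (n + 1) e bn erefl.
right; rewrite e2; split=> // -[S [cS kS]].
have fe := cut_of_culprit csF lL A_neg A_sat A_L kind (negPf Al) d9
   (fun x h => proj1 (mT x) (eq_ind _ (fun g => g x != 0) h _ (st9_arr (a := aT) isT))) cS.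
by have := f8 _ fe; rewrite nd; lia.
Qed.

Lemma program_ok :
  let t := run program (hinit inw) in
  ((exists S : {fset clause}, culprit_set F L l S /\ #|` S|%fset <= k) ->
     exists (S : {fset clause}) (ds : seq (literal * literal)),
     [/\ culprit_set F L l S, #|` S|%fset <= k, lists_clauses ds S,
       rg t rOut = 2 + 4 * size ds /\ size ds <= m
     & forall i, i < 2 + 4 * size ds -> ar t aOUT i = nth 0 ([:: 1; size ds] ++ code_clauses ds) i]) /\
  (~ (exists S : {fset clause}, culprit_set F L l S /\ #|` S|%fset <= k) ->
     ar t aOUT 0 = 0 /\ rg t rOut = 1).
Proof.
rewrite program_st10; have [em ei] := st10_frame.
have out := output_ok em ei; rewrite /= in out *.
have sz : size (deleted cs st10 m) <= m.
  by rewrite /deleted size_map size_filter (leq_trans (count_size _ _)) // size_iota.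
case: search_ok' => [[dn [S [h1 h2 h3]]]|[dn no]]; rewrite dn /= in out.
  case: out => o1 o2; split; last by case; exists S.
  by move=> _; exists S, (deleted cs st10 m); split.
by split=> // _; case: out.
Qed.

Lemma program_out : rg (run program (hinit inw)) rOut <= 2 + 4 * m.
Proof.
rewrite program_st10; have [em ei] := st10_frame.
have out := output_ok em ei; rewrite /= in out *.
have sz : size (deleted cs st10 m) <= m.
  by rewrite /deleted size_map size_filter (leq_trans (count_size _ _)) // size_iota.
move: sz out; set u := run output st10; set n := size _; set d := rg st10 _.
by case: (d == 1) => sz [-> _]; lia.
Qed.

End Correct.

Local Close Scope hl_scope.

(** * Input, output and running time *)

Definition copy (src dst : nat) : cmd :=
  While 4 (Seq (Read 16 src) (Seq (Write dst 16)
    (Seq (Add 8 8 20) (Seq (Add 12 12 24) (Sub 4 4 20))))).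

(** One statement covers both directions between a contiguous block and an interleaved array. No
    destination is a source, so a value cannot be overwritten before it is read. *)
Lemma copy_ok (fwd : bool) (N x y : nat) (s : state) :
  let src := if fwd then 8 else 12 in let dst := if fwd then 12 else 8 in
  let sa j := if fwd then x + j else y + 32 * j in
  let da j := if fwd then y + 32 * j else x + j in
  reg s 4 = N -> reg s 8 = x -> reg s 12 = y -> reg s 20 = 1 -> reg s 24 = 32 ->
  (forall i j, i < N -> j < N -> da i <> sa j) ->
  exists s', [/\ exec (copy src dst) s s' (1 + N * 6),
    forall j, j < N -> mem s' (da j) = mem s (sa j),
    forall a, (forall j, j < N -> a <> da j) -> mem s' a = mem s a
    & forall r, r \notin [:: 4; 8; 12; 16] -> reg s' r = reg s r].
Proof.
move=> src dst sa da; elim: N x y s @sa @da => [|N IH] x y s sa da e4 e8 e12 e20 e24 dis.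
  by exists s; split=> //; apply: exec_WhileF.
pose s1 := setr s 16 (mem s (reg s src)).
pose s2 := State (reg s1) (upd (mem s1) (reg s1 dst) (reg s1 16)).
pose s3 := setr s2 8 (reg s2 8 + reg s2 20).
pose s4 := setr s3 12 (reg s3 12 + reg s3 24).
pose s5 := setr s4 4 (reg s4 4 - reg s4 20).
have f4 : reg s5 4 = N by rewrite /= !updE /= e4 e20 subn1.
have f8 : reg s5 8 = x.+1 by rewrite /= !updE /= e8 e20 addn1.
have f12 : reg s5 12 = y + 32 by rewrite /= !updE /= e12 e24.
have f20 : reg s5 20 = 1 by rewrite /= !updE /= e20.
have f24 : reg s5 24 = 32 by rewrite /= !updE /= e24.
have saS j : (if fwd then x.+1 + j else y + 32 + 32 * j) = sa j.+1 by rewrite /sa; case: (fwd); lia.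
have daS j : (if fwd then y + 32 + 32 * j else x.+1 + j) = da j.+1 by rewrite /da; case: (fwd); lia.
have [|s' [h1 h2 h3 h4]] := IH x.+1 (y + 32) s5 f4 f8 f12 f20 f24.
  by move=> i j iN jN; rewrite saS daS; apply: dis.
have es : reg s src = sa 0 by rewrite /src /sa; case: (fwd); lia.
have ed : reg s1 dst = da 0 by rewrite /s1 /dst /da; case: (fwd); rewrite /= updE /=; lia.
have m5 a : mem s5 a = if a == da 0 then mem s (sa 0) else mem s a.
  by rewrite /= updE -es -ed.
have daI j : da j.+1 <> da 0 by rewrite /da; case: (fwd); lia.
exists s'; split.
- have -> : 1 + N.+1 * 6 = ((1 + (1 + (1 + (1 + 1)))) + (1 + N * 6)).+1 by lia.
  apply: exec_WhileT; [by rewrite e4| |exact: h1].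
  do 4 (apply: exec_Seq; first by constructor); by constructor.
- case=> [|j] jN.
    rewrite h3; first by rewrite m5 eqxx.
    by move=> j jN'; rewrite daS => e; apply: (daI j).
  rewrite -daS h2 // saS m5; case: eqP => // e.
  by case: (dis 0 j.+1).
- move=> a ha; rewrite h3; last by move=> j jN; rewrite daS; apply: ha.
  by rewrite m5; case: eqP => // e; case: (ha 0).
- move=> r hr; rewrite h4 //; move: hr; rewrite !inE !negb_or => /and4P[/negPf r1 /negPf r2 /negPf r3 /negPf r4].
  by rewrite /= !updE r1 r2 r3 r4.
Qed.

(** The arrays are placed right after the input, whose length is computed by additions as
    [5 + 4 * m + 2 * |L|]. Memory beyond the input reads 0, so all arrays but the copy of the input
    start out empty. *)
Definition prologue : cmd :=
  seqs [:: Const 20 1; Read 4 20; Const 8 2; Read 8 8; Const 0 5;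
    Add 0 0 4; Add 0 0 4; Add 0 0 4; Add 0 0 4; Add 0 0 8; Add 0 0 8;
    Move 4 0; Const 8 0; Move 12 0; Const 24 32; copy 8 12].

Definition epilogue : cmd :=
  seqs [:: Move 4 (hreg 30); Const 8 0; Const 20 1; Const 24 32; Add 12 0 20; copy 12 8].

Lemma exec_cons (p : cmd) (ps : seq cmd) (s1 s2 s3 : state) (t : nat) :
  exec p s1 s2 1 -> exec (seqs ps) s2 s3 t -> exec (seqs (p :: ps)) s1 s3 t.+1.
Proof. by move=> h1 h2; rewrite -add1n; apply: exec_Seq h1 h2. Qed.

Lemma exec_last (p : cmd) (s1 s2 : state) (t : nat) :
  exec p s1 s2 t -> exec (seqs [:: p]) s1 s2 t.+1.
Proof. by move=> h; rewrite -addn1; apply: exec_Seq h _; constructor. Qed.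

Lemma upd_hreg (f : nat -> nat) (r v x : nat) : ~~ odd r -> upd f r v (hreg x) = f (hreg x).
Proof.
move=> h; rewrite upd_other // => e; move: h.
by rewrite -e /hreg /= oddM.
Qed.

Definition base_state (w : seq nat) (v : nat) (s : state) : Prop :=
  [/\ mem s = nth 0 w, forall x, reg s (hreg x) = 0
    & [/\ reg s 0 = v, reg s 4 = nth 0 w 1, reg s 8 = nth 0 w 2 & reg s 20 = 1]].

Lemma base_add (w : seq nat) (v r : nat) (s : state) :
  r \in [:: 4; 8] -> base_state w v s ->
  exists s', exec (Add 0 0 r) s s' 1 /\ base_state w (v + nth 0 w (r %/ 4)) s'.
Proof.
move=> hr [e1 e2 [e3 e4 e5 e6]]; exists (setr s 0 (reg s 0 + reg s r)).
split; first by constructor.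
split; [by [] | by move=> x; rewrite /= upd_hreg | split; [|by []|by []|by []]].
by move: hr; rewrite /= upd_same e3 !inE => /orP[] /eqP ->; rewrite ?e4 ?e5.
Qed.

Lemma prologue_ok (w : seq nat) :
  size w = 5 + 4 * nth 0 w 1 + 2 * nth 0 w 2 ->
  exists s, exec prologue (init w) s (17 + 6 * size w) /\ simulates (size w) s (hinit w).
Proof.
move=> sw; set b := size w in sw *.
pose q1 := setr (init w) 20 1; pose q2 := setr q1 4 (mem q1 (reg q1 20)).
pose q3 := setr q2 8 2; pose q4 := setr q3 8 (mem q3 (reg q3 8)); pose q5 := setr q4 0 5.
have b5 : base_state w 5 q5 by split=> // x; rewrite /= !upd_hreg.
have [q6 [x6 b6]] := base_add (isT : 4 \in [:: 4; 8]) b5.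
have [q7 [x7 b7]] := base_add (isT : 4 \in [:: 4; 8]) b6.
have [q8 [x8 b8]] := base_add (isT : 4 \in [:: 4; 8]) b7.
have [q9 [x9 b9]] := base_add (isT : 4 \in [:: 4; 8]) b8.
have [q10 [x10 b10]] := base_add (isT : 8 \in [:: 4; 8]) b9.
have [q11 [x11 b11]] := base_add (isT : 8 \in [:: 4; 8]) b10.
have [em eo [e0 e4 e8 e20]] := b11.
have {}e0 : reg q11 0 = b by rewrite e0 sw; change (4 %/ 4) with 1; change (8 %/ 4) with 2; lia.
pose q12 := setr q11 4 (reg q11 0); pose q13 := setr q12 8 0.
pose q14 := setr q13 12 (reg q13 0); pose q15 := setr q14 24 32.
have r4 : reg q15 4 = b by exact: e0.
have r12 : reg q15 12 = b by exact: e0.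
have [|s' [h1 h2 h3 h4]] := @copy_ok true b 0 b q15 r4 erefl r12 e20 erefl.
  by move=> i j _ jb /=; lia.
have m15 : mem q15 = nth 0 w by exact: em.
exists s'; split.
  have -> : 17 + 6 * b = (1 + b * 6).+4.+4.+4.+4 by lia.
  do 5 (apply: exec_cons; first by constructor).
  do 6 (apply: exec_cons; first by eassumption).
  do 4 (apply: exec_cons; first by constructor).
  exact: exec_last h1.
split; first by rewrite h4.
- move=> x; rewrite h4 ?inE; last by rewrite /hreg; lia.
  by rewrite /= !upd_hreg.
- move=> a i a32; rewrite /hinit /=; case: (a =P 0) => [->|a0].
    rewrite addn0; case: (ltnP i b) => ib; first by rewrite (h2 i ib) m15.
    rewrite h3; last by move=> j jb; lia.
    by rewrite m15 !nth_default //; lia.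
  rewrite h3; last by move=> j jb; lia.
  by rewrite m15 nth_default //; lia.
Qed.

(** An output of length at most [b] is written entirely below the arrays, so the array being copied
    stays intact. *)
Lemma epilogue_ok (b : nat) (s : state) (h : hstate) :
  simulates b s h -> rg h 30 <= b ->
  exists s', exec epilogue s s' (7 + 6 * rg h 30) /\
    forall i, i < rg h 30 -> mem s' i = ar h 1 i.
Proof.
move=> [e0 er em] le; set N := rg h 30 in le *.
pose q1 := setr s 4 (reg s (hreg 30)); pose q2 := setr q1 8 0; pose q3 := setr q2 20 1.
pose q4 := setr q3 24 32; pose q5 := setr q4 12 (reg q4 0 + reg q4 20).
have r4 : reg q5 4 = N by rewrite /= !updE /=; apply: (er 30).
have r12 : reg q5 12 = b + 1 by rewrite /= !updE /= e0.
have [|s' [h1 h2 h3 h4]] := @copy_ok false N 0 (b + 1) q5 r4 erefl r12 erefl erefl.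
  by move=> i j iN jN /=; lia.
exists s'; split.
  have -> : 7 + 6 * N = (1 + N * 6).+4.+2 by lia.
  do 5 (apply: exec_cons; first by constructor).
  exact: exec_last h1.
move=> i iN; rewrite -[i in LHS]add0n (h2 i iN) /= -em //.
by congr (mem s _); lia.
Qed.

(** * Growth of the stages and the final time bound *)

Lemma cost_growth (p : hl) (s : hstate) :
  all (fun x => x \notin wregs p) (bregs p) -> cost p s <= kcost p * growth p (rg s).
Proof.
move/allP=> h; apply: leq_trans (scost_growth _ _).
by apply: cost_scost.
Qed.

Lemma growth_augment (v : nat -> nat) : growth augment v <= (v 10).+1 * (v 5).+1.
Proof. by rewrite /= !geq_max; do ?[apply/andP; split]; nia. Qed.

Lemma growth_flow (v : nat -> nat) : growth max_flow v <= (v 9).+1 * ((v 10).+1 * (v 5).+1).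
Proof.
have -> : growth max_flow v =
  maxn ((v 5).+1 * 1) (maxn 1 (maxn 1 ((v 9).+1 * growth augment v))) by [].
have h := growth_augment v; rewrite !geq_max; do ?[apply/andP; split]; nia.
Qed.

Lemma growth_step (v : nat -> nat) : growth step v <= (v 9).+1 * ((v 10).+1 * (v 5).+1).
Proof.
have -> : growth step v = maxn 1 (maxn (growth backtrack v) (maxn (growth max_flow v)
  (maxn 1 (maxn (growth select v) (maxn (growth push v) 1))))) by [].
have hb : growth backtrack v = 1 by [].
have hp : growth push v = 1 by [].
have hs : growth select v <= (v 5).+1 by rewrite /= !geq_max; do ?[apply/andP; split]; nia.
have h := growth_flow v; set f := growth max_flow v in h *.
have h1 : (v 5).+1 <= (v 9).+1 * ((v 10).+1 * (v 5).+1) by rewrite mulnA leq_pmull.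
rewrite hb hp; move: h h1 hs; move: (growth select v) f ((v 9).+1 * _) => g f' B.
by rewrite !geq_max; lia.
Qed.

Lemma growth_sat_step (v : nat -> nat) : growth sat_step v <= (v 5).+1.
Proof. by rewrite /= !geq_max; do ?[apply/andP; split]; nia. Qed.

(** Registers 5, 9, 10, 11, 12 hold [m], [k + 1], [n + 2], [2 * n + 1] and [20 * 5^k]: the first
    product is the search (micro-steps, augmentations, passes, clauses), the second the satisfying
    assignment. *)
Lemma growth_stage2 (v : nat -> nat) :
  growth stage2 v <= (v 12).+1 * ((v 9).+1 * ((v 10).+1 * (v 5).+1)) + (v 11).+1 * (v 5).+1.
Proof.
have -> : growth stage2 v = maxn ((v 11).+1 * growth sat_step v) (maxn ((v 5).+1 * growth classify v)
  (maxn 1 (maxn ((v 12).+1 * growth step v) (growth output v)))) by [].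
have hc : growth classify v = 1 by [].
have ho : growth output v <= (v 5).+1 by rewrite /= !geq_max; do ?[apply/andP; split]; nia.
rewrite hc; move: ho (growth_sat_step v) (growth_step v).
move: (growth output v) (growth sat_step v) (growth step v) ((v 9).+1 * _) => go gs gt B h1 h2 h3.
have a1 : (v 5).+1 <= (v 11).+1 * (v 5).+1 by rewrite leq_pmull.
have a2 : (v 11).+1 * gs <= (v 11).+1 * (v 5).+1 by rewrite leq_mul2l h2 orbT.
have a3 : (v 12).+1 * gt <= (v 12).+1 * B by rewrite leq_mul2l h3 orbT.
by rewrite !geq_max; lia.
Qed.

Lemma growth_stage1 (v : nat -> nat) : growth stage1 v <= (v 5).+1 + (v 6).+1 + (v 7).+1.
Proof. by rewrite /= !geq_max; do ?[apply/andP; split]; lia. Qed.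

Definition machine : cmd := Seq prologue (Seq (comp 0 program) epilogue).

Definition time_constant : nat :=
  200 + kcost setup + 6 * kcost stage1 + kcost bounds + 512 * kcost stage2.

Lemma arith_bound (m n nl k E : nat) : 0 < E ->
  let T := E * maxn 1 k * maxn 1 (n + k) * maxn 1 (m + nl) in
  [/\ 0 < T, m + nl <= T, m.+1 + nl.+1 + k.+1 <= 6 * T
    & (20 * E).+1 * (k.+2 * ((n + 2).+1 * m.+1)) + (2 * n + 1).+1 * m.+1 <= 512 * T].
Proof.
move=> E0 T; rewrite /T; set K := maxn 1 k; set N := maxn 1 (n + k); set M := maxn 1 (m + nl).
have K0 : 0 < K by rewrite /K; lia.
have N0 : 0 < N by rewrite /N; lia.
have M0 : 0 < M by rewrite /M; lia.
(* The constants below give 21 * 3 * 4 * 2 = 504 for the search and 4 * 2 = 8 for the satisfying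
   assignment, together 512. *)
have b1 : (20 * E).+1 <= 21 * E by lia.
have b2 : k.+2 <= 3 * K by rewrite /K; lia.
have b3 : (n + 2).+1 <= 4 * N by rewrite /N; lia.
have b4 : m.+1 <= 2 * M by rewrite /M; lia.
have b5 : (2 * n + 1).+1 <= 4 * N by rewrite /N; lia.
have b6 : m + nl <= M by rewrite /M; lia.
have b7 : k <= N by rewrite /N; lia.
have EK : 0 < E * K by rewrite muln_gt0 E0.
have tM : M <= E * K * N * M by rewrite leq_pmull // muln_gt0 EK.
have tN : N <= E * K * N * M by rewrite -mulnA mulnCA leq_pmulr // muln_gt0 EK.
split; [by rewrite !muln_gt0 E0 K0 N0 | by lia | by lia | ].
have c1 : (20 * E).+1 * (k.+2 * ((n + 2).+1 * m.+1)) <= 21 * E * (3 * K * (4 * N * (2 * M))).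
  by rewrite leq_mul // leq_mul // leq_mul.
have c2 : (2 * n + 1).+1 * m.+1 <= 4 * N * (2 * M) by rewrite leq_mul.
have e1 : 21 * E * (3 * K * (4 * N * (2 * M))) = 504 * (E * K * N * M).
  by rewrite [504]/(21 * (3 * (4 * 2))); lia.
have c3 : N * M <= E * K * N * M by rewrite -[X in _ <= X]mulnA leq_pmull.
lia.
Qed.

Theorem theorem6 :
  exists (prog : cmd) (C : nat),
    forall (F : formula) (L : {fset literal}) (l : literal) (k : nat)
      (w : seq nat),
      aslasat_instance F L l ->
      represents w F L l k ->
      exists (s : state) (t : nat),
        [/\ exec prog (init w) s t,
            t <= C * time_bound F L k,
            (exists S : {fset clause}, culprit_set F L l S /\ #|` S|%fset <= k) ->
            exists S : {fset clause},
              [/\ culprit_set F L l S, #|` S|%fset <= k & outputs_set s S]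
          & ~ (exists S : {fset clause}, culprit_set F L l S /\ #|` S|%fset <= k) ->
            outputs_no s].
Proof.
exists machine, time_constant => F L l k w inst [cs [ls [csF lsL ew]]].
have ew' : w = input cs ls l k by [].
have sw : size w = 5 + 4 * size cs + 2 * size ls.
  by rewrite ew /= size_cat size_code_clauses size_code_literals; lia.
have [|s1 [x1 sim1]] := @prologue_ok w; first by rewrite sw ew.
have wf : hwf program by [].
have [s2 [x2 sim2 _ _]] := comp_correct 0 wf sim1.
set h := run program (hinit w) in sim2.
have [yes no] := program_ok k inst csF lsL; rewrite -ew' -/h in yes no.
have out_le : rg h 30 <= size w.
  by rewrite sw /h ew'; apply: leq_trans (program_out l k cs ls) _; lia.
have [s3 [x3 m3]] := epilogue_ok sim2 out_le.
have x : exec machine (init w) s3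
    (17 + 6 * size w + (cost program (hinit w) + (7 + 6 * rg h 30))).
  by apply: exec_Seq x1 _; apply: exec_Seq x2 x3.
exists s3, (17 + 6 * size w + (cost program (hinit w) + (7 + 6 * rg h 30))); split=> //.
- have sF : size cs = #|` F|%fset.
    case: csF => u e; rewrite -(size_map mkclause); apply/perm_size/uniq_perm => //.
    exact: fset_uniq.
  have sL : size ls = #|` L|%fset.
    by case: lsL => u e; apply/perm_size/uniq_perm => //; exact: fset_uniq.
  have [V [uV sV VF]] := st6_vars l k ls csF.
  have sn : rg (st6 l k cs ls) 28 = #|` fvars F|%fset.
    by rewrite -sV; apply/perm_size/uniq_perm => //; exact: fset_uniq.
  have E0 : 0 < 5 ^ k by rewrite expn_gt0.
  have [B0 B1 B2 B3] := arith_bound #|` F|%fset #|` fvars F|%fset #|` L|%fset k E0.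
  rewrite -/(time_bound F L k) in B0 B1 B2 B3.
  have c0 : cost program (hinit w) = cost setup (hinit w) + (cost stage1 (st1 l k cs ls) +
     (cost bounds (st5 l k cs ls) + cost stage2 (st6 l k cs ls))) by rewrite ew'.
  have [rk rm rl _ [rk1 _ _ _ _]] := st1_reg l k cs ls.
  have f5 : rg (st6 l k cs ls) 5 = rg (st1 l k cs ls) 5 by apply: st6_frame.
  have f9 : rg (st6 l k cs ls) 9 = rg (st1 l k cs ls) 9 by apply: st6_frame.
  have [e1 e2 e3] := st6_bounds l k cs ls.
  have c1 : cost setup (hinit w) <= kcost setup * 1 := @cost_growth setup (hinit w) isT.
  have c2 := @cost_growth stage1 (st1 l k cs ls) isT.
  have c3 : cost bounds (st5 l k cs ls) <= kcost bounds * 1 := @cost_growth bounds _ isT.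
  have c4 := @cost_growth stage2 (st6 l k cs ls) isT.
  have d2 : growth stage1 (rg (st1 l k cs ls)) <= 6 * time_bound F L k.
    by apply: leq_trans (growth_stage1 _) _; rewrite rk rm rl sF sL.
  have d4 : growth stage2 (rg (st6 l k cs ls)) <= 512 * time_bound F L k.
    by apply: leq_trans (growth_stage2 _) _; rewrite f5 f9 e1 e2 e3 rm rk1 sn sF.
  have {}c2 : cost stage1 (st1 l k cs ls) <= 6 * kcost stage1 * time_bound F L k.
    by apply: leq_trans c2 _; rewrite [6 * _]mulnC -mulnA leq_mul2l d2 orbT.
  have {}c4 : cost stage2 (st6 l k cs ls) <= 512 * kcost stage2 * time_bound F L k.
    by apply: leq_trans c4 _; rewrite [512 * _]mulnC -mulnA leq_mul2l d4 orbT.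
  have {}c1 : cost setup (hinit w) <= kcost setup * time_bound F L k.
    by apply: leq_trans c1 _; rewrite leq_mul2l B0 orbT.
  have {}c3 : cost bounds (st5 l k cs ls) <= kcost bounds * time_bound F L k.
    by apply: leq_trans c3 _; rewrite leq_mul2l B0 orbT.
  (* Both copies together take at most [24 + 12 * size w], that is [84 + 48 * m + 24 * |L|]
     steps. *)
  have c5 : 17 + 6 * size w + (7 + 6 * rg h 30) <= 200 * time_bound F L k.
    by move: out_le B0 B1; rewrite sw sF sL; lia.
  rewrite /time_constant c0; move: c1 c2 c3 c4 c5.
  move: (kcost setup) (kcost stage1) (kcost bounds) (kcost stage2) (time_bound F L k).
  move: (cost setup _) (cost stage1 _) (cost bounds _) (cost stage2 _) (6 * size w) (6 * rg h 30).
  move=> C1 C2 C3 C4 a b K1 K2 K3 K4 T h1 h2 h3 h4 h5.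
  rewrite !mulnDl; lia.
- move=> /yes [S [ds [h1 h2 h3 [h4 h4'] h5]]]; exists S; split=> //; exists ds; split=> //.
  move=> i hi; have {}hi : i < 2 + 4 * size ds by move: hi; rewrite size_cat size_code_clauses.
  by rewrite m3 ?h4 // h5.
- by move=> /no [h1 h2]; rewrite /outputs_no m3 ?h1 // h2.
Qed.
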